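(* Let $\lambda$ be a partition and $m\ge 1$. Then the normalized Schur polynomial \[ \mathrm{N}(s_{\lambda}(x_1,\ldots,x_m)) = \sum_{\mu} K_{\lambda\mu}\, \frac{x^\mu}{\mu!} \] is either identically zero or its logarithm is a concave function on the positive orthant $\mathbb{R}^m_{>0}$.
   Context: A partition is a weakly decreasing sequence of nonnegative integers. The Schur polynomial $s_\lambda(x_1,\ldots,x_m)=\sum_{\mathrm{T}} x^{\mu(\mathrm{T})}$ is the sum over all semistandard Young tableaux $\mathrm{T}$ of shape $\lambda$ with entries in $[m]$, where $\mu_i(\mathrm{T})$ is the number of entries equal to $i$ and $x^{\mu}=x_1^{\mu_1}\cdots x_m^{\mu_m}$. The Kostka number $K_{\lambda\mu}$ is the number of such tableaux of weight $\mu$, so $s_\lambda=\sum_\mu K_{\lambda\mu}x^\mu$. The normalization operator $\mathrm{N}$ is the linear operator on polynomials defined by $\mathrm{N}(x^\mu)=\frac{x^\mu}{\mu!}=\frac{x_1^{\mu_1}}{\mu_1!}\cdots\frac{x_m^{\mu_m}}{\mu_m!}$ for all $\mu\in\mathbb{N}^m$. *)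

(* Defs.v *)
From HB Require Import structures.
From mathcomp Require Import all_boot all_order all_algebra.
From mathcomp Require Import mpoly.
From mathcomp Require Import boolp classical_sets reals exp convex.

Set Implicit Arguments.
Unset Strict Implicit.
Unset Printing Implicit Defensive.

Import GRing.Theory Num.Theory.

Local Open Scope ring_scope.

(* Trailing zeros are allowed: they contribute empty rows to the diagram. *)
Definition is_partition (lam : seq nat) : bool := sorted geq lam.

(* Boxes (row, column) of the Young diagram, both coordinates starting at 0. *)
Definition box (lam : seq nat) : finType :=
  {i : 'I_(size lam) & 'I_(nth 0%N lam i)}.

Definition brow (lam : seq nat) (b : box lam) : nat := tag b.
Definition bcol (lam : seq nat) (b : box lam) : nat := tagged b.

Section Tableaux.

Variables (lam : seq nat) (m : nat).

(* The entry set [m] = {1, ..., m} is represented by 'I_m = {0, ..., m - 1}. *)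
Definition filling : finType := {ffun box lam -> 'I_m}.

Definition semistandard (T : filling) : bool :=
  [forall b : box lam, forall c : box lam,
     ((brow b == brow c) && (bcol b <= bcol c)%N ==> (T b <= T c)%N) &&
     ((bcol b == bcol c) && (brow b < brow c)%N ==> (T b < T c)%N)].

Definition weight (T : filling) : 'X_{1..m} :=
  [multinom #|[pred b | T b == i]| | i < m].

Definition kostka (mu : 'X_{1..m}) : nat :=
  #|[pred T : filling | semistandard T && (weight T == mu)]|.

End Tableaux.

Definition schur (R : nzRingType) (m : nat) (lam : seq nat) : {mpoly R[m]} :=
  \sum_(T : filling lam m | semistandard T) 'X_[weight T].

Definition mnm_fact (m : nat) (mu : 'X_{1..m}) : nat :=
  (\prod_(i < m) (mu i)`!)%N.

Section Normalization.

Variables (R : fieldType) (m : nat).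

Definition normalize (p : {mpoly R[m]}) : {mpoly R[m]} :=
  \sum_(mu <- msupp p) (p@_mu / (mnm_fact mu)%:R) *: 'X_[mu].

Lemma mcoeff_normalize (p : {mpoly R[m]}) (mu : 'X_{1..m}) :
  (normalize p)@_mu = p@_mu / (mnm_fact mu)%:R.
Proof.
rewrite /normalize raddf_sum /=; under eq_bigr do rewrite mcoeffZ mcoeffX.
have [mu_p | mu_p] := boolP (mu \in msupp p).
  rewrite (bigD1_seq mu) ?msupp_uniq //= eqxx mulr1 big1 ?addr0 // => nu.
  by move=> /negbTE ->; rewrite mulr0.
rewrite (memN_msupp_eq0 mu_p) mul0r big_seq big1 // => nu nu_p.
case: eqP => [nu_mu | _]; last by rewrite mulr0.
by rewrite -nu_mu nu_p in mu_p.
Qed.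

Lemma normalize_is_linear : linear normalize.
Proof.
move=> a p q; apply/mpolyP => mu.
by rewrite mcoeffD mcoeffZ !mcoeff_normalize mcoeffD mcoeffZ mulrDl mulrA.
Qed.

HB.instance Definition _ :=
  GRing.isLinear.Build R {mpoly R[m]} {mpoly R[m]} _ normalize
    normalize_is_linear.

Lemma normalizeX (mu : 'X_{1..m}) :
  normalize 'X_[mu] = ((mnm_fact mu)%:R)^-1 *: 'X_[mu].
Proof.
apply/mpolyP => nu; rewrite mcoeff_normalize mcoeffZ mcoeffX.
by case: eqP => [->|_]; rewrite ?mul0r ?mulr0 // mulrC.
Qed.

End Normalization.

Definition positive_orthant (R : realType) (m : nat) : set 'rV[R]_m :=
  [set x : 'rV[R]_m | forall i : 'I_m, 0 < x 0 i]%classic.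

Definition poly_fun (R : realType) (m : nat) (p : {mpoly R[m]})
    (x : 'rV[R]_m) : R :=
  p.@[fun i => x 0 i].

Definition concave_function (R : realType) (E : lmodType R) (D : set E)
    (f : E -> R) : Prop :=
  @convex_function R E D (fun x => - f x).

(* As ln is totalized by a junk value outside the positive reals, positivity
   of f on D has to be required for the logarithm of f to make sense there. *)
Definition log_concave_on (R : realType) (E : lmodType R) (D : set E)
    (f : E -> R) : Prop :=
  (forall x, D x -> 0 < f x) /\ concave_function D (fun x => ln (f x)).

(* Main.v *)
Require Import Defs.
From mathcomp Require Import all_boot all_order all_algebra all_fingroup.
From mathcomp Require Import mpoly.
From mathcomp Require Import boolp reals.
From mathcomp Require Import ring lra zify.

Set Implicit Arguments.
Unset Strict Implicit.
Unset Printing Implicit Defensive.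

Import Order.TTheory GRing.Theory Num.Theory.

Local Open Scope ring_scope.

(** The normalized Schur polynomial is the volume polynomial of a Schubert variety, and volume
    polynomials are log-concave by a Brunn-Minkowski argument. The proof makes this elementary, with
    dimensions of function spaces in place of intersection numbers.

    Suppose lambda has at most m = q + 1 rows (otherwise [no_tableaux] makes the polynomial zero)
    and put n = lambda_1 + q. A partition nu is encoded by the staircase b_r = nu_(q-r) + r + 1
    ([bof]). The row span of a matrix Y supported on this staircase is, in general, a q-dimensional
    projective subspace L of P^n in the Schubert variety of nu. For each i a point of L is chosen,
    forced to lie on k_i generic hyperplanes; [phi i s] is its s-th coordinate. [gdim] is the
    generic dimension of the space of functions of multidegree x in these coordinates. When every
    k_i is q, the i-th point is L cut by a linear space of codimension q, powers of its hyperplane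
    class are special Schubert classes, and the Pieri rule gives Kostka numbers as intersection
    numbers. So [gdim] at N x should grow like N^|lambda| F(x), with F the normalized Schur
    polynomial.

    Lower bound ([gdim_lower]): multiplying by a function that vanishes on smaller cells and adding
    functions lifted from those cells gives recursions ([dim_cut], [dim_strip], [dim_plucker]);
    their solution is a sum of products of binomials over Gelfand-Tsetlin patterns.

    Upper bound ([gdim_upper]): for the full rectangle without cuts the number of monomials is
    already sharp. The same recursions, read as H(x) + H'(x) + E(x) <= H(v + x), carry an upper
    bound from H to H' by differentiating the leading form ([asyLe_increment], [asyLe_derivative]).
    The leading forms match because of the dual Pieri rule [gt_pieri].

    Brunn-Minkowski ([gdim_brunn_minkowski]): with all cuts present the cell has a slice with
    coordinates z, on which the functions are polynomials. Their leading exponents are additive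
    under products and contain a translated unit cube, so the discrete inequality [discrete_bm]
    applies. In the limit this gives F(f) F(g) <= F((f+g)/2)^2 ([Fw_midpoint]), and continuity turns
    midpoint concavity of ln F into concavity ([ln_segment]). Finally [sum_tableaux] identifies F
    with the sum over semistandard tableaux. *)

(** * Functions polynomial along lines, and linear independence on a set *)

Section LinePolynomial.
Variables (R : realFieldType) (E : lmodType R).
Implicit Types (f g : E -> R) (Z : E -> Prop).

Lemma poly_nonroot (p : {poly R}) : p != 0 -> exists t, p.[t] != 0.
Proof.
move=> p0; apply: contrapT => H.
have := @max_poly_roots R p [seq i%:R | i <- iota 0 (size p)] p0.
have -> : all (root p) [seq i%:R | i <- iota 0 (size p)].
  apply/allP => x _; apply/rootP/eqP/negP => /negP nx.
  by apply: H; exists x; apply/eqP; move/eqP: nx.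
rewrite map_inj_uniq ?iota_uniq; last by apply: mulrIn; rewrite oner_neq0.
by move=> /(_ isT isT); rewrite size_map size_iota ltnn.
Qed.

(** A coordinate-free substitute for polynomial functions: every density argument below is carried
    out on a single line. *)
Definition linepoly f := forall u v, exists p : {poly R}, forall t, f (u + t *: v) = p.[t].

Definition lineclosed Z := forall u v t, Z u -> Z v -> Z (u + t *: (v - u)).

Lemma linepoly_cst c : linepoly (fun=> c).
Proof. by move=> u v; exists c%:P => t; rewrite hornerC. Qed.

Lemma linepolyD f g : linepoly f -> linepoly g -> linepoly (fun u => f u + g u).
Proof.
move=> lf lg u v; have [p Hp] := lf u v; have [q Hq] := lg u v.
by exists (p + q) => t; rewrite hornerD Hp Hq.
Qed.

Lemma linepolyM f g : linepoly f -> linepoly g -> linepoly (fun u => f u * g u).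
Proof.
move=> lf lg u v; have [p Hp] := lf u v; have [q Hq] := lg u v.
by exists (p * q) => t; rewrite hornerM Hp Hq.
Qed.

Lemma linepoly_sum (I : finType) (F : I -> E -> R) :
  (forall i, linepoly (F i)) -> linepoly (fun u => \sum_i F i u).
Proof.
move=> H u v; have /choice[p Hp] : forall i, exists p : {poly R}, forall t, F i (u + t *: v) = p.[t].
  by move=> i; apply: H.
by exists (\sum_i p i) => t; rewrite horner_sum; apply: eq_bigr => i _; apply: Hp.
Qed.

Lemma linepoly_det k (F : E -> 'M[R]_k) :
  (forall i j, linepoly (fun u => F u i j)) -> linepoly (fun u => \det (F u)).
Proof.
move=> H u v.
have /choice[p Hp] : forall ij : 'I_k * 'I_k,
    exists p : {poly R}, forall t, F (u + t *: v) ij.1 ij.2 = p.[t].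
  by move=> ij; apply: H.
exists (\det (\matrix_(i, j) p (i, j))) => t.
rewrite -[RHS]/(horner_eval t _) -det_map_mx; congr (\det _).
by apply/matrixP => i j; rewrite !mxE; exact: (Hp (i, j) t).
Qed.

(** This is how line-closed sets play the role of irreducible varieties: on the line joining the two
    points both functions restrict to nonzero polynomials, and so does their product. *)
Lemma linepoly_mul_neq0 f g Z u v : linepoly f -> linepoly g -> lineclosed Z ->
  Z u -> f u != 0 -> Z v -> g v != 0 -> exists w, Z w /\ f w * g w != 0.
Proof.
move=> lf lg lZ Zu fu Zv gv.
have [p Hp] := lf u (v - u); have [q Hq] := lg u (v - u).
have p0 : p != 0.
  by apply: contraNneq fu => p0; have := Hp 0; rewrite scale0r addr0 p0 horner0 => ->.
have q0 : q != 0.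
  apply: contraNneq gv => q0; have := Hq 1.
  by rewrite scale1r addrC subrK q0 horner0 => ->.
have [t] := poly_nonroot (mulf_neq0 p0 q0).
rewrite hornerM -Hp -Hq => Ht; exists (u + t *: (v - u)); split => //.
exact: lZ.
Qed.

Definition lfree Z N (f : 'I_N -> E -> R) :=
  forall c : 'I_N -> R, (forall u, Z u -> \sum_i c i * f i u = 0) -> forall i, c i = 0.

(** Independence is detected by finitely many evaluations, which makes it an open condition. As a
    function of the last point the determinant is a combination of the f_i in which one coefficient
    is, up to sign, the smaller determinant, nonzero by induction. *)
Lemma lfree_points Z N (f : 'I_N -> E -> R) : lfree Z f ->
  exists p : 'I_N -> E, (forall j, Z (p j)) /\ \det (\matrix_(i, j) f i (p j)) != 0.
Proof.
elim: N f => [|N IH] f fr.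
  exists (fun _ => 0); split; first by case.
  by rewrite det_mx00 oner_neq0.
have fr' : lfree Z (fun i => f (lift ord_max i)).
  move=> c Hc; pose c' i := oapp c 0 (unlift ord_max i).
  suff H : forall i, c' i = 0 by move=> i; have := H (lift ord_max i); rewrite /c' liftK.
  apply: fr => u Zu; rewrite (bigD1_ord ord_max) //= /c' unlift_none mul0r add0r -[RHS](Hc u Zu).
  by apply: eq_bigr => i _; rewrite liftK.
have [p [Zp dp]] := IH _ fr'.
pose P w (j : 'I_N.+1) := oapp p w (unlift ord_max j).
pose g w := \det (\matrix_(i, j) f i (P w j)).
have gE w : g w = \sum_i cofactor (\matrix_(i, j) f i (P 0 j)) i ord_max * f i w.
  rewrite /g (expand_det_col _ ord_max); apply: eq_bigr => i _; rewrite mulrC; congr (_ * _).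
    rewrite /cofactor; congr (_ * \det _); apply/matrixP => a b; rewrite !mxE.
    by rewrite /P liftK.
  by rewrite mxE /P unlift_none.
have [w [Zw gw]] : exists w, Z w /\ g w != 0.
  apply: contrapT => H.
  have Z0 : forall u, Z u -> \sum_i cofactor (\matrix_(i, j) f i (P 0 j)) i ord_max * f i u = 0.
    move=> u Zu; rewrite -gE; apply/eqP/negP => /negP gu; apply: H; exists u; split => //.
  have /eqP := fr _ Z0 ord_max.
  rewrite /cofactor mulf_eq0 signr_eq0 /=; apply/negP.
  rewrite (_ : row' _ _ = \matrix_(i, j) f (lift ord_max i) (p j)) //.
  by apply/matrixP => a b; rewrite !mxE /P liftK.
exists (P w); split => // j.
by rewrite /P; case: unliftP => [j' _|_] /=.
Qed.

Lemma points_lfree Z N (f : 'I_N -> E -> R) (p : 'I_N -> E) :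
  (forall j, Z (p j)) -> \det (\matrix_(i, j) f i (p j)) != 0 -> lfree Z f.
Proof.
move=> Zp d c Hc i; set M := \matrix_(_, _) _ in d.
have : (\row_j c j) *m M = 0.
  apply/rowP => j; rewrite !mxE -[RHS](Hc _ (Zp j)).
  by apply: eq_bigr => k _; rewrite !mxE.
move/(congr1 (mulmx^~ (invmx M))); rewrite mul0mx mulmxK ?unitmxE ?unitfE //.
by move/rowP => /(_ i); rewrite !mxE.
Qed.

End LinePolynomial.

(** * Multigraded families of functions *)

Section Graded.
Variables (R : realFieldType) (E : lmodType R) (m n : nat).
Variable phi : 'I_m -> 'I_n -> E -> R.
Implicit Types (f g : E -> R) (Z V : E -> Prop) (x y v : 'X_{1..m}).

(** The multidegree counts, for each i, the factors [phi i _]. Working with functions rather than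
    formal polynomials keeps the relations between the [phi i s] implicit. *)
Inductive grade : 'X_{1..m} -> (E -> R) -> Prop :=
| grade0 x : grade x (fun=> 0)
| grade1 : grade 0%MM (fun=> 1)
| gradeM i s x f : grade x f -> grade (U_(i) + x)%MM (fun u => phi i s u * f u)
| gradeD x f g : grade x f -> grade x g -> grade x (fun u => f u + g u)
| gradeZ x c f : grade x f -> grade x (fun u => c * f u).

Lemma grade_ext x y f g : grade x f -> x = y -> f =1 g -> grade y g.
Proof. by move=> H <- /funext <-. Qed.

Lemma grade_mul x y f g : grade x f -> grade y g -> grade (x + y)%MM (fun u => f u * g u).
Proof.
move=> Hf Hg; elim: Hf => {x f} [x||i s x f _ IH|x f h _ IHf _ IHh|x c f _ IH].
- by apply: grade_ext (grade0 (x + y)%MM) _ _ => // u; rewrite mul0r.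
- by apply: grade_ext Hg _ _; rewrite ?add0m // => u; rewrite mul1r.
- by apply: grade_ext (gradeM i s IH) _ _; rewrite ?addmA // => u; rewrite mulrA.
- by apply: grade_ext (gradeD IHf IHh) _ _ => // u; rewrite mulrDl.
- by apply: grade_ext (gradeZ c IH) _ _ => // u; rewrite mulrA.
Qed.

Lemma grade_phi i s : grade U_(i)%MM (phi i s).
Proof. by apply: grade_ext (gradeM i s grade1) _ _; rewrite ?addm0 // => u; rewrite mulr1. Qed.

Lemma grade_sum (I : Type) (r : seq I) (P : pred I) x (F : I -> E -> R) :
  (forall i, P i -> grade x (F i)) -> grade x (fun u => \sum_(i <- r | P i) F i u).
Proof.
move=> H; elim: r => [|i r IH].
  by apply: grade_ext (grade0 x) _ _ => // u; rewrite big_nil.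
case Pi: (P i); last by apply: grade_ext IH _ _ => // u; rewrite big_cons Pi.
by apply: grade_ext (gradeD (H i Pi) IH) _ _ => // u; rewrite big_cons Pi.
Qed.

Lemma grade_prod (I : Type) (r : seq I) (x : I -> 'X_{1..m}) (F : I -> E -> R) :
  (forall i, grade (x i) (F i)) ->
  grade (\big[mnm_add/0%MM]_(i <- r) x i) (fun u => \prod_(i <- r) F i u).
Proof.
move=> H; elim: r => [|i r IH].
  by apply: grade_ext grade1 _ _; rewrite ?big_nil // => u; rewrite big_nil.
by apply: grade_ext (grade_mul (H i) IH) _ _; rewrite ?big_cons // => u; rewrite big_cons.
Qed.

Hypothesis phi_lp : forall i s, linepoly (phi i s).

Lemma grade_linepoly x f : grade x f -> linepoly f.
Proof.
elim => {x f} [x||i s x f _ IH|x f h _ IHf _ IHh|x c f _ IH]; try exact: linepoly_cst.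
- exact: linepolyM.
- exact: linepolyD.
- by apply: linepolyM => //; apply: linepoly_cst.
Qed.

(** The set V of common zeros is carried along because the next gluing step needs the family to
    vanish on the next subcell. *)
Definition fam Z x N V := exists f : 'I_N -> E -> R,
  [/\ forall i, grade x (f i), lfree Z f & forall i u, V u -> f i u = 0].

Definition dge Z x N := fam Z x N (fun=> False).

(** The restriction sequence for Z1 inside Z: a relation restricted to Z1 involves only the first
    family, so its coefficients there vanish, and then the second family is independent on Z. *)
Lemma fam_glue Z1 Z x N1 N2 (V1 V2 V : E -> Prop) :
  fam Z1 x N1 V1 -> fam Z x N2 V2 -> (forall u, Z1 u -> Z u) -> (forall u, Z1 u -> V2 u) ->
  (forall u, V u -> V1 u /\ V2 u) -> fam Z x (N1 + N2) V.
Proof.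
move=> [f [gf ff vf]] [g [gg fg vg]] sZ sV VV.
exists (fun i => match split i with inl j => f j | inr j => g j end); split.
- by move=> i; case: split.
- move=> c Hc.
  have Hc' u : Z u -> \sum_i c (lshift N2 i) * f i u + \sum_i c (rshift N1 i) * g i u = 0.
    move=> Zu; rewrite -[RHS](Hc u Zu) big_split_ord /=; congr (_ + _); apply: eq_bigr => i _.
      by rewrite (unsplitK (inl i)).
    by rewrite (unsplitK (inr i)).
  have cf : forall i, c (lshift N2 i) = 0.
    apply: ff => u Z1u; rewrite -[RHS](Hc' u (sZ u Z1u)).
    rewrite [X in _ + X]big1 ?addr0 // => i _.
    by rewrite (vg _ _ (sV u Z1u)) mulr0.
  have cg : forall i, c (rshift N1 i) = 0.
    apply: fg => u Zu; rewrite -[RHS](Hc' u Zu) [X in _ = X + _]big1 ?add0r // => i _.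
    by rewrite cf mul0r.
  by move=> i; rewrite -(splitK i); case: (split i) => j /=.
- by move=> i u /VV[/vf H1 /vg H2]; case: split.
Qed.

Lemma fam_weak Z x N V V' : fam Z x N V -> (forall u, V' u -> V u) -> fam Z x N V'.
Proof. by move=> [f [gf ff vf]] H; exists f; split => // i u /H; apply: vf. Qed.

Lemma lfree_mul Z N (f : 'I_N -> E -> R) psi : (forall i, linepoly (f i)) -> linepoly psi ->
  lineclosed Z -> lfree Z f -> (exists w, Z w /\ psi w != 0) ->
  lfree Z (fun i u => psi u * f i u).
Proof.
move=> lf lpsi lZ ff [w [Zw pw]] c Hc; apply: ff => u Zu.
apply/eqP/negP => /negP nu.
have lg : linepoly (fun u => \sum_i c i * f i u).
  by apply: linepoly_sum => i; apply: linepolyM => //; apply: linepoly_cst.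
have [z [Zz]] := linepoly_mul_neq0 lpsi lg lZ Zw pw Zu nu.
rewrite mulr_sumr; under eq_bigr do rewrite mulrCA.
by rewrite Hc // eqxx.
Qed.

Lemma fam_mul Z x v N psi V : lineclosed Z -> dge Z x N -> grade v psi ->
  (exists w, Z w /\ psi w != 0) -> (forall u, V u -> psi u = 0) -> fam Z (v + x)%MM N V.
Proof.
move=> lZ [f [gf ff _]] gpsi ex vpsi.
exists (fun i u => psi u * f i u); split.
- by move=> i; apply: grade_mul.
- apply: lfree_mul => //; last exact: grade_linepoly gpsi.
  by move=> i; apply: grade_linepoly (gf i).
- by move=> i u /vpsi ->; rewrite mul0r.
Qed.

Lemma dge_le Z x N N' : (N' <= N)%N -> dge Z x N -> dge Z x N'.
Proof.
move=> le [f [gf ff _]]; exists (fun i => f (widen_ord le i)); split => // c Hc i.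
pose c' (j : 'I_N) := oapp c 0 (insub (val j)).
have c'E j : c' (widen_ord le j) = c j by rewrite /c' /= valK.
rewrite -c'E; apply: ff => u Zu; rewrite -[RHS](Hc u Zu).
rewrite (bigID (fun j : 'I_N => (j < N')%N)) /= [X in _ + X]big1 ?addr0; last first.
  by move=> j; rewrite -leqNgt => jN; rewrite /c' insubF ?mul0r // ltnNge jN.
rewrite (big_ord_narrow le); apply: eq_bigr => j _; rewrite c'E.
by congr (_ * f _ u); apply: val_inj.
Qed.

Lemma dge0 Z x : dge Z x 0.
Proof. by exists (fun _ _ => 0); split => // [[]|c _ []]. Qed.

Lemma dge_one Z : (exists u, Z u) -> dge Z 0%MM 1.
Proof.
move=> [u Zu]; exists (fun _ _ => 1); split => //.
  by move=> _; apply: grade1.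
by move=> c /(_ u Zu); rewrite big_ord1 mulr1 => c0 i; rewrite ord1.
Qed.

(** With more functions than generators the coefficient matrix would have a nonzero left kernel,
    that is, a linear relation. *)
Lemma lfree_span_le Z N (f : 'I_N -> E -> R) (I : finType) (g : I -> E -> R) :
  lfree Z f -> (forall i, exists a : I -> R, forall u, f i u = \sum_j a j * g j u) ->
  (N <= #|I|)%N.
Proof.
move=> ff /choice[a Ha]; rewrite leqNgt; apply/negP => lt.
pose A := \matrix_(i < N, j < #|I|) a i (enum_val j).
have : kermx A != 0.
  by rewrite -mxrank_eq0 mxrank_ker -lt0n subn_gt0 (leq_ltn_trans (rank_leq_col A)).
move=> /matrix0Pn[k [l kl]].
have kA : row k (kermx A) *m A = 0 by rewrite -row_mul mulmx_ker row0.
case/eqP: kl; apply: (ff (fun i => kermx A k i)) => u Zu.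
under eq_bigr do rewrite Ha mulr_sumr.
rewrite exchange_big /= big1 // => j _.
have H : \sum_i kermx A k i * a i j = 0.
  move/matrixP/(_ 0 (enum_rank j)): kA; rewrite !mxE => kA; rewrite -[RHS]kA.
  by apply: eq_bigr => i _; rewrite !mxE enum_rankK.
transitivity ((\sum_i kermx A k i * a i j) * g j u); last by rewrite H mul0r.
rewrite mulr_suml.
by apply: eq_bigr => i _; rewrite mulrA.
Qed.

End Graded.

(** * Dimensions of multigraded pieces *)

Lemma card_compositions n K t :
  (#|[pred g : {ffun 'I_n.+1 -> 'I_K} | (\sum_s g s == t)%N]| <= 'C(n + t, n))%N.
Proof.
rewrite -card_ord_partitions.
pose h (g : {ffun 'I_n.+1 -> 'I_K}) : n.+1.-tuple 'I_t.+1 := [tuple inord (g s) | s < n.+1].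
have le (g : {ffun 'I_n.+1 -> 'I_K}) s : (\sum_s g s == t)%N -> (g s < t.+1)%N.
  by move=> /eqP <-; rewrite ltnS (bigD1 s) //= leq_addr.
rewrite -(card_in_imset (f := h)).
  apply/subset_leq_card/subsetP => _ /imsetP[g gt ->]; rewrite inE /h big_tuple.
  move: gt; rewrite !inE => gt; apply/eqP; rewrite -[RHS](eqP gt); apply: eq_bigr => s _.
  by rewrite tnth_mktuple inordK // le.
move=> g g'; rewrite !inE => Hg Hg' /(congr1 (fun u => tnth u)) E.
apply/ffunP => s; apply: val_inj; have := congr1 (fun u => val (u s)) E.
by rewrite /= !tnth_mktuple !inordK ?le.
Qed.

Section Dim.
Variables (R : realFieldType) (E : lmodType R) (m n : nat).
Variable phi : 'I_m -> 'I_n.+1 -> E -> R.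
Implicit Types (f g : E -> R) (Z V : E -> Prop) (x y v : 'X_{1..m}).

Definition dbound x := (\prod_(i < m) 'C(n + x i, n))%N.

Let mon (c : 'I_m -> 'I_n.+1 -> nat) u := \prod_i \prod_s phi i s u ^+ c i s.

Lemma grade_span_seq x f : grade phi x f ->
  exists l : seq (R * ('I_m -> 'I_n.+1 -> nat)),
    (forall b, List.In b l -> forall i, (\sum_s b.2 i s)%N = x i) /\
    forall u, f u = \sum_(b <- l) b.1 * mon b.2 u.
Proof.
elim => {x f} [x||i s x f _ [l [Hl fE]]|x f h _ [l [Hl fE]] _ [l' [Hl' hE]]|x c f _ [l [Hl fE]]].
- by exists [::]; split => // u; rewrite big_nil.
- exists [:: (1, fun _ _ => 0%N)]; split=> [b [<-|//] i /=|u].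
    by rewrite big1 // mnm0E.
  by rewrite big_seq1 /= mul1r /mon big1 // => i _; rewrite big1.
- pose add (c : 'I_m -> 'I_n.+1 -> nat) j r := (c j r + ((j == i) && (r == s)))%N.
  exists [seq (b.1, add b.2) | b <- l]; split=> [b|u].
    move=> /List.in_map_iff[b' [<- /Hl Hb]] j /=; rewrite /add big_split /= Hb mnmDE mnm1E addnC.
    congr (_ + _)%N; rewrite [i == j]eq_sym; case: (j == i) => /=; last by rewrite big1.
    by rewrite (bigD1 s) //= eqxx big1 ?addn0 // => r /negbTE ->.
  rewrite big_map fE mulr_sumr; apply: eq_bigr => b _ /=; rewrite mulrCA; congr (_ * _).
  rewrite /mon (bigD1 i) //= [RHS](bigD1 i) //= mulrA; congr (_ * _); last first.
    apply: eq_bigr => j /negbTE ji; apply: eq_bigr => r _; by rewrite /add ji addn0.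
  rewrite (bigD1 s) //= [RHS](bigD1 s) //= mulrA; congr (_ * _).
    by rewrite /add !eqxx addn1 exprS.
  by apply: eq_bigr => r /negbTE rs; rewrite /add rs andbF addn0.
- exists (l ++ l'); split=> [b /(@List.in_app_or _ _ _ _)[/Hl|/Hl']//|u].
  by rewrite big_cat fE hE.
- exists [seq (c * b.1, b.2) | b <- l]; split=> [b /List.in_map_iff[b' [<- /Hl]]//|u].
  by rewrite big_map fE mulr_sumr; apply: eq_bigr => b _; rewrite mulrA.
Qed.

(** Counting monomials in n + 1 coordinates for each i. This makes the maximum in [ddim] meaningful,
    and it is the sharp bound from which [rect_upper] starts. *)
Lemma dge_bound Z x N : dge phi Z x N -> (N <= dbound x)%N.
Proof.
move=> [f [gf ff _]].
pose K := (mdeg x).+1; pose T : finType := {ffun 'I_m -> {ffun 'I_n.+1 -> 'I_K}}.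
pose A : pred T := family (fun i => [pred g : {ffun 'I_n.+1 -> 'I_K} | \sum_s g s == x i]%N).
pose g (F : {F : T | A F}) := mon (fun i s => sval F i s).
apply: (@leq_trans #|{: {F : T | A F}}|).
  apply: (lfree_span_le (g := g) ff) => i; have [l [Hl fE]] := grade_span_seq (gf i).
  pose F0 (c : 'I_m -> 'I_n.+1 -> nat) : T := [ffun j => [ffun s => inord (c j s)]].
  have F0E b : List.In b l -> forall j s, F0 b.2 j s = b.2 j s :> nat.
    move=> /Hl Hb j s; rewrite !ffunE inordK // ltnS (leq_trans (_ : _ <= x j)%N) //.
      by rewrite -Hb (bigD1 s) //= leq_addr.
    by rewrite mdegE (bigD1 j) //= leq_addr.
  have AF0 b : List.In b l -> A (F0 b.2).
    move=> bl; apply/familyP => j; rewrite inE; apply/eqP; rewrite -(Hl b bl j).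
    by apply: eq_bigr => s _; rewrite F0E.
  exists (fun F => \sum_(b <- l | F0 b.2 == sval F) b.1) => u; rewrite fE.
  under [RHS]eq_bigr do rewrite mulr_suml.
  rewrite (exchange_big_dep predT) //=.
  elim: l {Hl fE} F0E AF0 => [|b l IH] F0E AF0; first by rewrite !big_nil.
  rewrite !big_cons IH; first last.
  - by move=> b' b'l; apply: AF0; right.
  - by move=> b' b'l; apply: F0E; right.
  congr (_ + _); have Ab : A (F0 b.2) by apply: AF0; left.
  rewrite (big_pred1 (exist (fun F : T => is_true (A F)) (F0 b.2) Ab)) /=; last by move=> F; apply/eqP/eqP => [FE|->//]; apply: val_inj; rewrite /= FE.
  congr (_ * _); rewrite /g /mon /=; apply: eq_bigr => j _; apply: eq_bigr => s _.
  by rewrite F0E //; left.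
rewrite card_sig card_family foldrE big_image /= /dbound.
by apply: leq_prod => i _; apply: card_compositions.
Qed.

Definition ddim Z x : nat := \max_(N < (dbound x).+1 | `[<dge phi Z x N>]) N.

Lemma dgeP Z x N : dge phi Z x N <-> (N <= ddim Z x)%N.
Proof.
split=> [H|].
  have lt : (N < (dbound x).+1)%N by rewrite ltnS (dge_bound H).
  by apply: (leq_bigmax_cond (Ordinal lt)); apply/asboolP.
suff H : dge phi Z x (ddim Z x) by move=> le; apply: dge_le H.
rewrite /ddim; elim/big_ind: _; first exact: dge0.
  by move=> a b Ha Hb; rewrite /maxn; case: ifP.
by move=> i /asboolP.
Qed.

Lemma ddim_bound Z x : (ddim Z x <= dbound x)%N.
Proof. by apply: dge_bound (proj2 (dgeP Z x _) (leqnn _)). Qed.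

End Dim.

(** Frobenius-Konig: by counting, every permutation sends some row of P into Q, so every term of the
    determinant contains a zero. *)
Lemma det_zero_block (R : comNzRingType) N (A : 'M[R]_N) (P Q : {set 'I_N}) :
  (forall i j, i \in P -> j \in Q -> A i j = 0) -> (N < #|P| + #|Q|)%N -> \det A = 0.
Proof.
move=> A0 lt; rewrite /determinant big1 // => s _.
case: (pickP (fun i => (i \in P) && (s i \in Q))) => [i /andP[iP siQ]|H].
  by rewrite (bigD1 i) //= A0 // mul0r mulr0.
exfalso; move: lt; apply/negP; rewrite -leqNgt.
have := subset_leq_card (_ : [set s i | i in P] \subset ~: Q).
rewrite card_imset; last exact: perm_inj.
move=> le; have := cardsC Q; rewrite card_ord => QN; apply: leq_trans (_ : _ <= #|Q| + #|~: Q|)%N _; last by rewrite QN.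
rewrite addnC leq_add2l le //.
by apply/subsetP => _ /imsetP[i iP ->]; rewrite inE; have := H i; rewrite iP /= => ->.
Qed.

(** * Staircase cells and generic cuts *)

Section Cells.
Variables (R : realFieldType) (q m n : nat).

(** The first component Y spans a projective subspace L; the i-th matrix W_i of the second picks the
    point of L with coordinate vector [cofvec] of W_i times Y, whose s-th entry is [phi i s]. *)
Definition Omega : lmodType R :=
  ('M[R]_(q.+1, n.+1) * {ffun 'I_m -> 'M[R]_(q.+1, q)})%type.
Definition cuts : lmodType R := {ffun 'I_m -> 'M[R]_(n.+1, q)}.

Implicit Types (a b : 'I_q.+1 -> nat) (k : 'I_m -> nat) (B : cuts) (x : 'X_{1..m}).

Definition colcat (y : 'I_q.+1 -> R) (W : 'M[R]_(q.+1, q)) : 'M[R]_q.+1 :=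
  \matrix_(r, c) oapp (fun j => W r j) (y r) (unlift ord0 c).

Definition cofvec (W : 'M[R]_(q.+1, q)) (r : 'I_q.+1) : R := (-1) ^+ r * \det (row' r W).

Lemma det_colcat y W : \det (colcat y W) = \sum_r y r * cofvec W r.
Proof.
rewrite (expand_det_col _ ord0); apply: eq_bigr => r _; rewrite mxE unlift_none /=; congr (_ * _).
rewrite /cofactor addn0; congr (_ * \det _).
by apply/matrixP => i j; rewrite !mxE liftK.
Qed.

Definition phi (i : 'I_m) (s : 'I_n.+1) (w : Omega) : R :=
  \det (colcat (fun r => w.1 r s) (w.2 i)).

Lemma linepoly_affine (E : lmodType R) (f : E -> R) : scalar f -> linepoly f.
Proof.
move=> lf u v; exists ((f u)%:P + f v *: 'X) => t.
have fD := lf t v u; rewrite addrC fD hornerD hornerC hornerZ hornerX addrC mulrC.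
by rewrite addrC.
Qed.

Lemma phi_lp i s : linepoly (phi i s).
Proof.
apply: linepoly_det => r c; apply: linepoly_affine => t u v.
have E2 j : (t *: u + v).2 i r j = t * u.2 i r j + v.2 i r j.
  have -> : (t *: u + v).2 = t *: u.2 + v.2 by [].
  by rewrite !ffunE !mxE.
by rewrite !mxE; case: (unlift _ _) => [j|] //; apply: E2.
Qed.

Definition stairs a (Y : 'M[R]_(q.+1, n.+1)) := forall r (s : 'I_n.+1), (a r <= s)%N -> Y r s = 0.

(** The vector [cofvec] of W_i is orthogonal to the columns of W_i. Replacing the first [k i] of
    them by columns of Y B_i therefore puts the i-th point on the [k i] hyperplanes given by columns
    of B_i. *)
Definition cpt k B (Y : 'M[R]_(q.+1, n.+1)) (W : {ffun 'I_m -> 'M[R]_(q.+1, q)}) : Omega :=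
  (Y, [ffun i => \matrix_(r, j) if (j < k i)%N then (Y *m B i) r j else W i r j]).

Definition cell a k B (w : Omega) := exists Y W, stairs a Y /\ w = cpt k B Y W.

Lemma stairs_line a Y Y' t : stairs a Y -> stairs a Y' -> stairs a (Y + t *: (Y' - Y)).
Proof. by move=> H H' r s le; rewrite !mxE H ?H' // subr0 mulr0 addr0. Qed.

Lemma stairs_le a b Y : (forall r, (b r <= a r)%N) -> stairs b Y -> stairs a Y.
Proof. by move=> le H r s ars; apply: H; apply: leq_trans (le r) ars. Qed.

Lemma cell_le a b k B w : (forall r, (b r <= a r)%N) -> cell b k B w -> cell a k B w.
Proof. by move=> le [Y [W [sY ->]]]; exists Y, W; split => //; apply: stairs_le sY. Qed.

Lemma cell_lineclosed a k B : lineclosed (cell a k B).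
Proof.
move=> u v t [Y [W [sY ->]]] [Y' [W' [sY' ->]]].
exists (Y + t *: (Y' - Y)), (W + t *: (W' - W)); split; first exact: stairs_line.
congr (_, _); apply/ffunP => i; rewrite !ffunE; apply/matrixP => r j; rewrite !mxE.
case: ifP => _; last by rewrite ?ffunE ?mxE.
rewrite -sumrN -big_split /= mulr_sumr -big_split /=; apply: eq_bigr => s _.
by rewrite !mxE; ring.
Qed.

Lemma cut_lineE (B B' : cuts) (t : R) i : (B + t *: (B' - B)) i = B i + t *: (B' i - B i).
Proof. by case: B B' => [B] [B']; rewrite [LHS]ffunE ffunE ffunE ffunE. Qed.

Lemma cpt_line k B B' Y W : exists v,
  forall t, cpt k (B + t *: (B' - B)) Y W = cpt k B Y W + t *: v.
Proof.
exists (0, [ffun i => \matrix_(r, j) if (j < k i)%N then (Y *m (B' i - B i)) r j else 0]) => t.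
congr (_, _); first by rewrite /= scaler0 addr0.
apply/ffunP => i; rewrite !ffunE; apply/matrixP => r j; rewrite !mxE.
case: ifP => _; last by rewrite mulr0 addr0.
rewrite mulr_sumr -big_split /=; apply: eq_bigr => s _.
by rewrite !mxE; ring.
Qed.

(* A property of the cuts B holding outside a proper algebraic subset, tested along lines. *)
Definition generic (Q : cuts -> Prop) := (exists B, Q B) /\
  forall B B', Q B -> exists p : {poly R}, p != 0 /\
    forall t, p.[t] != 0 -> Q (B + t *: (B' - B)).

Lemma genericT : generic (fun=> True).
Proof. by split; [exists 0 | move=> B B' _; exists 1; rewrite oner_neq0]. Qed.

(** A common point is found on the line from a P-point to a Q-point; the polynomial for Q is based
    at the other end, hence the substitution of 1 - X. *)
Lemma generic_and (P Q : cuts -> Prop) : generic P -> generic Q -> generic (fun B => P B /\ Q B).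
Proof.
move=> [[B PB] oP] [[B' QB'] oQ]; split; last first.
  move=> C C' [PC QC]; have [p [p0 Hp]] := oP C C' PC; have [r [r0 Hr]] := oQ C C' QC.
  exists (p * r); split=> [|t]; first by rewrite mulf_neq0.
  by rewrite hornerM mulf_eq0 negb_or => /andP[/Hp ? /Hr ?].
have [p [p0 Hp]] := oP B B' PB; have [r [r0 Hr]] := oQ B' B QB'.
have r'0 : r \Po (1 - 'X) != 0.
  apply: contra_neq r0 => /(congr1 (fun s => s \Po (1 - 'X))).
  have E : (1 - 'X) \Po (1 - 'X) = 'X :> {poly R}.
    by rewrite comp_polyB comp_polyX -{1}polyC1 comp_polyC polyC1 opprB addrC subrK.
  by rewrite -comp_polyA E comp_polyXr comp_poly0.
have [t] := poly_nonroot (mulf_neq0 p0 r'0).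
rewrite hornerM mulf_eq0 negb_or => /andP[pt]; rewrite horner_comp !hornerE => rt.
exists (B + t *: (B' - B)); split; first exact: Hp.
rewrite (_ : B + _ = B' + (1 - t) *: (B - B')); first exact: Hr.
by rewrite scalerBl scale1r addrA [B' + (B - B')]addrC subrK -scalerN opprB.
Qed.

Lemma generic_all (I : Type) (l : seq I) (Q : I -> cuts -> Prop) :
  (forall i, generic (Q i)) -> generic (fun B => forall i, List.In i l -> Q i B).
Proof.
move=> H; elim: l => [|i l IH].
  by have := genericT; congr generic; apply/funext => B; apply/propext; split.
have := generic_and (H i) IH; congr generic; apply/funext => B; apply/propext; split.
  by move=> [Qi Ql] j [<-|/Ql].
by move=> Q'; split => [|j jl]; apply: Q'; [left | right].
Qed.

Notation grd := (grade phi).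
Notation dg := (dge phi).
Notation dim := (ddim phi).

(** The largest dimension over all choices of cuts; by [gdim_generic] it is also the generic one. *)
Definition gdim a k x : nat :=
  \max_(N < (@dbound m n x).+1 | `[<exists B, dg (cell a k B) x N>]) N.

Lemma gdim_ge a k B x : (dim (cell a k B) x <= gdim a k x)%N.
Proof.
have lt : (dim (cell a k B) x < (@dbound m n x).+1)%N by rewrite ltnS ddim_bound.
by apply: (leq_bigmax_cond (Ordinal lt)); apply/asboolP; exists B; apply/dgeP.
Qed.

Lemma gdim_ex a k x : exists B, dim (cell a k B) x = gdim a k x.
Proof.
suff [B H] : exists B, dg (cell a k B) x (gdim a k x).
  by exists B; apply/eqP; rewrite eqn_leq gdim_ge /=; apply/dgeP.
rewrite /gdim; elim/big_ind: _; first by exists 0; apply: dge0.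
  by move=> i j Hi Hj; rewrite /maxn; case: ifP.
by move=> i /asboolP.
Qed.

Lemma gdim_bound a k x : (gdim a k x <= @dbound m n x)%N.
Proof. by have [B <-] := gdim_ex a k x; apply: ddim_bound. Qed.

(** Semicontinuity: take a family and points with nonzero evaluation determinant at an optimal B.
    Moving B along a line moves the points along lines, so the determinant is a polynomial in t,
    nonzero at 0; where it does not vanish the dimension stays maximal. *)
Lemma gdim_generic a k x : generic (fun B => dim (cell a k B) x = gdim a k x).
Proof.
split; first exact: gdim_ex.
move=> B B' H; have [f [gf ff _]] : dg (cell a k B) x (gdim a k x).
  by apply/dgeP; rewrite H.
have [p [Zp dp]] := lfree_points ff.
have /choice[YW HYW] : forall j, exists YW, stairs a YW.1 /\ p j = cpt k B YW.1 YW.2.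
  by move=> j; have [Y [W H1]] := Zp j; exists (Y, W).
have /choice[v Hv] : forall j, exists v, forall t,
    cpt k (B + t *: (B' - B)) (YW j).1 (YW j).2 = p j + t *: v.
  by move=> j; rewrite (HYW j).2; apply: cpt_line.
have /choice[P HP] : forall ij, exists P : {poly R}, forall t,
    f ij.1 (p ij.2 + t *: v ij.2) = P.[t].
  by move=> ij; apply: (grade_linepoly phi_lp (gf ij.1)).
pose M := \det (\matrix_(i, j) P (i, j)).
have ME t : M.[t] = \det (\matrix_(i, j) f i (p j + t *: v j)).
  rewrite -[LHS]/(horner_eval t _) -det_map_mx; congr (\det _).
  by apply/matrixP => i j; rewrite !mxE; rewrite (HP (i, j) t).
exists M; split.
  apply: contraNneq dp => M0; have := ME 0; rewrite M0 horner0.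
  move=> /esym H0; apply/eqP; rewrite -[RHS]H0; congr (\det _).
  by apply/matrixP => i j; rewrite !mxE scale0r addr0.
move=> t; rewrite ME => dt; apply/eqP; rewrite eqn_leq gdim_ge /=.
apply/dgeP.
exists f; split => //; apply: points_lfree dt => j.
by rewrite -Hv; exists (YW j).1, (YW j).2; split => //; exact: (HYW j).1.
Qed.

End Cells.

(** * Cutting by one hyperplane *)

Section Steps.
Variables (R : realFieldType) (q m n : nat).

Notation Om := (Omega R q m n).
Notation cuts := (cuts R q m n).
Notation phi := (@phi R q m n).
Notation dim := (ddim phi).
Notation cell := (@cell R q m n).
Notation cpt := (@cpt R q m n).

Implicit Types (a b : 'I_q.+1 -> nat) (k : 'I_m -> nat) (B : cuts) (x v : 'X_{1..m}).
Implicit Types (Z : Om -> Prop).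

(** Functions on the subcell Z1 are multiplied by psi to reach degree v + x, then glued to a family
    on Z that already vanishes on Z1. *)
Lemma dim_glue Z Z1 x v N psi theta V :
  lineclosed Z -> lineclosed Z1 -> (forall u, Z1 u -> Z u) ->
  grade phi v psi -> (exists w, Z1 w /\ psi w != 0) -> (forall u, V u -> psi u = 0) ->
  fam phi Z (v + x)%MM N theta -> (forall u, Z1 u -> theta u) -> (forall u, V u -> theta u) ->
  fam phi Z (v + x)%MM (dim Z1 x + N) V.
Proof.
move=> lZ lZ1 sZ gp ep vp fZ tZ tV.
have d1 : dge phi Z1 x (dim Z1 x) by apply/dgeP.
by apply: (fam_glue (fam_mul (@phi_lp R q m n) lZ1 d1 gp ep vp) fZ) => // u Vu; split => //; apply: tV.
Qed.

Lemma det_colcat_lift (j : 'I_q.+1) :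
  \det (colcat (fun r => (r == j)%:R : R) (\matrix_(r, c) (r == lift j c)%:R)) = (-1) ^+ j.
Proof.
rewrite det_colcat (bigD1 j) //= eqxx mul1r big1 ?addr0 => [|r /negbTE ->]; last by rewrite mul0r.
rewrite /cofvec (_ : row' _ _ = 1%:M) ?det1 ?mulr1 //.
by apply/matrixP => r c; rewrite !mxE (inj_eq lift_inj).
Qed.

Lemma generic_linepoly (T : Type) (P : T -> Prop) (F : T -> cuts -> R) :
  (forall w, linepoly (F w)) -> (exists B w, P w /\ F w B != 0) ->
  generic (fun B => exists w, P w /\ F w B != 0).
Proof.
move=> lF [B [w [Pw Fw]]]; split; first by exists B, w.
move=> {B w Pw Fw} B B' [w [Pw Fw]]; have [p Hp] := lF w B (B' - B).
exists p; split; first by apply: contraNneq Fw => p0; have := Hp 0; rewrite scale0r addr0 p0 horner0 => ->.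
by move=> t pt; exists w; split => //; rewrite Hp.
Qed.

(** The j-th hyperplane of B_i evaluated at the i-th point; [cutdetE] shows that it is linear in the
    coordinates of that point. *)
Definition cutdet B (i : 'I_m) (j : 'I_q) (w : Om) : R :=
  \det (colcat (fun r => (w.1 *m B i) r j) (w.2 i)).

Lemma cutdetE B i j w : cutdet B i j w = \sum_s B i s j * phi i s w.
Proof.
rewrite /cutdet det_colcat; under [RHS]eq_bigr do rewrite /phi det_colcat mulr_sumr.
rewrite exchange_big /=; apply: eq_bigr => r _; rewrite mxE mulr_suml.
by apply: eq_bigr => s _ /=; ring.
Qed.

Lemma grade_cutdet B i j : grade phi U_(i)%MM (cutdet B i j).
Proof.
have -> : cutdet B i j = (fun w => \sum_s B i s j * phi i s w).
  by apply/funext => w; apply: cutdetE.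
by apply: grade_sum => s _; apply/gradeZ/grade_phi.
Qed.

Lemma linepoly_cpt k Y W i r j : linepoly (fun B => (cpt k B Y W).2 i r j).
Proof.
have -> : (fun B => (cpt k B Y W).2 i r j) =
    fun B => if (j < k i)%N then (Y *m B i) r j else W i r j.
  by apply/funext => B; rewrite ffunE mxE.
case: (_ < _)%N; last exact: linepoly_cst.
apply: linepoly_affine => t C D; rewrite !mxE mulr_sumr -big_split /=; apply: eq_bigr => s _.
by rewrite !ffunE !mxE mulrDr mulrCA.
Qed.

Definition cut_ok1 a k (i : 'I_m) (j : 'I_q) B :=
  exists YW, stairs a YW.1 /\ cutdet B i j (cpt k B YW.1 YW.2) != 0.

Definition cut_ok2 a k (i : 'I_m) B :=
  exists YWs, stairs a YWs.1.1 /\ phi i YWs.2 (cpt k B YWs.1.1 YWs.1.2) != 0.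

Let B0 : cuts := [ffun=> \matrix_(s, j) (s == j :> nat)%:R].
Let Y0 : 'M[R]_(q.+1, n.+1) := \matrix_(r, s) (r == s :> nat)%:R.

Lemma stairs_unit a : (forall r : 'I_q.+1, (r < a r)%N) -> stairs a Y0.
Proof.
move=> ha r s ars; rewrite mxE; case: eqP => // rs.
by move: ars; rewrite -rs leqNgt ha.
Qed.

Lemma unit_cut i r j : (q <= n)%N -> (Y0 *m B0 i) r j = (r == j :> nat)%:R.
Proof.
move=> qn; have rn : (r < n.+1)%N by apply: leq_trans (ltn_ord r) _.
rewrite mxE (bigD1 (Ordinal rn)) //= big1 ?addr0; last first.
  by move=> s; rewrite !mxE -val_eqE /= eq_sym => /negbTE ->; rewrite mul0r.
by rewrite !mxE /= eqxx mul1r ffunE mxE.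
Qed.

Lemma cut_ok1_generic a k i (j : 'I_q) : (q <= n)%N -> (forall r : 'I_q.+1, (r < a r)%N) ->
  k i = j -> generic (cut_ok1 a k i j).
Proof.
move=> qn ha kij; rewrite /cut_ok1.
apply: (@generic_linepoly _ (fun YW => stairs a YW.1)
          (fun YW B => cutdet B i j (cpt k B YW.1 YW.2))) => [[Y W]|] /=.
  apply: linepoly_det => r c; have -> : (fun B => colcat (fun r => (Y *m B i) r j)
      ((cpt k B Y W).2 i) r c) = if unlift ord0 c is Some j' then fun B => (cpt k B Y W).2 i r j'
      else fun B => (Y *m B i) r j.
    by apply/funext => B; rewrite mxE; case: (unlift _ _).
  case: (unlift _ _) => [j'|]; first exact: linepoly_cpt.
  apply: linepoly_affine => t C D; rewrite !mxE mulr_sumr -big_split /=; apply: eq_bigr => s _.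
  by rewrite !ffunE !mxE mulrDr mulrCA.
(* The witness takes coordinate hyperplanes as cuts: the first j columns are unit vectors 0 to j - 1
   and the remaining columns of W skip the index j, so [det_colcat_lift] applies. *)
pose jj : 'I_q.+1 := inord j.
have jE : jj = j :> nat by rewrite inordK // ltnW // ltnS.
exists B0, (Y0, [ffun=> \matrix_(r, c) (r == lift jj c)%:R]); split => /=; first exact: stairs_unit.
suff -> : cutdet B0 i j (cpt k B0 Y0 [ffun=> \matrix_(r, c) (r == lift jj c)%:R]) =
    \det (colcat (fun r => (r == jj)%:R : R) (\matrix_(r, c) (r == lift jj c)%:R)).
  by rewrite det_colcat_lift signr_eq0.
rewrite /cutdet; congr (\det _); apply/matrixP => r c; rewrite [LHS]mxE [RHS]mxE.
case: (unlift _ _) => [c'|] /=; last by rewrite unit_cut // -val_eqE /= jE.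
rewrite ffunE [RHS]mxE mxE; case: ifP => lt; last by rewrite ffunE mxE.
by rewrite unit_cut //; congr (_ %:R); rewrite -val_eqE /= /bump jE -kij leqNgt lt.
Qed.

Lemma cut_ok2_generic a k i : (q <= n)%N -> (forall r : 'I_q.+1, (r < a r)%N) -> generic (cut_ok2 a k i).
Proof.
move=> qn ha; rewrite /cut_ok2.
apply: (@generic_linepoly _ (fun YWs : ('M_(q.+1, n.+1) * {ffun 'I_m -> 'M_(q.+1, q)}) * 'I_n.+1
          => stairs a YWs.1.1)
          (fun YWs B => phi i YWs.2 (cpt k B YWs.1.1 YWs.1.2))) => [[[Y W] s]|] /=.
  apply: linepoly_det => r c; have -> : (fun B => colcat (fun r => (cpt k B Y W).1 r s)
      ((cpt k B Y W).2 i) r c) = if unlift ord0 c is Some j' then fun B => (cpt k B Y W).2 i r j'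
      else fun B => Y r s.
    by apply/funext => B; rewrite mxE; case: (unlift _ _).
  by case: (unlift _ _) => [j'|]; [exact: linepoly_cpt | exact: linepoly_cst].
exists B0, (Y0, [ffun=> \matrix_(r, c) (r == lift ord_max c)%:R], inord q); split => /=.
  exact: stairs_unit.
suff -> : phi i (inord q) (cpt k B0 Y0 [ffun=> \matrix_(r, c) (r == lift ord_max c)%:R]) =
    \det (colcat (fun r : 'I_q.+1 => (r == ord_max)%:R : R) (\matrix_(r, c) (r == lift ord_max c)%:R)).
  by rewrite det_colcat_lift signr_eq0.
rewrite /phi; congr (\det _); apply/matrixP => r c; rewrite [LHS]mxE [RHS]mxE.
case: (unlift _ _) => [c'|] /=; last by rewrite mxE -val_eqE /= inordK.
rewrite ffunE [RHS]mxE mxE; case: ifP => lt; last by rewrite ffunE mxE.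
by rewrite unit_cut //; congr (_ %:R); rewrite -val_eqE /= /bump leqNgt ltn_ord.
Qed.

Definition incr k (i : 'I_m) : 'I_m -> nat := fun i' => (k i' + (i' == i))%N.

Lemma cutdet_cell a k B i (j : 'I_q) w : (j < k i)%N -> cell a k B w -> cutdet B i j w = 0.
Proof.
move=> jk [Y [W [_ ->]]]; rewrite /cutdet -det_tr.
apply: (@determinant_alternate _ _ _ ord0 (lift ord0 j)) => // r; rewrite !mxE unlift_none liftK /=.
by rewrite !ffunE !mxE jk.
Qed.

Lemma cell_incr a k i B w : cell a (incr k i) B w -> cell a k B w.
Proof.
move=> [Y [W [sY ->]]]; exists Y, (cpt (incr k i) B Y W).2; split => //.
congr (_, _); apply/ffunP => j; rewrite !ffunE; apply/matrixP => r c; rewrite !mxE /incr.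
by case: (ltnP c (k j)) => [lt|_] //; rewrite (leq_trans lt) ?leq_addr.
Qed.

(** The hyperplane section sequence: multiples of the equation [cutdet] vanish on the section, while
    functions on the section reach the higher degree after multiplication by a coordinate
    [phi i s]. *)
Lemma dim_cut a k i (j : 'I_q) B x : k i = j -> cut_ok1 a k i j B -> cut_ok2 a (incr k i) i B ->
  (dim (cell a k B) x + dim (cell a (incr k i) B) x <= dim (cell a k B) (U_(i) + x)%MM)%N.
Proof.
move=> kij [[Y W] /= [sY n1]] [[[Y' W'] s] /= [sY' n2]].
have d1 : dge phi (cell a k B) x (dim (cell a k B) x) by apply/dgeP.
have f1 : fam phi (cell a k B) (U_(i) + x)%MM (dim (cell a k B) x) (cell a (incr k i) B).
  apply: (fam_mul (@phi_lp R q m n) (@cell_lineclosed _ _ _ _ a k B) d1 (grade_cutdet B i j)).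
    by exists (cpt k B Y W); split => //; exists Y, W.
  by move=> u; apply: cutdet_cell; rewrite /incr eqxx addn1 kij.
rewrite addnC; apply/dgeP.
apply: (dim_glue (psi := phi i s) (theta := cell a (incr k i) B)) => //.
- exact: cell_lineclosed.
- exact: cell_lineclosed.
- exact: cell_incr.
- exact: grade_phi.
- by exists (cpt (incr k i) B Y' W'); split => //; exists Y', W'.
Qed.

Lemma gdim_cut a k i x : (q <= n)%N -> (forall r : 'I_q.+1, (r < a r)%N) -> (k i < q)%N ->
  (gdim R n a k x + gdim R n a (incr k i) x <= gdim R n a k (U_(i) + x)%MM)%N.
Proof.
move=> qn ha kq.
have [[B [<- [<- [n1 n2]]]] _] := generic_and (@gdim_generic R q m n a k x) (generic_and (@gdim_generic R q m n a (incr k i) x)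
  (generic_and (@cut_ok1_generic a k i (Ordinal kq) qn ha erefl) (cut_ok2_generic (incr k i) i qn ha))).
by apply: leq_trans (gdim_ge _ _ B _); apply: dim_cut n1 n2.
Qed.

End Steps.

(** * Removing boxes of a horizontal strip *)

Definition dec (b : nat -> nat) t : nat -> nat := fun r => (b r - (r == t))%N.

(** The first t + 1 rows live in only t columns: those up to t, without [c0]. *)
Lemma det_zero_corner (R : comNzRingType) N (A : 'M[R]_N) (t c0 : 'I_N) :
  (forall r c : 'I_N, (r <= t)%N -> (c == c0) || (t < c)%N -> A r c = 0) -> (c0 <= t)%N -> \det A = 0.
Proof.
move=> A0 c0t; pose P := [set r : 'I_N | (r <= t)%N].
apply: (@det_zero_block _ _ _ P (c0 |: ~: P)) => [r c|].
  by rewrite !inE -ltnNge => rt ct; apply: A0.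
by rewrite cardsU1 !inE c0t /= add1n addnS ltnS cardsC card_ord.
Qed.

Section StripStep.
Variables (R : realFieldType) (q m n : nat).

Notation Om := (Omega R q m n).
Notation cuts := (cuts R q m n).
Notation phi := (@phi R q m n).
Notation dim := (ddim phi).
Notation cpt := (@cpt R q m n).
Notation fullk := (fun _ : 'I_m => q).

Definition ncell (a : nat -> nat) k B := @cell R q m n (fun r => a r) k B.

Implicit Types (a b : nat -> nat) (k : 'I_m -> nat) (B : cuts) (x v : 'X_{1..m}).

(** For staircases of partitions lambda and nu this says lambda_(i+1) <= nu_i <= lambda_i: the skew
    shape lambda/nu is a horizontal strip. *)
Definition interl a b := [/\ (0 < b 0)%N, (forall r, (r < q)%N -> (a r < b r.+1)%N) &
  forall r, (r <= q)%N -> (b r <= a r)%N].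
(** Boxes are removed in order of decreasing row index, so each strip is reached once; j is the row
    being emptied, and j = q also covers the start b = a. *)
Definition level a b j := [/\ (j <= q)%N, (forall r, (r < j)%N -> b r = a r) &
  ((j < q)%N -> (b j < a j)%N)].
Definition removable a b t := if t is t'.+1 then (a t' < (b t).-1)%N else (1 < b 0)%N.

Lemma interl_lt a b r : interl a b -> (r < q)%N -> (b r < b r.+1)%N.
Proof. by move=> [_ H1 H2] rq; apply: leq_ltn_trans (H2 r (ltnW rq)) (H1 r rq). Qed.

Lemma interl_mono a b r r' : interl a b -> (r <= r')%N -> (r' <= q)%N -> (b r <= b r')%N.
Proof.
move=> I; elim: r' => [|r' IH]; first by rewrite leqn0 => /eqP ->.
rewrite leq_eqVlt => /orP[/eqP -> //|]; rewrite ltnS => rr' r'q.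
by apply: leq_trans (IH rr' (ltnW r'q)) (ltnW (interl_lt I r'q)).
Qed.

Lemma interl_smono a b r r' : interl a b -> (r < r')%N -> (r' <= q)%N -> (b r < b r')%N.
Proof.
move=> I rr' r'q; apply: leq_trans (interl_lt I (leq_trans rr' r'q)) _.
exact: interl_mono I rr' r'q.
Qed.

Lemma interl_top a b r : interl a b -> (r < q)%N -> (a r < a r.+1)%N.
Proof. by move=> [_ H1 H2] rq; apply: leq_trans (H1 r rq) (H2 _ rq). Qed.

Lemma interl_topmono a b r r' : interl a b -> (r <= r')%N -> (r' <= q)%N -> (a r <= a r')%N.
Proof.
move=> I; elim: r' => [|r' IH]; first by rewrite leqn0 => /eqP ->.
rewrite leq_eqVlt => /orP[/eqP -> //|]; rewrite ltnS => rr' r'q.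
by apply: leq_trans (IH rr' (ltnW r'q)) (ltnW (interl_top I r'q)).
Qed.

Lemma interl_pos a b r : interl a b -> (r <= q)%N -> (0 < b r)%N.
Proof. by move=> I rq; apply: leq_trans (interl_mono I (leq0n r) rq); case: I. Qed.

Lemma interl_gt a b r : interl a b -> (r <= q)%N -> (r < b r)%N.
Proof.
move=> I; elim: r => [_|r IH rq]; first by case: I.
by apply: leq_ltn_trans (IH (ltnW rq)) (interl_lt I rq).
Qed.

Lemma interl_dec a b j t : interl a b -> level a b j -> (t <= j)%N -> removable a b t ->
  interl a (dec b t) /\ level a (dec b t) t.
Proof.
move=> I [jq Lj Lq] tj rt; have [b0 H1 H2] := I; split.
  split.
  - by rewrite /dec; case: t tj rt => [|t] _ /=; rewrite ?subn1 ?subn0 // => H; case: (b 0) H => [|[]].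
  - move=> r rq; rewrite /dec; case: eqP => [E|_]; rewrite ?subn0 ?H1 //.
    by move: rt; rewrite -E subn1.
  - by move=> r rq; apply: leq_trans (leq_subr _ _) (H2 r rq).
have tq := leq_trans tj jq; split => //.
- by move=> r rt'; rewrite /dec (ltn_eqF rt') subn0 Lj // (leq_trans rt').
- move=> tq'; rewrite /dec eqxx subn1 prednK ?H2 //; exact: interl_pos I tq.
Qed.

Variables (B : cuts) (i0 : 'I_m) (a : nat -> nat).
Hypothesis an : forall r, (r <= q)%N -> (a r <= n.+1)%N.
Hypothesis Bi0 : forall s c, B i0 s c = (s.+1 == a c)%:R.

Let col (e : nat) : 'I_n.+1 := inord e.-1.

Lemma colK (e : nat) : (0 < e)%N -> (e <= n.+1)%N -> (col e).+1 = e.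
Proof. by move=> b0 bn; rewrite inordK prednK. Qed.

Lemma sel_cut (Y : 'M[R]_(q.+1, n.+1)) r (c : 'I_q) : (0 < a c)%N ->
  (Y *m B i0) r c = Y r (col (a c)).
Proof.
move=> a0; have ac : (a c <= n.+1)%N by rewrite an // ltnW.
rewrite mxE (bigD1 (col (a c))) //= Bi0 colK // eqxx mulr1 big1 ?addr0 // => s.
rewrite -val_eqE /= => ne; rewrite Bi0; case: eqP => [E|_]; last by rewrite mulr0.
by case/eqP: ne; apply: succn_inj; rewrite colK.
Qed.

(** Since the cuts of point [i0] select the columns a_c of Y, [phi i0 s] is a minor of Y. In its
    rows 0 to j, column s and the selected columns a_c with c >= j lie beyond the staircase, which
    leaves too few columns. *)
Lemma strip_vanish b j (s : 'I_n.+1) w : interl a b -> level a b j -> ncell b fullk B w ->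
  (b j <= s)%N -> phi i0 s w = 0.
Proof.
move=> I [jq Lj Lq] [Y [W [sY ->]]] bs; rewrite /phi.
have jq1 : (j < q.+1)%N by rewrite ltnS.
apply: (@det_zero_corner _ _ _ (Ordinal jq1) ord0) => //= r c rj.
rewrite mxE; case: unliftP => [c' -> |-> _] /=; last first.
  by apply: sY; apply: leq_trans bs; apply: interl_mono I rj jq.
rewrite /bump /= add1n ltnS => jc.
have a0 : (0 < a c')%N by apply: leq_trans (interl_pos I (ltnW (ltn_ord c'))) _; case: I => _ _; apply; apply: ltnW.
rewrite ffunE mxE ltn_ord sel_cut //; apply: sY.
rewrite -ltnS colK ?an ?(ltnW (ltn_ord c')) //.
have jq' : (j < q)%N by apply: leq_ltn_trans jc (ltn_ord c').
apply: leq_ltn_trans (interl_mono I rj jq) _; apply: leq_trans (Lq jq') _.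
by apply: interl_topmono I jc _; apply: ltnW.
Qed.

(** The minor becomes a signed identity when Y has ones at column b_j in row j and at the columns
    a_c in the other rows: rows before j fit because b agrees with a there, rows after j because a_c
    < b_(c+1). *)
Lemma strip_nonvanish b j : interl a b -> level a b j ->
  exists w, ncell b fullk B w /\ phi i0 (col (b j)) w != 0.
Proof.
move=> I [jq Lj Lq]; have jq1 : (j < q.+1)%N by rewrite ltnS.
pose jj := Ordinal jq1.
have [_ H1 H2] := I.
have apos r : (r <= q)%N -> (0 < a r)%N.
  by move=> rq; apply: leq_trans (interl_pos I rq) (H2 r rq).
have ainj (c c' : 'I_q) : a c = a c' -> c = c'.
  move=> E; apply: val_inj; apply/eqP; rewrite eqn_leq; apply/andP; split; rewrite leqNgt; apply/negP.
    move=> lt; have := leq_trans (interl_top I (ltn_ord c')) (interl_topmono I lt (ltnW (ltn_ord c))).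
    by rewrite E ltnn.
  move=> lt; have := leq_trans (interl_top I (ltn_ord c)) (interl_topmono I lt (ltnW (ltn_ord c'))).
  by rewrite E ltnn.
have abj (c : 'I_q) : (a c == b j) = false.
  apply/eqP => E; have [cj|jc] := ltnP c j.
    have := leq_trans (H1 c (ltn_ord c)) (interl_mono I cj jq); by rewrite E ltnn.
  have jq' : (j < q)%N by apply: leq_ltn_trans jc (ltn_ord c).
  have := leq_trans (Lq jq') (interl_topmono I jc (ltnW (ltn_ord c))).
  by rewrite E ltnn.
pose Y : 'M[R]_(q.+1, n.+1) := \matrix_(r, s)
  (((r == jj) && (s.+1 == b j)) || [exists c : 'I_q, (r == lift jj c) && (s.+1 == a c)])%:R.
have bn : (b j <= n.+1)%N by apply: leq_trans (H2 j jq) (an jq).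
exists (cpt fullk B Y 0); split.
  exists Y, 0; split => // r s brs; rewrite mxE; case: eqP => /= [rj|_].
    have -> : (s.+1 == b j) = false.
      by apply/eqP => E; move: brs; rewrite rj /= -E ltnn.
    case: existsP => // [[c /andP[/eqP E _]]]; by move: (neq_lift jj c); rewrite -E rj eqxx.
  case: existsP => // [[c /andP[/eqP E /eqP sE]]].
  move: brs; rewrite -ltnS sE E /= /bump ltnNge => /negP[].
  case: (leqP j c) => jc; rewrite ?add1n ?add0n.
    exact: ltnW (H1 c (ltn_ord c)).
  by rewrite Lj.
suff -> : phi i0 (col (b j)) (cpt fullk B Y 0) =
    \det (colcat (fun r => (r == jj)%:R : R) (\matrix_(r, c) (r == lift jj c)%:R)).
  by rewrite det_colcat_lift signr_eq0.
rewrite /phi; congr (\det _); apply/matrixP => r c; rewrite [LHS]mxE [RHS]mxE.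
case: (unlift _ _) => [c'|] /=.
  rewrite ffunE mxE ltn_ord sel_cut ?apos ?(ltnW (ltn_ord c')) // !mxE.
  rewrite colK ?apos ?an ?(ltnW (ltn_ord c')) // abj andbF /=; congr (_ %:R).
  case: existsP => [[c1 /andP[/eqP -> /eqP /ainj ->]]|H]; first by rewrite eqxx.
  by case: eqP => // E; case: H; exists c'; rewrite E !eqxx.
rewrite mxE colK ?(interl_pos I) // eqxx andbT.
case: existsP => [[c1 /andP[_ ]]|_]; first by rewrite eq_sym abj.
by rewrite orbF.
Qed.

Lemma ncell_dec b t k w : ncell (dec b t) k B w -> ncell b k B w.
Proof. by apply: cell_le => r; apply: leq_subr. Qed.

(** One box of the Pieri rule. The coordinate at b_j of point [i0] (counting from 1) is nonzero on
    the cell but vanishes on every [dec b t]. On [dec b t] the next multiplier is the coordinate at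
    b_t - 1, which vanishes on [dec b u] for u < t. *)
Lemma dim_strip b j x : interl a b -> level a b j ->
  (dim (ncell b fullk B) x + \sum_(0 <= t < j.+1 | removable a b t) dim (ncell (dec b t) fullk B) x
    <= dim (ncell b fullk B) (U_(i0) + x)%MM)%N.
Proof.
move=> I L; have [jq Lj Lq] := L.
(* The union of the subcells still to be glued in. Induction runs from t = j + 1 down to 0, always
   keeping the family zero on this union. *)
pose V t w := exists u, [/\ (u < t)%N, removable a b u & ncell (dec b u) fullk B w].
suff /(_ j.+1 (leqnn _)) H : forall d, (d <= j.+1)%N -> fam phi (ncell b fullk B) (U_(i0) + x)%MM
    (dim (ncell b fullk B) x +
      \sum_(j.+1 - d <= t < j.+1 | removable a b t) dim (ncell (dec b t) fullk B) x) (V (j.+1 - d)%N).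
  by apply/dgeP; rewrite subnn in H; apply: fam_weak H _ => u [].
have lc b' := @cell_lineclosed R q m n (fun r => b' r) fullk B.
have vanish t u w : (u < t)%N -> (t <= j.+1)%N -> removable a b u -> ncell (dec b u) fullk B w ->
    forall s : 'I_n.+1, ((b u).-1 <= s)%N -> phi i0 s w = 0.
  move=> ut tj ru cw s us; have uj : (u <= j)%N by rewrite -ltnS (leq_trans ut).
  have [I' L'] := interl_dec I L uj ru.
  by apply: strip_vanish I' L' cw _; rewrite /dec eqxx subn1.
elim=> [_|d IH dj].
  rewrite subn0 big_geq // addn0.
  have d1 : dge phi (ncell b fullk B) x (dim (ncell b fullk B) x) by apply/dgeP.
  apply: (fam_mul (@phi_lp R q m n) (lc b) d1 (grade_phi phi i0 (col (b j)))).
    exact: strip_nonvanish.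
  move=> w [u [uj ru cw]]; apply: (vanish j.+1 u) => //.
  rewrite -ltnS colK ?(interl_pos I) //; last by case: I => _ _ H; apply: leq_trans (H j jq) (an jq).
  rewrite prednK ?(interl_pos I) ?(leq_trans _ jq) //.
  exact: interl_mono I _ jq.
have tE : (j.+1 - d = (j.+1 - d.+1).+1)%N by rewrite -subSn.
set t := (j.+1 - d.+1)%N in tE *.
have tj : (t <= j)%N by rewrite -ltnS -tE leq_subr.
have tq : (t <= q)%N := leq_trans tj jq.
have {}IH := IH (ltnW dj); rewrite tE in IH.
rewrite (@big_ltn_cond _ _ _ t) ?ltnS //; case: ifP => rt; last first.
  apply: fam_weak IH _ => w [u [ut ru cw]]; exists u; split => //; exact: ltnW.
have [I' L'] := interl_dec I L tj rt.
rewrite addnCA; apply: (@dim_glue R q m n (ncell b fullk B) (ncell (dec b t) fullk B) x U_(i0)%MM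
   _ (phi i0 (col (b t).-1)) (V t.+1)) => //.
- exact: lc.
- exact: lc.
- by move=> u; apply: ncell_dec.
- exact: grade_phi.
- by have := strip_nonvanish I' L'; rewrite {2}/dec eqxx subn1.
- move=> w [u [ut ru cw]]; apply: (vanish t u) => //; first exact: leqW.
  have bt1 : (0 < (b t).-1)%N by have := interl_pos I' tq; rewrite /dec eqxx subn1.
  have ubt := interl_smono I ut tq.
  have bn : (b t <= n.+1)%N by case: I => _ _ H; apply: leq_trans (H t tq) (an tq).
  rewrite -ltnS colK //; last by lia.
  have := interl_pos I (leq_trans (ltnW ut) tq); lia.
- by move=> u cu; exists t; split.
- by move=> w [u [ut ru cw]]; exists u; split => //; apply: leqW.
Qed.

End StripStep.

(** * Plucker coordinates and Schubert divisors *)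

Definition mone m : 'X_{1..m} := [multinom 1%N | i < m].

Lemma moneE m : mone m = \big[mnm_add/0%MM]_(i < m) U_(i)%MM.
Proof.
apply/mnmP => i; rewrite mnmE mnm_sumE (bigD1 i) //= mnm1E eqxx big1 // => j ji.
by rewrite mnm1E (negbTE ji).
Qed.

Section PluckerStep.
Variables (R : realFieldType) (q n : nat).
Notation m := q.+1.
Notation Om := (Omega R q m n).
Notation cuts := (cuts R q m n).
Notation phi := (@phi R q m n).
Notation dim := (ddim phi).
Notation cpt := (@cpt R q m n).
Notation nocut := (fun _ : 'I_m => 0%N).
Notation cel b B := (@ncell R q m n b nocut B).
Implicit Types (b : nat -> nat) (B : cuts) (x : 'X_{1..m}) (w : Om).

Definition minor (c : 'I_q.+1 -> 'I_n.+1) w : R := \det (\matrix_(i, r) phi i (c r) w).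

Lemma grade_prodphi (c : 'I_q.+1 -> 'I_n.+1) :
  grade phi (mone m) (fun w => \prod_i phi i (c i) w).
Proof. by rewrite moneE; apply: grade_prod => i; apply: grade_phi. Qed.

Lemma grade_minor c : grade phi (mone m) (minor c).
Proof.
have -> : minor c = fun w => \sum_(s : 'S_q.+1) (-1) ^+ s * \prod_i phi i (c (s i)) w.
  apply/funext => w; apply: eq_bigr => s _; congr (_ * _).
  by apply: eq_bigr => i _; rewrite mxE.
by apply: grade_sum => s _; apply/gradeZ/(grade_prodphi (fun i => c (s i))).
Qed.

(** The matrix of point coordinates is the matrix of cofactor vectors times Y. So Plucker
    coordinates of L, up to one common factor, occur in multidegree (1,...,1); this is where exactly
    q + 1 points are wanted. *)
Lemma minorE c w : minor c w =
  \det (\matrix_(i, r) cofvec (w.2 i) r) * \det (\matrix_(r, j) w.1 r (c j)).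
Proof.
rewrite -det_mulmx; congr (\det _); apply/matrixP => i j; rewrite !mxE /phi det_colcat.
by apply: eq_bigr => r _; rewrite !mxE mulrC.
Qed.

Lemma minor_vanish b B (c : 'I_q.+1 -> 'I_n.+1) w (t : 'I_q.+1) : cel b B w ->
  (forall r : 'I_q.+1, (r <= t)%N -> (b r <= b t)%N) ->
  (forall r : 'I_q.+1, (t <= r)%N -> (b t <= c r)%N) -> minor c w = 0.
Proof.
move=> [Y [W [sY ->]]] bm bc; rewrite minorE /= [X in _ * X](@det_zero_corner _ _ _ t t) ?mulr0 // => r j rt jt.
rewrite mxE; apply: sY; apply: leq_trans (bm r rt) (bc j _).
by case/orP: jt => [/eqP ->|/ltnW].
Qed.

(** Chosen so that the i-th point is, up to sign, the i-th row of Y. *)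
Definition stdW : {ffun 'I_m -> 'M[R]_(q.+1, q)} := [ffun i => \matrix_(r, j) (r == lift i j)%:R].

Lemma cofvec_std i r : cofvec (stdW i) r = (-1) ^+ i * (r == i)%:R.
Proof.
have : \det (colcat (fun r' => (r' == r)%:R) (stdW i)) = cofvec (stdW i) r.
  rewrite det_colcat (bigD1 r) //= eqxx mul1r big1 ?addr0 // => r' /negbTE ->.
  by rewrite mul0r.
move=> <-; case: (unliftP i r) => [j ->|->]; last by rewrite eqxx mulr1 ffunE det_colcat_lift.
rewrite [lift i j == i]eq_sym (negbTE (neq_lift i j)) mulr0 -det_tr.
apply: (@determinant_alternate _ _ _ ord0 (lift ord0 j)) => // r'.
by rewrite !mxE unlift_none liftK /= ffunE mxE.
Qed.

Lemma phi_std i s Y W : W = stdW -> phi i s (Y, W) = (-1) ^+ i * Y i s.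
Proof.
move=> ->; rewrite /phi det_colcat (bigD1 i) //= big1 ?addr0 => [|r ri].
  by rewrite cofvec_std eqxx mulr1 mulrC.
by rewrite cofvec_std (negbTE ri) !mulr0.
Qed.

Lemma cpt_nocut B Y W : cpt nocut B Y W = (Y, W).
Proof.
congr (_, _); apply/ffunP => i; rewrite ffunE; apply/matrixP => r j.
by rewrite mxE ltn0.
Qed.

Let col (e : nat) : 'I_n.+1 := inord e.-1.
Let cols b (r : 'I_q.+1) := col (b r).

Let colK (e : nat) : (0 < e)%N -> (e <= n.+1)%N -> (col e).+1 = e.
Proof. by move=> e0 en; rewrite inordK prednK. Qed.

Lemma minor_nonvanish b B : (forall r, (r <= q)%N -> (0 < b r <= n.+1)%N) ->
  (forall r r', (r < r')%N -> (r' <= q)%N -> (b r < b r')%N) ->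
  exists w, cel b B w /\ minor (cols b) w != 0.
Proof.
move=> bb bi; pose Y : 'M[R]_(q.+1, n.+1) := \matrix_(r, s) (s.+1 == b r)%:R.
have bq (r : 'I_q.+1) := bb r (leq_ord r).
exists (Y, stdW); split.
  exists Y, stdW; split; last by rewrite cpt_nocut.
  move=> r s brs; rewrite mxE; case: eqP => // E.
  by move: brs; rewrite -E ltnn.
rewrite minorE mulf_neq0 //.
  rewrite (_ : matrix_of_fun _ _ = diag_mx (\row_i (-1) ^+ i)).
    by rewrite det_diag prodf_seq_neq0; apply/allP => i _ /=; rewrite mxE signr_eq0.
  by apply/matrixP => i r; rewrite !mxE cofvec_std mulr_natr eq_sym.
rewrite (_ : matrix_of_fun _ _ = 1%:M) ?det1 ?oner_neq0 //.
apply/matrixP => r j; rewrite !mxE; congr (_ %:R).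
have /andP[b0 bn] := bq j; rewrite /cols colK //.
case: (ltngtP r j) => rj.
- by rewrite -val_eqE /= (ltn_eqF rj) gtn_eqF // bi // leq_ord.
- by rewrite -val_eqE /= (gtn_eqF rj) ltn_eqF // bi // leq_ord.
- by rewrite (val_inj rj) !eqxx.
Qed.

(** Row 0 is always allowed, even when b_0 = 1: the row then becomes zero and L loses a dimension, a
    boundary component that has to be counted. *)
Definition corner b t := if t is t'.+1 then (b t' < (b t).-1)%N else true.

Variable b : nat -> nat.
Hypothesis q_gt0 : (0 < q)%N.
Hypothesis b0 : (0 < b 0)%N.
Hypothesis blt : forall r, (r < q)%N -> (b r < b r.+1)%N.
Hypothesis bn : (b q <= n.+1)%N.

Lemma bsmono r r' : (r < r')%N -> (r' <= q)%N -> (b r < b r')%N.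
Proof.
elim: r' => // r' IH; rewrite ltnS leq_eqVlt => /orP[/eqP ->|rr'] r'q; first exact: blt.
exact: ltn_trans (IH rr' (ltnW r'q)) (blt r'q).
Qed.

Lemma bmono r r' : (r <= r')%N -> (r' <= q)%N -> (b r <= b r')%N.
Proof. by rewrite leq_eqVlt => /orP[/eqP ->//|rr'] r'q; apply/ltnW/bsmono. Qed.

Lemma bpos r : (r <= q)%N -> (0 < b r)%N.
Proof. by move=> rq; apply: leq_trans (bmono (leq0n r) rq). Qed.

Lemma bbound r : (r <= q)%N -> (b r <= n.+1)%N.
Proof. by move=> rq; apply: leq_trans (bmono rq (leqnn q)) bn. Qed.

Lemma dec_minor_vanish (c : 'I_q.+1 -> 'I_n.+1) (u : 'I_q.+1) B w : cel (dec b u) B w ->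
  (forall r : 'I_q.+1, (u <= r)%N -> (b u <= (c r).+1)%N) -> minor c w = 0.
Proof.
move=> cw H; apply: (minor_vanish (t := u) cw) => r ru; rewrite /dec eqxx subn1.
  case: (ltngtP r u) ru => // [ru _|->]; last by lia.
  by have := bsmono ru (leq_ord u); lia.
by have := H r ru; lia.
Qed.

(** The Plucker coordinate on the columns b_r - 1 is nonzero on the cell and vanishes on each
    boundary cell [dec b t]; the latter are glued in from t = q down to 0, as in [dim_strip]. *)
Lemma dim_plucker B x :
  (dim (cel b B) x + \sum_(0 <= t < q.+1 | corner b t) dim (cel (dec b t) B) x
    <= dim (cel b B) (mone m + x)%MM)%N.
Proof.
pose V t w := exists u, [/\ (u < t)%N, corner b u & cel (dec b u) B w].
suff /(_ q.+1 (leqnn _)) H : forall d, (d <= q.+1)%N -> fam phi (cel b B) (mone m + x)%MM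
    (dim (cel b B) x +
      \sum_(q.+1 - d <= t < q.+1 | corner b t) dim (cel (dec b t) B) x) (V (q.+1 - d)%N).
  by apply/dgeP; rewrite subnn in H; apply: fam_weak H _ => u [].
have lc b' := @cell_lineclosed R q m n (fun r => b' r) nocut B.
have cE r : (r <= q)%N -> (col (b r)).+1 = b r.
  by move=> rq; rewrite colK ?bpos ?bbound.
elim=> [_|d IH dj].
  rewrite subn0 big_geq // addn0.
  have d1 : dge phi (cel b B) x (dim (cel b B) x) by apply/dgeP.
  apply: (fam_mul (@phi_lp R q m n) (lc b) d1 (grade_minor (cols b))).
    apply: minor_nonvanish => [r rq|r r' rr' r'q]; first by rewrite bpos ?bbound.
    exact: bsmono.
  move=> w [u [uj ru cw]]; apply: (@dec_minor_vanish _ (Ordinal uj) B) cw _ => r ur.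
  by rewrite cE ?leq_ord // bmono ?leq_ord.
have tE : (q.+1 - d = (q.+1 - d.+1).+1)%N by rewrite -subSn.
set t := (q.+1 - d.+1)%N in tE *.
have tq : (t <= q)%N by rewrite -ltnS -tE leq_subr.
have {}IH := IH (ltnW dj); rewrite tE in IH.
rewrite (@big_ltn_cond _ _ _ t) ?ltnS //; case: ifP => rt; last first.
  apply: fam_weak IH _ => w [u [ut ru cw]]; exists u; split => //; exact: ltnW.
rewrite addnCA.
have sub u : cel (dec b t) B u -> cel b B u by apply: cell_le => r; apply: leq_subr.
have VV u : V t u -> V t.+1 u by move=> [u' [ut ru cw]]; exists u'; split => //; apply: leqW.
have cV u : cel (dec b t) B u -> V t.+1 u by move=> cu; exists t; split.
case: (posnP t) => [t0|tpos].
  (* At t = 0 nothing remains on which the multiplier has to vanish. Minors are unusable, being zero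
     if row 0 has become zero; a product of coordinates serves, and q > 0 leaves a nonzero row for
     it. *)
  apply: (@dim_glue R q m n (cel b B) (cel (dec b t) B) x (mone m) _
    (fun w => \prod_i phi i ord0 w) (V t.+1) (V t) (lc _) (lc _)) => //.
    exact: (grade_prodphi (fun=> ord0)).
    pose Y : 'M[R]_(q.+1, n.+1) := \matrix_(r, s) ((r == ord_max) && (s == ord0))%:R.
    pose W : {ffun 'I_m -> 'M[R]_(q.+1, q)} := [ffun=> stdW ord_max].
    exists (Y, W); split.
      exists Y, W; split; last by rewrite cpt_nocut.
      move=> r s; rewrite mxE; case: (eqVneq r ord_max) => [->|] //=.
      rewrite /dec t0 eqn0Ngt q_gt0 subn0 => bs.
      by case: eqP => // s0; move: bs; rewrite s0 /= leqNgt bpos.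
    rewrite prodf_seq_neq0; apply/allP => i _ /=; rewrite /phi /= ffunE det_colcat.
    rewrite (bigD1 ord_max) //= big1 ?addr0 => [|r /negbTE rm]; last by rewrite mxE rm mul0r.
    by rewrite mxE !eqxx mul1r cofvec_std eqxx mulr1 signr_eq0.
  by move=> w [u []]; rewrite t0.
apply: (@dim_glue R q m n (cel b B) (cel (dec b t) B) x (mone m) _
  (minor (cols (dec b t))) (V t.+1) (V t) (lc _) (lc _)) => //; first exact: grade_minor.
  have {rt} rt : (b t.-1 < (b t).-1)%N by move: tpos rt; case: (t).
  apply: minor_nonvanish => [r rq|r r' rr' r'q].
    rewrite (leq_trans (leq_subr _ _) (bbound rq)) andbT /dec; case: eqP => [->|_].
      by rewrite subn1; apply: leq_trans rt.
    by rewrite subn0 bpos.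
  rewrite /dec; have := bsmono rr' r'q; case: eqP => [E|_]; case: eqP => [E'|_].
  - by rewrite E E' ltnn.
  - lia.
  - move=> _; rewrite subn0 E' subn1; apply: leq_ltn_trans rt; apply: bmono; lia.
  - by rewrite !subn0.
move=> w [u [ut ru cw]].
have uq : (u < q.+1)%N by rewrite (ltn_trans ut).
apply: (@dec_minor_vanish _ (Ordinal uq) B) cw _ => r /= ur.
have bd : (0 < dec b t r)%N.
  rewrite /dec; case: eqP => [->|_]; last by rewrite subn0 bpos ?leq_ord.
  by rewrite subn1; move: tpos rt; case: (t) => //= t' _; apply: leq_trans.
rewrite colK //; last by apply: leq_trans (leq_subr _ _) (bbound (leq_ord r)).
rewrite /dec; case: eqP => [E|_]; last by rewrite subn0 bmono ?leq_ord.
by rewrite subn1 E; have := bsmono ut tq; lia.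
Qed.

End PluckerStep.

(** Each graded function on the source is the pullback of one on the target: the nonzero scalar c is
    divided out at every factor. Pullbacks of dependent functions are dependent. *)
Lemma dim_pull (R : realFieldType) (E E' : lmodType R) m n (phi : 'I_m -> 'I_n.+1 -> E -> R)
    (phi' : 'I_m -> 'I_n.+1 -> E' -> R) (rho : E' -> E) (c : R) (Z : E -> Prop) (Z' : E' -> Prop) x :
  c != 0 -> (forall i s w, phi i s (rho w) = c * phi' i s w) -> (forall w, Z' w -> Z (rho w)) ->
  (ddim phi' Z' x <= ddim phi Z x)%N.
Proof.
move=> c0 Hphi HZ; apply/dgeP; have /dgeP[f [gf ff _]] := leqnn (ddim phi' Z' x).
have lift y h : grade phi' y h -> exists g, grade phi y g /\ forall w, g (rho w) = h w.
  elim=> {y h} [y||i s y h _ [g [gg gE]]|y h h' _ [g [gg gE]] _ [g' [gg' gE']]|y d h _ [g [gg gE]]].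
  - by exists (fun=> 0); split => //; apply: grade0.
  - by exists (fun=> 1); split => //; apply: grade1.
  - exists (fun u => c^-1 * (phi i s u * g u)); split; first exact/gradeZ/gradeM.
    by move=> w; rewrite Hphi gE !mulrA mulVf // mul1r.
  - by exists (fun u => g u + g' u); split; [exact: gradeD | move=> w; rewrite gE gE'].
  - by exists (fun u => d * g u); split; [exact: gradeZ | move=> w; rewrite gE].
have /choice[g Hg] : forall i, exists g, grade phi x g /\ forall w, g (rho w) = f i w.
  by move=> i; apply: lift.
exists g; split => //; first by move=> i; case: (Hg i).
move=> d Hd; apply: ff => w Zw; rewrite -[RHS](Hd _ (HZ w Zw)).
by apply: eq_bigr => i _; rewrite (Hg i).2.
Qed.

(** * Degenerate staircases and irrelevant cuts *)

Section ZeroRow.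
Variables (R : realFieldType) (q m n : nat).

(** Adds a zero row to Y and a matching unit row and column to each W_i, so that the points are
    unchanged up to sign. *)
Definition addrow (w : Omega R q m n) : Omega R q.+1 m n :=
  (\matrix_(r, s) oapp (fun r' => w.1 r' s) 0 (unlift ord0 r),
   [ffun i => \matrix_(r, j) match unlift ord0 r, unlift ord0 j with
      | Some r', Some j' => w.2 i r' j' | None, None => 1 | _, _ => 0 end]).

Lemma lift_lift0 (r : 'I_q.+1) (j : 'I_q) : lift (lift ord0 r) (lift ord0 j) = lift ord0 (lift r j).
Proof. by apply: val_inj; rewrite /= /bump; lia. Qed.

Lemma lift_lift00 (r : 'I_q.+1) : lift (lift ord0 r) (ord0 : 'I_q.+1) = ord0 :> 'I_q.+2.
Proof. exact: val_inj. Qed.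

Lemma phi_addrow i s w : phi i s (addrow w) = -1 * phi i s w.
Proof.
rewrite /phi !det_colcat big_ord_recl mxE unlift_none /= mul0r add0r mulr_sumr.
apply: eq_bigr => r _; rewrite mxE liftK /=.
suff -> : cofvec ((addrow w).2 i) (lift ord0 r) = -1 * cofvec (w.2 i) r by rewrite mulrCA.
rewrite /cofvec lift0 exprS -mulrA; congr (_ * (_ * _)).
rewrite (expand_det_row _ ord0) big_ord_recl big1 ?addr0 => [|j _]; last first.
  by rewrite !mxE ffunE mxE lift_lift00 unlift_none liftK mul0r.
rewrite !mxE ffunE mxE lift_lift00 !unlift_none mul1r.
rewrite /cofactor addn0 expr0 mul1r; congr (\det _); apply/matrixP => j l; rewrite !mxE.
by rewrite lift_lift0 !liftK.
Qed.

Lemma dim_addrow (b : nat -> nat) B B' x : b 0%N = 0%N ->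
  (ddim (@phi R q m n) (ncell (fun r => b r.+1) (fun=> 0%N) B) x <=
   ddim (@phi R q.+1 m n) (ncell b (fun=> 0%N) B') x)%N.
Proof.
move=> b0; apply: (@dim_pull _ _ _ _ _ _ _ addrow (-1)); first by rewrite oppr_eq0 oner_neq0.
  exact: phi_addrow.
move=> _ [Y [W [sY ->]]]; exists (addrow (cpt (fun=> 0%N) B Y W)).1, (addrow (cpt (fun=> 0%N) B Y W)).2.
split.
  move=> r s /=; rewrite mxE; case: (unliftP ord0 r) => [r' ->|->] //= le.
  exact: sY.
congr (_, _); apply/ffunP => i; rewrite !ffunE; apply/matrixP => r j.
by rewrite [RHS]mxE ltn0.
Qed.

End ZeroRow.

Section Unused.
Variables (R : realFieldType) (q m n : nat).
Notation phi := (@phi R q m n).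

Lemma grade_unused x f (w w' : Omega R q m n) : grade phi x f -> w.1 = w'.1 ->
  (forall i, (0 < x i)%N -> w.2 i = w'.2 i) -> f w = f w'.
Proof.
move=> gf E1; elim: gf => {x f} [//|//|i s x f _ IH|x f g _ IHf _ IHg|x c f _ IH] H.
- rewrite /phi E1 H; last by rewrite mnmDE mnm1E eqxx.
  by rewrite IH // => j xj; apply: H; rewrite mnmDE addn_gt0 xj orbT.
- by rewrite IHf // IHg.
- by rewrite IH.
Qed.

Lemma dim_unused b k (B B' : cuts R q m n) (x : 'X_{1..m}) : (forall i, (0 < x i)%N -> B i = B' i) ->
  (ddim phi (ncell b k B) x <= ddim phi (ncell b k B') x)%N.
Proof.
move=> H; apply/dgeP; have /dgeP[f [gf ff _]] := leqnn (ddim phi (ncell b k B) x).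
exists f; split => // c Hc; apply: ff => _ [Y [W [sY ->]]].
rewrite -[RHS](Hc (cpt k B' Y W)); last by exists Y, W.
apply: eq_bigr => i _; congr (_ * _); apply: (grade_unused (gf i)) => // j xj.
by rewrite !ffunE H.
Qed.

End Unused.

(** * Enumerating strips and weights of patterns *)

Section Strips.

Definition decn (b : nat -> nat) t d : nat -> nat := fun r => (b r - (if r == t then d else 0))%N.

(** Pairs of a number of removed boxes and the resulting staircase, for strips touching rows up to j
    only; the ranges of d are those that keep the interlacing with the outer shape a. *)
Fixpoint below (a : nat -> nat) j (b : nat -> nat) : seq (nat * (nat -> nat)) :=
  if j is j'.+1 then
    flatten [seq [seq ((d + p.1)%N, p.2) | p <- below a j' (decn b j d)] | d <- iota 0 (b j - a j')]
  else [seq (d, decn b 0 d) | d <- iota 0 (b 0)].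

Variables (a : nat -> nat) (D : (nat -> nat) -> nat).

Definition bsum j b (w : nat -> nat) := (\sum_(p <- below a j b) w p.1 * D p.2)%N.

Lemma decn0 b t : decn b t 0 = b.
Proof. by apply/funext => r; rewrite /decn; case: ifP; rewrite subn0. Qed.

Lemma decn_dec b t d : decn b t d.+1 = decn (dec b t) t d.
Proof. by apply/funext => r; rewrite /decn /dec; case: ifP => _; rewrite ?subn0 // -subnDA. Qed.

Lemma bsum0 b w : bsum 0 b w = (\sum_(d <- iota 0 (b 0)) w d * D (decn b 0 d))%N.
Proof. by rewrite /bsum big_map. Qed.

Lemma bsumS j b w : bsum j.+1 b w =
  (\sum_(d <- iota 0 (b j.+1 - a j)) bsum j (decn b j.+1 d) (fun s => w (d + s)))%N.
Proof.
rewrite /bsum /= big_flatten big_map; apply: eq_bigr => d _.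
by rewrite big_map.
Qed.

(** Either nothing is removed, or t is the largest row index touched and one box is peeled off
    there. This is the shape of the recursion in [dim_strip]. *)
Lemma bsum_rec j b w : (0 < b 0)%N -> (forall r, (r < j)%N -> (a r < b r.+1)%N) ->
  bsum j b w = (w 0 * D b + \sum_(0 <= t < j.+1 | removable a b t)
     bsum t (dec b t) (fun s => w s.+1))%N.
Proof.
move=> b0; elim: j => [_|j IH ab].
  rewrite big_mkcond big_nat1 bsum0 -(prednK b0) /= big_cons decn0; congr (_ + _)%N.
  rewrite (iotaDl 1 0) big_map; case: ifP => /= H.
    rewrite bsum0 /dec eqxx subn1 /=; apply: eq_bigr => d _.
    by rewrite add1n decn_dec.
  have -> : (b 0).-1 = 0%N by case: (b 0) b0 H => [|[]].
  by rewrite big_nil.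
rewrite big_mkcond big_nat_recr //= -big_mkcond addnA -IH => [|r rj]; last by apply: ab; apply: ltnW.
have abj := ab j (ltnSn j).
rewrite bsumS -(@prednK (b j.+1 - a j)%N) ?subn_gt0 //= big_cons decn0; congr (_ + _)%N.
rewrite (iotaDl 1 0) big_map; case: ifP => /= H.
  rewrite bsumS /dec eqxx subn1 -!subn1 subnAC; apply: eq_bigr => d _.
  by rewrite add1n decn_dec.
have -> : ((b j.+1 - a j).-1 = 0)%N by move/negbT: H; rewrite -leqNgt; lia.
by rewrite big_nil.
Qed.

End Strips.

Definition strict q (a : nat -> nat) := (0 < a 0)%N /\ forall r, (r < q)%N -> (a r < a r.+1)%N.

Lemma strict_interl q a : strict q a -> interl q a a.
Proof. by case=> a0 H; split. Qed.

Lemma interl_strict q a b : interl q a b -> strict q b.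
Proof. by move=> I; split; [case: I | move=> r rq; apply: interl_lt I rq]. Qed.

Lemma In_mem (T : eqType) (l : seq T) x : List.In x l <-> x \in l.
Proof.
elim: l => //= y l IH; rewrite inE; split=> [[->|/IH ->]|/orP[/eqP ->|/IH]]; rewrite ?eqxx ?orbT //.
  by left.
by right.
Qed.

Lemma In_flatten (T : Type) (l : seq (seq T)) x : List.In x (flatten l) ->
  exists s, List.In s l /\ List.In x s.
Proof.
elim: l => //= s l IH /(@List.in_app_or _ _ _ _)[xs|/IH[s' [? ?]]]; first by exists s; split; [left|].
by exists s'; split; [right|].
Qed.

Lemma below_spec a j b p : List.In p (below a j b) ->
  [/\ forall r, (j < r)%N -> p.2 r = b r, forall r, (p.2 r <= b r)%N, (0 < p.2 0)%N,
      forall r, (r < j)%N -> (a r < p.2 r.+1)%N &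
      p.1 = \sum_(0 <= r < j.+1) (b r - p.2 r)]%N.
Proof.
elim: j b p => [|j IH] b p /=.
  move=> /List.in_map_iff[d [<- /In_mem]]; rewrite mem_iota add0n => /= db.
  split => //=; rewrite /decn.
  - by move=> [|r] //; rewrite subn0.
  - by move=> r; apply: leq_subr.
  - by rewrite eqxx subn_gt0.
  - by rewrite big_nat1 eqxx subKn // ltnW.
move=> /(@In_flatten _ _ p)[s [/List.in_map_iff[d [<- dd]] /List.in_map_iff[p' [<- p'in]]]].
have {p'in} := IH _ _ p'in; move/In_mem: dd.
rewrite mem_iota add0n => /= dH.
move=> [H1 H2 H3 H4 H5] /=; split => //.
- move=> r jr; rewrite H1; last exact: ltnW.
  by rewrite /decn gtn_eqF // subn0.
- by move=> r; apply: leq_trans (H2 r) (leq_subr _ _).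
- move=> r; rewrite ltnS leq_eqVlt => /orP[/eqP ->|/H4//].
  by rewrite H1 // /decn eqxx; lia.
- rewrite big_nat_recr //= H5 addnC; congr (_ + _)%N.
    by apply: eq_big_nat => r /andP[_ rj]; rewrite /decn ltn_eqF // subn0.
  rewrite H1 // /decn eqxx; lia.
Qed.

Lemma below_interl q a b p : interl q a b -> List.In p (below a q b) -> interl q a p.2.
Proof.
move=> [b0 H1 H2] /below_spec[E1 E2 E3 E4 _]; split => //.
by move=> r rq; apply: leq_trans (E2 r) (H2 r rq).
Qed.

(** Weights, with multiplicity, of Gelfand-Tsetlin patterns: the last entry is the size of the
    outermost strip, and the innermost staircase must be that of the empty partition. *)
Fixpoint wts q l (a : nat -> nat) : seq (seq nat) :=
  if l is l'.+1 then flatten [seq [seq rcons M p.1 | M <- wts q l' p.2] | p <- below a q a]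
  else if all (fun r => a r == r.+1) (iota 0 q.+1) then [:: [::]] else [::].

Lemma mem_map_In (T : Type) (U : eqType) (f : T -> U) (l : seq T) u : u \in map f l ->
  exists2 t, List.In t l & u = f t.
Proof.
elim: l => //= t l IH; rewrite inE => /orP[/eqP ->|/IH[t' t'l ->]]; first by exists t => //; left.
by exists t' => //; right.
Qed.

Lemma size_wts q l a M : M \in wts q l a -> size M = l.
Proof.
elim: l a M => [|l IH] a M /=.
  by case: ifP => // _; rewrite inE => /eqP ->.
move=> /flattenP[s /mem_map_In[p _ ->] /mapP[M' M'in ->]].
by rewrite size_rcons (IH p.2).
Qed.

(** * Lower bounds for the dimensions *)

Section LowerBound.
Variables (R : realFieldType) (q m n : nat).
Notation phi := (@phi R q m n).
Notation dim := (ddim phi).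
Notation fullk := (fun _ : 'I_m => q).
Notation cuts := (cuts R q m n).

(** Iterating [dim_strip] t times: both sides follow the same recursion by Pascal's rule, so a strip
    of size s is counted with the binomial of t over s. *)
Lemma dim_binomial (B : cuts) (i0 : 'I_m) a b j x t :
  (forall r, (r <= q)%N -> (a r <= n.+1)%N) ->
  (forall s c, B i0 s c = (s.+1 == a c)%:R) -> interl q a b -> level q a b j ->
  (bsum a (fun nu => dim (ncell nu fullk B) x) j b (fun s => 'C(t, s)) <=
    dim (ncell b fullk B) (U_(i0) *+ t + x)%MM)%N.
Proof.
move=> an Bi0; elim: t b j => [|t IH] b j I L.
  rewrite bsum_rec; first last.
  - by move=> r rj; case: I => _ + _; apply; case: L => jq _ _; apply: leq_trans jq.
  - by case: I.
  rewrite bin0 mul1n mulm0n add0m big1 ?addn0 // => u _.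
  by rewrite /bsum big1 // => p _; rewrite bin0n mul0n.
have Iab r : (r < j)%N -> (a r < b r.+1)%N.
  by move=> rj; case: I => _ + _; apply; case: L => jq _ _; apply: leq_trans jq.
have b0 : (0 < b 0)%N by case: I.
have := dim_strip an Bi0 (U_(i0) *+ t + x)%MM I L.
rewrite addmA -mulmS; apply: leq_trans.
have D0 : (bsum a (fun nu => dim (ncell nu fullk B) x) j b (fun s => 'C(t.+1, s)) =
   bsum a (fun nu => dim (ncell nu fullk B) x) j b (fun s => 'C(t, s)) +
   \sum_(0 <= u < j.+1 | removable a b u)
      bsum a (fun nu => dim (ncell nu fullk B) x) u (dec b u) (fun s => 'C(t, s)))%N.
  rewrite !bsum_rec // !bin0 -addnA; congr (_ + _)%N.
  rewrite -big_split /=; apply: eq_bigr => u _; rewrite /bsum -big_split /=.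
  by apply: eq_bigr => p _; rewrite binS mulnDl.
rewrite D0; apply: leq_add; first exact: IH.
rewrite big_nat_cond [X in (_ <= X)%N]big_nat_cond; apply: leq_sum => u /andP[/andP[_ uj] ru].
have [I' L'] := interl_dec I L uj ru.
exact: IH.
Qed.

Definition xof l (y : nat -> nat) : 'X_{1..m} := [multinom if (i < l)%N then y i else 0%N | i < m].

Lemma dim_wts l a (y : nat -> nat) : (l <= m)%N -> strict q a -> (a q <= n.+1)%N ->
  (\sum_(M <- wts q l a) \prod_(i < l) 'C(y i, nth 0%N M i) <= gdim R n (fun r : 'I_q.+1 => a r) fullk (xof l y))%N.
Proof.
elim: l a => [|l IH] a lm sa an.
  rewrite /=; case: ifP => _; last by rewrite big_nil.
  rewrite big_seq1 big_ord0; apply: leq_trans (gdim_ge _ _ 0 _).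
  have -> : xof 0 y = 0%MM by apply/mnmP => i; rewrite !mnmE.
  apply/dgeP; apply: dge_one; exists (cpt fullk 0 0 0), 0, 0; split => //.
  by move=> r s _; rewrite mxE.
have Iaa := strict_interl sa.
have anr r : (r <= q)%N -> (a r <= n.+1)%N.
  by move=> rq; apply: leq_trans (interl_mono Iaa rq (leqnn q)) an.
pose i0 : 'I_m := Ordinal lm.
have [[B HB] _] := @generic_all R q m n _ (below a q a) (fun p B =>
    dim (ncell p.2 fullk B) (xof l y) = gdim R n (fun r : 'I_q.+1 => p.2 r) fullk (xof l y))
    (fun p => @gdim_generic R q m n (fun r => p.2 r) fullk (xof l y)).
(* Only the cuts of point l are made special. The inner functions have degree 0 in that point, so by
   [dim_unused] their dimensions keep the generic values. *)
pose B' : cuts := [ffun i => if i == i0 then \matrix_(s, c) (s.+1 == a c)%:R else B i].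
have Bi0 s c : B' i0 s c = (s.+1 == a c)%:R by rewrite ffunE eqxx mxE.
have xE : xof l.+1 y = (U_(i0) *+ y l + xof l y)%MM.
  apply/mnmP => i; rewrite mnmE mnmDE mulmnE mnm1E mnmE ltnS -val_eqE /=.
  by case: (ltngtP i l) => [||->]; rewrite ?muln0 ?mul0n ?mul1n ?addn0.
apply: leq_trans (gdim_ge _ _ B' _); rewrite xE.
have lev : level q a a q by split => //; rewrite ltnn.
apply: leq_trans (dim_binomial (xof l y) (y l) anr Bi0 Iaa lev).
rewrite /bsum /= big_flatten big_map.
elim: (below a q a) (fun p => @below_interl q a a p Iaa) HB => [|p bl IHb] pI HB.
  by rewrite !big_nil.
rewrite !big_cons; apply: leq_add; last first.
  by apply: IHb => p' H; [apply: pI; right | apply: HB; right].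
have pin : List.In p (p :: bl) by left.
have Ip := pI p pin; rewrite big_map.
apply: leq_trans (_ : 'C(y l, p.1) * (\sum_(M <- wts q l p.2) \prod_(i < l) 'C(y i, nth 0 M i)) <= _)%N.
  rewrite big_distrr /= leq_eqVlt; apply/orP; left; apply/eqP.
  rewrite big_seq [RHS]big_seq; apply: eq_bigr => M Min.
  have sM := size_wts Min.
  rewrite big_ord_recr /= nth_rcons sM ltnn eqxx mulnC; congr (_ * _)%N.
  by apply: eq_bigr => i _; rewrite nth_rcons sM ltn_ord.
rewrite leq_mul2l; apply/orP; right.
apply: leq_trans (IH p.2 (ltnW lm) (interl_strict Ip) _) _.
  by case: Ip => _ _ H; apply: leq_trans (H q (leqnn q)) an.
rewrite -(HB p pin); apply: dim_unused => i xi; rewrite ffunE.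
case: eqP => // ii0; move: xi; by rewrite mnmE ii0 /= ltnn.
Qed.

End LowerBound.

Section Lower.
Variables (R : realFieldType) (q m n : nat).
Notation phi := (@phi R q m n).
Notation dim := (ddim phi).
Notation ngdim a k x := (gdim R n (fun r : 'I_q.+1 => a r) k x).
Implicit Types (x y : 'X_{1..m}) (k : 'I_m -> nat) (a : nat -> nat).

Lemma strict_gt a r : strict q a -> (r <= q)%N -> (r < a r)%N.
Proof. by move=> /strict_interl; apply: interl_gt. Qed.

Lemma strict_n a : strict q a -> (a q <= n.+1)%N -> (q <= n)%N.
Proof. by move=> sa an; rewrite -ltnS (leq_trans _ an) // strict_gt. Qed.

Lemma mnm_unit x i : (0 < x i)%N -> exists x', x = (U_(i) + x')%MM.
Proof.
move=> xi; exists (x - U_(i))%MM; rewrite addmC submK //; apply/mnm_lepP => j.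
by rewrite mnm1E; case: eqP => // <-.
Qed.

Lemma gdim_mono a k x y : strict q a -> (a q <= n.+1)%N ->
  (ngdim a k x <= ngdim a k (y + x)%MM)%N.
Proof.
move=> sa an; have qn := strict_n sa an.
have ha (r : 'I_q.+1) : (r < a r)%N by apply: strict_gt; rewrite ?leq_ord.
elim: {y}(mdeg y) {-2}y (erefl (mdeg y)) => [|d IH] y yd.
  by move/eqP: yd; rewrite mdeg_eq0 => /eqP ->; rewrite add0m.
have [i yi] : exists i, (0 < y i)%N.
  apply: contrapT => H; suff : mdeg y = 0%N by rewrite yd.
  rewrite mdegE big1 // => i _; apply/eqP; rewrite -leqn0 leqNgt; apply/negP => yi.
  by apply: H; exists i.
have [y' yE] := mnm_unit yi; rewrite yE -addmA.
apply: leq_trans (IH y' _) _; first by move: yd; rewrite yE mdegD mdeg1 => -[].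
have [[B [<- [[[Y W] s] /= [sY ne]]]] _] :=
  generic_and (@gdim_generic R q m n (fun r => a r) k (y' + x)%MM) (@cut_ok2_generic R q m n _ k i qn ha).
apply: leq_trans (gdim_ge _ _ B _); apply/dgeP.
have d1 : dge phi (cell (fun r : 'I_q.+1 => a r) k B) (y' + x)%MM
  (dim (cell (fun r : 'I_q.+1 => a r) k B) (y' + x)%MM) by apply/dgeP.
apply: (fam_mul (@phi_lp R q m n) (@cell_lineclosed _ _ _ _ _ k B) d1 (grade_phi phi i s)) => //.
by exists (cpt k B Y W); split => //; exists Y, W.
Qed.

Definition binsum (W : seq ('I_m -> nat)) (x : 'I_m -> nat) := (\sum_(M <- W) \prod_i 'C(x i, M i))%N.

(** A point with [c i] degrees of freedom left inside L raises the exponent of variable i by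
    [c i]. *)
Definition shifted (c : 'I_m -> nat) (l : seq (seq nat)) : seq ('I_m -> nat) :=
  [seq fun i => (nth 0 M (val i) + c i)%N | M <- l].

Lemma binsum_pascal W (x : 'X_{1..m}) i : (forall M, List.In M W -> (0 < M i)%N) ->
  (binsum W (U_(i) + x)%MM =
   binsum W x + binsum [seq fun j => (M j - (j == i))%N | M <- W] x)%N.
Proof.
move=> H; rewrite /binsum big_map -big_split /=.
elim: W H => [|M W IH] H; first by rewrite !big_nil.
rewrite !big_cons IH; last by move=> M' M'W; apply: H; right.
congr (_ + _)%N; rewrite (bigD1 i) //= [X in (_ = X + _)%N](bigD1 i) //= [X in (_ = _ + X)%N](bigD1 i) //=.
have Mi := H M (or_introl erefl).
rewrite mnmDE mnm1E eqxx add1n -{1}(prednK Mi) binS prednK // subn1 mulnDl.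
by congr (_ * _ + _ * _)%N; apply: eq_bigr => j /negbTE ji; rewrite mnmDE mnm1E eq_sym ji add0n ?subn0.
Qed.

(** Starting from the fully cut case [dim_wts], cuts are taken away one at a time: [gdim_cut] is an
    inequality of exactly the form of Pascal's rule [binsum_pascal], and at degree 0 in an undercut
    variable the binomial sum vanishes. *)
Lemma gdim_lower a k x : strict q a -> (a q <= n.+1)%N -> (forall i, (k i <= q)%N) ->
  (binsum (shifted (fun i => q - k i)%N (wts q m a)) x <= ngdim a k x)%N.
Proof.
move=> sa an; have qn := strict_n sa an.
have ha (r : 'I_q.+1) : (r < a r)%N by apply: strict_gt; rewrite ?leq_ord.
elim: {k}(\sum_i (q - k i))%N {-2}k (erefl (\sum_i (q - k i))%N) x => [|d IH] k kd x kq.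
  have kE : k = (fun=> q).
    apply/funext => i; apply/eqP; rewrite eqn_leq kq /= -subn_eq0.
    by move/eqP: kd; rewrite sum_nat_eq0 => /forallP/(_ i).
  pose y (j : nat) := nth 0%N (x : seq nat) j.
  have yE (i : 'I_m) : y i = x i by rewrite /y -tnth_nth.
  have -> : x = xof m m y by apply/mnmP => i; rewrite mnmE ltn_ord yE.
  rewrite kE; have D := @dim_wts R q m n m a y (leqnn m) sa an.
  apply: leq_trans D.
  rewrite /binsum big_map leq_eqVlt; apply/orP; left; apply/eqP.
  apply: eq_bigr => M _; apply: eq_bigr => i _.
  by rewrite subnn addn0 mnmE ltn_ord.
have [i ki] : exists i, (k i < q)%N.
  apply: contrapT => H; suff : (\sum_i (q - k i) = 0)%N by rewrite kd.
  by rewrite big1 // => i _; apply/eqP; rewrite subn_eq0 leqNgt; apply/negP => ki; apply: H; exists i.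
elim: {x}(x i) {-2}x (erefl (x i)) => [|t IHt] x xt.
  rewrite /binsum big_map big1 // => M _; rewrite (bigD1 i) //= xt bin0n addn_eq0.
  by rewrite subn_eq0 leqNgt ki andbF mul0n.
have [x' xE] : exists x', x = (U_(i) + x')%MM by apply: mnm_unit; rewrite xt.
rewrite xE binsum_pascal; last first.
  by move=> M /List.in_map_iff[M' [<- _]]; rewrite addn_gt0 subn_gt0 ki orbT.
apply: leq_trans (gdim_cut R x' qn ha ki).
apply: leq_add; first by apply: IHt; move: xt; rewrite xE mnmDE mnm1E eqxx => -[].
rewrite (_ : [seq _ | M <- _] = shifted (fun j => q - incr k i j)%N (wts q m a)).
  apply: IH => [|j]; last by rewrite /incr; case: eqP => [->|_]; rewrite ?addn0 // addn1.
  apply: succn_inj; rewrite -kd (bigD1 i) //= [RHS](bigD1 i) //= /incr eqxx addn1 -addSn.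
  congr (_ + _)%N; first by rewrite subnS prednK // subn_gt0.
  by apply: eq_bigr => j /negbTE ->; rewrite addn0.
rewrite /shifted -map_comp; apply: eq_map => M; apply/funext => j /=.
rewrite /incr; case: eqP => [->|_]; rewrite ?addn0 ?subn0 // addn1 subnS.
by rewrite subn1 -[in RHS](prednK (_ : 0 < q - k i)%N) ?subn_gt0 //= -{1}(prednK (_ : 0 < q - k i)%N) ?subn_gt0 // addnS.
Qed.

End Lower.

Section PluckerLower.
Variables (R : realFieldType) (q n : nat).
Notation m := q.+1.
Notation nocut := (fun _ : 'I_m => 0%N).
Notation ngdim a x := (gdim R n (fun r : 'I_q.+1 => a r) nocut x).
Implicit Types (x y : 'X_{1..m}) (a b : nat -> nat).

Lemma gdim_nocut b B x : ngdim b x = ddim (@phi R q m n) (ncell b nocut B) x.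
Proof.
have [B' <-] := gdim_ex R n (fun r : 'I_q.+1 => b r) nocut x.
by rewrite (_ : cell _ nocut B' = ncell b nocut B).
Qed.

(** When b_0 = 0 the subspace has dimension q - 1, so the remaining rows are used and each point has
    q - 1 degrees of freedom. *)
Definition Wlist b : seq ('I_m -> nat) :=
  if b 0%N == 0%N then shifted (fun=> q.-1) (wts q.-1 m (fun r => b r.+1))
  else shifted (fun=> q) (wts q m b).

Lemma gdim_Wlist b x : (0 < q)%N -> (b q <= n.+1)%N -> (forall r, (r < q)%N -> (b r < b r.+1)%N) ->
  (binsum (Wlist b) x <= ngdim b x)%N.
Proof.
move=> q0 bn blt; rewrite /Wlist; case: eqP => [b0|/eqP]; last first.
  rewrite -lt0n => b0; apply: leq_trans (gdim_lower R x (conj b0 blt) bn (fun=> leq0n _)).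
  by rewrite leq_eqVlt; apply/orP; left; apply/eqP; congr binsum; congr shifted; apply/funext => i; rewrite subn0.
rewrite (gdim_nocut b 0); case: q q0 b0 bn blt x => // q' _ b0 bn blt x.
have sb : strict q' (fun r => b r.+1).
  by split; [have := blt 0%N isT; rewrite b0 | move=> r rq; apply: blt].
have D := @gdim_lower R q' q'.+2 n (fun r => b r.+1) (fun=> 0%N) x sb bn (fun=> leq0n _).
apply: (leq_trans (leq_trans _ D)).
  by rewrite leq_eqVlt; apply/orP; left; apply/eqP; congr binsum; congr shifted; apply/funext => i; rewrite subn0.
have [B <-] := gdim_ex R n (fun r : 'I_q'.+1 => b r.+1) (fun _ : 'I_q'.+2 => 0%N) x.
exact: dim_addrow.
Qed.

Lemma gdim_plucker b t x : (0 < q)%N -> strict q b -> (b q <= n.+1)%N -> (t <= q)%N -> corner b t ->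
  (ngdim b x + ngdim (dec b t) x +
     binsum (flatten [seq Wlist (dec b u) | u <- iota 0 q.+1 & corner b u && (u != t)]) x
   <= ngdim b (mone m + x)%MM)%N.
Proof.
move=> q0 [b0 blt] bn tq ct; rewrite (gdim_nocut b 0) (gdim_nocut b 0) (gdim_nocut (dec b t) 0).
apply: leq_trans (dim_plucker q0 b0 blt bn 0 x); rewrite -addnA leq_add2l.
rewrite -big_filter (bigD1_seq t) ?filter_uniq ?iota_uniq ?mem_filter ?mem_index_iota ?ltnS ?ct ?tq //.
rewrite leq_add2l big_filter_cond /binsum big_flatten big_map big_filter /index_iota subn0.
rewrite big_seq_cond [X in (_ <= X)%N]big_seq_cond; apply: leq_sum => u.
rewrite mem_iota add0n ltnS => /and3P[/andP[_ uq] cu _].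
rewrite -gdim_nocut; apply: gdim_Wlist => //.
  by apply: leq_trans (leq_subr _ _) bn.
move=> r rq; rewrite /dec; have := blt r rq; case: eqP => [E|_]; case: eqP => [E'|_].
- by lia.
- by lia.
- by move: cu; rewrite -E' /=; lia.
- by rewrite !subn0.
Qed.

End PluckerLower.

(** * Leading asymptotics and their differentiation *)

Section Asymptotics.
Variable R : archiRealFieldType.
Implicit Types (u v : nat -> R) (k l : nat) (a b e : R).

(** This is u(N) = a N^k + O(N^(k-1)), multiplied by N so that k = 0 needs no negative exponent. *)
Definition asy k a u := exists2 K, 0 <= K & forall N, (0 < N)%N ->
  `|u N - a * N%:R ^+ k| * N%:R <= K * N%:R ^+ k.

Lemma asy_ext k a u v : u =1 v -> asy k a u -> asy k a v.
Proof. by move=> uv [K K0 H]; exists K => // N N0; rewrite -uv; apply: H. Qed.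

Lemma asy_mon k a : asy k a (fun N => a * N%:R ^+ k).
Proof. by exists 0 => // N _; rewrite subrr normr0 !mul0r. Qed.

Lemma asyD k a b u v : asy k a u -> asy k b v -> asy k (a + b) (fun N => u N + v N).
Proof.
move=> [K K0 H] [L L0 H']; exists (K + L); first exact: addr_ge0.
move=> N N0; rewrite [(K + L) * _]mulrDl; apply: le_trans (lerD (H N N0) (H' N N0)); rewrite -mulrDl ler_wpM2r //.
by rewrite (_ : _ - _ = (u N - a * N%:R ^+ k) + (v N - b * N%:R ^+ k)) ?ler_normD //; ring.
Qed.

Lemma asyM k l a b u v : asy k a u -> asy l b v -> asy (k + l) (a * b) (fun N => u N * v N).
Proof.
move=> [K K0 H] [L L0 H']; exists ((`|a| + K) * L + `|b| * K).
  by rewrite addr_ge0 // mulr_ge0 // addr_ge0.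
move=> N N0; have := H N N0; have := H' N N0; rewrite exprD.
set X := N%:R ^+ k; set Y := N%:R ^+ l => HB HA.
have N1 : 1 <= N%:R :> R by rewrite ler1n.
have X0 : 0 <= X by rewrite exprn_ge0. have Y0 : 0 <= Y by rewrite exprn_ge0.
have uX : `|u N| <= (`|a| + K) * X.
  rewrite (_ : u N = (u N - a * X) + a * X); last by ring.
  apply: le_trans (ler_normD _ _) _; rewrite normrM (ger0_norm X0) addrC mulrDl lerD2l.
  by apply: le_trans HA; rewrite ler_peMr.
rewrite (_ : _ - _ = u N * (v N - b * Y) + b * Y * (u N - a * X)); last by ring.
apply: le_trans (_ : (`|u N| * `|v N - b * Y| + `|b| * Y * `|u N - a * X|) * N%:R <= _).
  rewrite ler_wpM2r //; apply: le_trans (ler_normD _ _) _.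
  by rewrite !normrM (ger0_norm Y0).
rewrite mulrDl -!mulrA mulrDl; apply: lerD.
  apply: le_trans (ler_wpM2l (normr_ge0 _) HB) _.
  apply: le_trans (ler_wpM2r _ uX) _; first by rewrite mulr_ge0.
  by rewrite le_eqVlt; apply/orP; left; apply/eqP; ring.
have := ler_wpM2l (mulr_ge0 (normr_ge0 b) Y0) HA.
by rewrite -!mulrA (_ : `|b| * (K * _) = `|b| * (Y * (K * X))) //; ring.
Qed.

Lemma asyZ k a b u : asy k a u -> asy k (b * a) (fun N => b * u N).
Proof.
move=> /(asyM (asy_mon 0 b)); apply: asy_ext => N; by rewrite expr0 mulr1.
Qed.

Lemma asy_sum (T : Type) (r : seq T) k (a : T -> R) (u : T -> nat -> R) :
  (forall t, List.In t r -> asy k (a t) (u t)) ->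
  asy k (\sum_(t <- r) a t) (fun N => \sum_(t <- r) u t N).
Proof.
elim: r => [|t r IH] H.
  rewrite big_nil; apply: asy_ext (asy_mon k 0) => N; by rewrite big_nil mul0r.
rewrite big_cons; apply: asy_ext (asyD (H t (or_introl erefl)) (IH _)) => [N|t' t'r].
  by rewrite big_cons.
by apply: H; right.
Qed.

Lemma asy_prod m (k : 'I_m -> nat) (a : 'I_m -> R) (u : 'I_m -> nat -> R) :
  (forall i, asy (k i) (a i) (u i)) -> asy (\sum_i k i) (\prod_i a i) (fun N => \prod_i u i N).
Proof.
move=> H; elim: (index_enum _) => [|i r IH].
  by rewrite !big_nil; apply: asy_ext (asy_mon 0 1) => N; rewrite big_nil expr0 mulr1.
by rewrite !big_cons; apply: asy_ext (asyM (H i) IH) => N; rewrite big_cons.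
Qed.

Lemma asy_lin a c : asy 1 a (fun N => a * N%:R + c).
Proof. by exists `|c| => // N _; rewrite expr1 addrAC subrr add0r. Qed.

Lemma asyX k a u l : asy k a u -> asy (l * k) (a ^+ l) (fun N => u N ^+ l).
Proof.
move=> H; elim: l => [|l IH]; first by apply: asy_ext (asy_mon 0 1) => N; rewrite !expr0 mulr1.
by rewrite mulSn exprS; apply: asy_ext (asyM H IH) => N; rewrite exprS.
Qed.

Lemma asy_bin (c x k : nat) : asy k (x%:R ^+ k / k`!%:R) (fun N => 'C(c + x * N, k)%:R).
Proof.
have F0 : k`!%:R != 0 :> R by rewrite pnatr_eq0 -lt0n fact_gt0.
suff H : forall k, asy k (x%:R ^+ k) (fun N => ((c + x * N) ^_ k)%:R).
  rewrite mulrC; apply: asy_ext (asyZ (k`!%:R)^-1 (H k)) => N.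
  by rewrite -bin_ffact natrM mulrC mulfK.
elim=> {k F0} [|k IH].
  by apply: asy_ext (asy_mon 0 (x%:R ^+ 0)) => N; rewrite ffactn0 expr0 mulr1.
rewrite exprSr -addn1; apply: asy_ext (asyM IH (_ : asy 1 x%:R (fun N => (c + x * N - k)%:R))) => [N|].
  by rewrite addn1 ffactnSr natrM.
exists (c + k)%:R => // N N0; rewrite expr1 ler_wpM2r // -natrM.
have [H|H] := leqP k (c + x * N).
  rewrite natrB // natrD ler_norml; have := ler0n R c; have := ler0n R k; rewrite natrD; lra.
rewrite (_ : _ - k = 0)%N; last by lia.
by rewrite sub0r normrN normr_nat ler_nat; lia.
Qed.

Lemma asy_near k a u e : asy k a u -> 0 < e ->
  exists N0, forall N, (N0 <= N)%N -> `|u N - a * N%:R ^+ k| <= e * N%:R ^+ k.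
Proof.
move=> [K K0 H] e0; exists (Num.bound (K / e)).+1 => N NN.
have N0 : (0 < N)%N by apply: leq_trans NN.
have KN : K <= e * N%:R.
  rewrite mulrC -ler_pdivrMr //; apply: ltW; apply: lt_le_trans (archi_boundP _) _.
    by rewrite divr_ge0 // ltW.
  by rewrite ler_nat; apply: leq_trans NN.
have N0' : 0 < N%:R :> R by rewrite ltr0n.
rewrite -(ler_pM2r N0'); apply: le_trans (H N N0) _.
rewrite (_ : e * _ * _ = (e * N%:R) * N%:R ^+ k); last by ring.
by rewrite ler_wpM2r // exprn_ge0.
Qed.

Variable m : nat.
Implicit Types (H E : 'X_{1..m} -> nat) (F : 'X_{1..m} -> R) (x y : 'X_{1..m}).

Definition asyLe H k F := forall x e, 0 < e -> exists N0, forall N, (N0 <= N)%N ->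
  (H (x *+ N)%MM)%:R <= (F x + e) * N%:R ^+ k.
Definition asyGe H k F := forall x e, 0 < e -> exists N0, forall N, (N0 <= N)%N ->
  (F x - e) * N%:R ^+ k <= (H (x *+ N)%MM)%:R.
Definition mono H := forall x y, (H x <= H (y + x)%MM)%N.

Lemma asy_asyLe H k F : (forall x, asy k (F x) (fun N => (H (x *+ N)%MM)%:R)) -> asyLe H k F.
Proof.
move=> A x e e0; have [N0 HN] := asy_near (A x) e0; exists N0 => N /HN.
by rewrite ler_norml mulrDl lerBlDl => /andP[].
Qed.

Lemma asy_asyGe H k F : (forall x, asy k (F x) (fun N => (H (x *+ N)%MM)%:R)) -> asyGe H k F.
Proof.
move=> A x e e0; have [N0 HN] := asy_near (A x) e0; exists N0 => N /HN.
by rewrite ler_norml mulrBl lerBrDl => /andP[].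
Qed.

Lemma asyLe_bound H H' k F F' : (forall x, (H' x <= H x)%N) -> (forall x, F x <= F' x) ->
  asyLe H k F -> asyLe H' k F'.
Proof.
move=> HH FF A x e e0; have [N0 HN] := A x e e0; exists N0 => N /HN L.
apply: le_trans (le_trans L _); first by rewrite ler_nat.
by rewrite ler_wpM2r ?exprn_ge0 // lerD2r.
Qed.

Lemma asyGe_bound H H' k F : (forall x, (H x <= H' x)%N) -> asyGe H k F -> asyGe H' k F.
Proof.
by move=> HH A x e e0; have [N0 HN] := A x e e0; exists N0 => N /HN L; apply: le_trans L _; rewrite ler_nat.
Qed.

(** Summing the increment inequality z times from y = z p x and using monotonicity gives H(y) + z
    (H'(y) + E(y)) <= H(z (v + p x)). Bounding H on both sides by its leading form F and E by G
    bounds H' by a difference of F at scale p, which for large p is close to the derivative F'. *)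
Lemma asyLe_increment H H' E k F F' (G : 'X_{1..m} -> R) (v : 'X_{1..m}) :
  (forall x, (H x + H' x + E x <= H (v + x)%MM)%N) -> mono H' -> mono E ->
  asyLe H k.+1 F -> asyGe H k.+1 F -> asyGe E k G -> (forall x, 0 <= F' x) ->
  (forall x e, 0 < e -> exists2 p, (0 < p)%N &
     F (v + x *+ p)%MM - F (x *+ p)%MM - G (x *+ p)%MM <= p%:R ^+ k * (F' x + e)) ->
  asyLe H' k F'.
Proof.
move=> inc mH mE UF LF LG F0 mv x e e0.
(* Two portions d are lost in the difference estimate and a third in replacing (N + p)^k by N^k. *)
pose d := e / 4%:R; have d0 : 0 < d by rewrite divr_gt0.
have [p p0 Hp] := mv x d d0.
have d3 : 0 < d / 3%:R by rewrite divr_gt0.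
have [N1 H1] := UF (v + x *+ p)%MM _ d3.
have [N2 H2] := LF (x *+ p)%MM _ d3.
have [N3 H3] := LG (x *+ p)%MM _ d3.
have F2 : 0 < F' x + 2%:R * d by rewrite ltr_wpDl // mulr_gt0.
have asyp : asy (k * 1) (1 ^+ k) (fun N => (1 * N%:R + p%:R) ^+ k) by apply/asyX/asy_lin.
have [N4 H4] := asy_near asyp (divr_gt0 d0 F2).
exists (maxn N4 (p * maxn N1 (maxn N2 N3)))%N => N; rewrite geq_max => /andP[/H4 {}H4 NN].
(* The multiple p z lies between N and N + p, so monotonicity of H' moves the estimate from
   multiples of p to every N. *)
pose z := (N %/ p).+1; have zN : (maxn N1 (maxn N2 N3) <= z)%N.
  by apply: leqW; rewrite leq_divRL // mulnC.
move: zN; rewrite !geq_max => /and3P[/H1 {}H1 /H2 {}H2 /H3 {}H3].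
have Npz : (N <= p * z)%N by rewrite mulnC ltnW // ltn_ceil.
have pzN : (p * z <= N + p)%N by rewrite mulnC mulSn addnC leq_add2r leq_trunc_div.
set y := ((x *+ p) *+ z)%MM in H2 H3.
have yE : y = (x *+ (p * z))%MM by apply/mnmP => i; rewrite !mulmnE mulnA.
have Hxy : (H' (x *+ N)%MM <= H' y)%N.
  have -> : y = (x *+ (p * z - N) + x *+ N)%MM; last exact: mH.
  by rewrite yE; apply/mnmP => i; rewrite mnmDE !mulmnE -mulnDr subnK.
have step : (H y + z * (H' y + E y) <= H (v *+ z + y)%MM)%N.
  elim: (z) => [|t IH]; first by rewrite mul0n addn0 (_ : (v *+ 0)%MM = 0%MM) ?add0m //; apply/mnmP => i; rewrite mulmnE muln0 mnm0E.
  rewrite (_ : (v *+ t.+1 + y = v + (v *+ t + y))%MM); last first.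
    by apply/mnmP => i; rewrite !mnmDE !mulmnE mulnS addnA.
  apply: leq_trans (inc _); rewrite mulSn.
  have := mH y (v *+ t)%MM; have := mE y (v *+ t)%MM; lia.
have vzy : ((v + x *+ p) *+ z = v *+ z + y)%MM by apply/mnmP => i; rewrite !(mnmDE, mulmnE) mulnDl.
rewrite vzy in H1.
have z0 : 0 < z%:R :> R by rewrite ltr0n.
have p1 : 1 <= p%:R ^+ k :> R by rewrite exprn_ege1 // ler1n.
set P := p%:R ^+ k in Hp p1; pose Z : R := z%:R ^+ k.
have Z0 : 0 <= Z by rewrite exprn_ge0.
have stepR : (H y)%:R + z%:R * ((H' y)%:R + (E y)%:R) <= (H (v *+ z + y)%MM)%:R :> R.
  by rewrite -natrD -natrM -natrD ler_nat.
rewrite exprS -/Z in H1; rewrite exprS -/Z in H2; rewrite -/Z in H3.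
have key : (H' y)%:R <= Z * (P * (F' x + 2%:R * d)).
  rewrite -(ler_pM2l z0).
  have H3' := ler_wpM2l (ltW z0) H3.
  have A1 : z%:R * (H' y)%:R <= (z%:R * Z) * (F (v + x *+ p)%MM - F (x *+ p)%MM - G (x *+ p)%MM + d).
    rewrite -[d in X in _ <= X](_ : 3%:R * (d / 3%:R) = d); last by rewrite mulrC divfK // pnatr_eq0.
    set d' := d / 3%:R in H1 H2 H3 H3' *; nra.
  apply: le_trans A1 _; rewrite [X in _ <= X]mulrA; apply: ler_wpM2l; first by rewrite mulr_ge0 // ltW.
  have : d <= P * d by rewrite ler_peMl // ltW.
  rewrite (_ : P * (F' x + 2%:R * d) = P * (F' x + d) + P * d); last by ring.
  by move=> A; apply: lerD.
apply: le_trans (_ : (H' y)%:R <= _); first by rewrite ler_nat.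
apply: le_trans key _; rewrite mulrA -exprMn -natrM mulnC.
apply: le_trans (_ : (N%:R + p%:R) ^+ k * (F' x + 2%:R * d) <= _).
  by rewrite ler_wpM2r ?(ltW F2) // lerXn2r ?nnegrE // ?addr_ge0 // -natrD ler_nat.
move: H4; rewrite muln1 expr1n !mul1r ler_norml lerBlDl => /andP[_ H4].
apply: le_trans (ler_wpM2r (ltW F2) H4) _.
rewrite mulrDl (mulrAC (d / _)) divfK ?gt_eqF // -[X in X + _]mulrC -mulrDl.
rewrite ler_wpM2r ?exprn_ge0 // -addrA lerD2l /d; lra.
Qed.

Implicit Types (W : seq ('I_m -> nat)) (f : 'I_m -> R) (M : 'I_m -> nat).

Definition mono_val M f := \prod_i (f i ^+ M i / (M i)`!%:R).
Definition Fw W f := \sum_(M <- W) mono_val M f.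
Definition rmnm x : 'I_m -> R := fun i => (x i)%:R.
Definition homogW k W := forall M, List.In M W -> (\sum_i M i = k)%N.
(** The partial derivative in variable i: differentiating x^M/M! only lowers the exponent, and
    exponent 0 drops out. *)
Definition dlist (i : 'I_m) W : seq ('I_m -> nat) :=
  [seq (fun j => M j - (j == i))%N | M <- W & (0 < M i)%N].

Lemma mono_val_ge0 M f : (forall i, 0 <= f i) -> 0 <= mono_val M f.
Proof. by move=> f0; apply: prodr_ge0 => i _; rewrite divr_ge0 // exprn_ge0. Qed.

Lemma Fw_ge0 W f : (forall i, 0 <= f i) -> 0 <= Fw W f.
Proof. by move=> f0; apply: sumr_ge0 => M _; apply: mono_val_ge0. Qed.

Lemma Fw_mono W f g : (forall i, 0 <= f i <= g i) -> Fw W f <= Fw W g.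
Proof.
move=> fg; apply: ler_sum => M _; apply: ler_prod => i _.
have /andP[f0 fgi] := fg i.
rewrite divr_ge0 ?exprn_ge0 //= ler_wpM2r ?invr_ge0 // lerXn2r ?nnegrE //; exact: le_trans fgi.
Qed.

Lemma Fw_cat W W' f : Fw (W ++ W') f = Fw W f + Fw W' f.
Proof. exact: big_cat. Qed.

Lemma Fw_flatten (T : Type) (r : seq T) (W : T -> seq ('I_m -> nat)) f :
  Fw (flatten [seq W t | t <- r]) f = \sum_(t <- r) Fw (W t) f.
Proof. by rewrite /Fw big_flatten big_map. Qed.

Lemma exprn_diff_le k (a : R) : 0 <= a -> (a + 1) ^+ k.+1 - a ^+ k.+1 <= k.+1%:R * (a + 1) ^+ k.
Proof.
move=> a0; rewrite subrXX addrC addKr mul1r.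
apply: le_trans (_ : \sum_(i < k.+1) (a + 1) ^+ k <= _).
  apply: ler_sum => i _.
  rewrite -[k in X in _ <= X](subnK (_ : i <= k)%N) ?exprD -1?ltnS //.
  by rewrite ler_wpM2l ?exprn_ge0 ?lerXn2r ?nnegrE ?addr_ge0 // lerDl.
by rewrite sumr_const card_ord mulr_natl lexx.
Qed.

(** A polynomial with nonnegative coefficients is convex along a coordinate direction of the
    orthant, so a unit increment is at most the derivative at its far end. *)
Lemma Fw_step W i f : (forall j, 0 <= f j) ->
  Fw W (fun j => f j + (j == i)%:R) - Fw W f <= Fw (dlist i W) (fun j => f j + (j == i)%:R).
Proof.
move=> f0; rewrite /Fw /dlist big_map big_filter -sumrB [X in _ <= X]big_mkcond /=.
apply: ler_sum => M _; rewrite /mono_val (bigD1 i) //= [X in _ - X](bigD1 i) //= eqxx.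
rewrite [X in _ * X - _](eq_bigr (fun j => f j ^+ M j / (M j)`!%:R)); last first.
  by move=> j /negbTE ->; rewrite addr0.
set P := \prod_(j | j != i) _.
have P0 : 0 <= P by apply: prodr_ge0 => j _; rewrite divr_ge0 // exprn_ge0.
rewrite -mulrBl -mulrBl; case: ifP => Mi; last first.
  by have -> : M i = 0%N by [case: (M i) Mi]; rewrite !expr0 subrr !mul0r.
rewrite (bigD1 i) //= eqxx [X in _ <= _ * X](eq_bigr (fun j => f j ^+ M j / (M j)`!%:R)); last first.
  by move=> j /negbTE ->; rewrite addr0 subn0.
apply: ler_wpM2r => //; case: (M i) Mi => // k _; rewrite subn1 /=.
rewrite factS natrM invfM mulrA ler_wpM2r ?invr_ge0 // ler_pdivrMr ?ltr0n // mulrC.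
exact: exprn_diff_le.
Qed.

Definition dlists s W := flatten [seq dlist i W | i <- s].
Lemma Fw_steps W s f : (forall j, 0 <= f j) ->
  Fw W (fun j => f j + (count_mem j s)%:R) - Fw W f <= Fw (dlists s W) (fun j => f j + (count_mem j s)%:R).
Proof.
move=> f0; elim: s => [|i s IH].
  by rewrite /dlists /Fw big_nil (_ : (fun j => _) = f) ?subrr //; apply/funext => j; rewrite addr0.
pose g j := f j + (count_mem j s)%:R.
have g0 j : 0 <= g j by rewrite addr_ge0.
have E : (fun j => f j + (count_mem j (i :: s))%:R) = (fun j => g j + (j == i)%:R).
  by apply/funext => j; rewrite /= natrD addrCA addrC eq_sym.
rewrite E -(subrKA (Fw W g)) /dlists /= Fw_cat; apply: lerD; first exact: Fw_step.
apply: le_trans IH _; apply: Fw_mono => j; by rewrite g0 /= lerDl.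
Qed.

Lemma asy_Fw k W f (c : 'I_m -> R) : homogW k W ->
  asy k (Fw W f) (fun N => Fw W (fun i => f i * N%:R + c i)).
Proof.
move=> hW; apply: asy_sum => M /hW <-; apply: asy_prod => i.
rewrite mulrC; have := asyZ ((M i)`!%:R)^-1 (asyX (M i) (asy_lin (f i) (c i))).
by rewrite muln1; apply: asy_ext => N; rewrite mulrC.
Qed.

Lemma asy_binsum k W x : homogW k W -> asy k (Fw W (rmnm x)) (fun N => (binsum W (x *+ N)%MM)%:R).
Proof.
move=> hW; apply: (@asy_ext _ _ (fun N => \sum_(M <- W) \prod_i 'C(0 + x i * N, M i)%:R)).
  move=> N; rewrite /binsum natr_sum; apply: eq_bigr => M _; rewrite natr_prod.
  by apply: eq_bigr => i _; rewrite mulmnE.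
by apply: asy_sum => M /hW <-; apply: asy_prod => i; apply: asy_bin.
Qed.

Lemma binsum_mono W : mono (binsum W).
Proof.
move=> x y; apply: leq_sum => M _; apply: leq_prod => i _; apply: leq_bin2l.
by rewrite mnmDE leq_addl.
Qed.

(** The form of [asyLe_increment] used for exponent lists: F' is the derivative of the leading form
    of H in direction v, less the leading form of the error term. The list s spells v as a sum of
    unit vectors. *)
Lemma asyLe_derivative H H' k W W' WE s (v : 'X_{1..m}) :
  (forall i, v i = count_mem i s) -> homogW k.+1 W -> homogW k (dlists s W) -> homogW k WE ->
  (forall x, (H x + H' x + binsum WE x <= H (v + x)%MM)%N) -> mono H' ->
  asyLe H k.+1 (fun x => Fw W (rmnm x)) -> (forall x, (binsum W x <= H x)%N) ->
  (forall f, (forall i, 0 <= f i) -> Fw (dlists s W) f <= Fw W' f + Fw WE f) ->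
  asyLe H' k (fun x => Fw W' (rmnm x)).
Proof.
move=> vs hW hdW hE inc mH UH LH dE.
apply: (asyLe_increment inc mH (@binsum_mono WE) UH
  (asyGe_bound LH (asy_asyGe (fun x => asy_binsum x hW))) (asy_asyGe (fun x => asy_binsum x hE))) => [x|x e e0].
  by apply: Fw_ge0 => i; apply: ler0n.
have A := asy_Fw (rmnm x) (rmnm v) hdW.
have B := asy_Fw (rmnm x) (fun=> 0) hE.
have [p0 Hp] := asy_near (asyD A (asyZ (-1) B)) e0.
exists p0.+1 => //; have := Hp p0.+1 (leqnSn _); set p := p0.+1.
rewrite ler_norml lerBlDl => /andP[_ C].
have E0 : rmnm (x *+ p)%MM = (fun i => rmnm x i * p%:R + 0).
  by apply/funext => i; rewrite /rmnm mulmnE natrM addr0.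
have E1 : rmnm (v + x *+ p)%MM = (fun i => rmnm x i * p%:R + rmnm v i).
  by apply/funext => i; rewrite /rmnm mnmDE mulmnE natrD natrM addrC.
have E2 : (fun j => rmnm (x *+ p)%MM j + (count_mem j s)%:R) = rmnm (v + x *+ p)%MM.
  by apply/funext => i; rewrite /rmnm mnmDE -vs natrD addrC.
have D : Fw W (rmnm (v + x *+ p)%MM) - Fw W (rmnm (x *+ p)%MM) <= Fw (dlists s W) (rmnm (v + x *+ p)%MM).
  by rewrite -E2; apply: Fw_steps => j; apply: ler0n.
rewrite E1 E0 in D *.
have := dE (rmnm x) (fun i => ler0n R (x i)) => dEx.
apply: le_trans (lerB D (lexx _)) _; move: C; rewrite mulN1r => C; apply: le_trans C _.
rewrite -mulrDl mulrC ler_wpM2l ?exprn_ge0 // lerD2r mulN1r; lra.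
Qed.

End Asymptotics.

(** * Gelfand-Tsetlin sums over partitions *)

Lemma below_complete a j b b' : (forall r, (j < r)%N -> b' r = b r) -> (forall r, (b' r <= b r)%N) ->
  (0 < b' 0)%N -> (forall r, (r < j)%N -> (a r < b' r.+1)%N) ->
  exists2 p, List.In p (below a j b) & p.2 = b'.
Proof.
elim: j b => [|j IH] b H1 H2 H3 H4 /=.
  exists ((b 0 - b' 0)%N, b') => //; apply/List.in_map_iff; exists (b 0 - b' 0)%N; split.
    by congr pair; apply/funext => -[|r]; rewrite /decn /= ?subn0 ?subKn // H1.
  by apply/In_mem; rewrite mem_iota add0n /=; rewrite ltn_subrL H3 (leq_trans H3).
have [p pin pE] : exists2 p, List.In p (below a j (decn b j.+1 (b j.+1 - b' j.+1))) & p.2 = b'.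
  apply: IH => // [r|r|r rj]; last by apply: H4; apply: ltnW.
    rewrite /decn leq_eqVlt eq_sym => /orP[/eqP ->|jr]; first by rewrite eqxx subKn.
    by rewrite gtn_eqF // subn0 H1.
  by rewrite /decn; case: eqP => [->|_]; rewrite ?subn0 // subKn.
exists ((b j.+1 - b' j.+1) + p.1, p.2)%N => //.
have : forall (T U : Type) (g : T -> seq U) r d t, List.In d r -> List.In t (g d) ->
    List.In t (flatten (map g r)).
  move=> T U g; elim=> //= d0 r IHr d t [->|dr] tg; apply/List.in_or_app; first by left.
  by right; apply: IHr dr tg.
apply; last by apply/List.in_map_iff; exists p.
apply/In_mem; rewrite mem_iota add0n /=; have := H2 j.+1; have := H4 j (ltnSn j); lia.
Qed.

Lemma uniq_flatten_map (T U : eqType) (g : T -> seq U) r : uniq r ->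
  {in r, forall d, uniq (g d)} ->
  (forall d d' t, d \in r -> d' \in r -> t \in g d -> t \in g d' -> d = d') ->
  uniq (flatten (map g r)).
Proof.
elim: r => //= d r IH /andP[dr ur] Hu Hd; rewrite cat_uniq Hu ?mem_head //=.
rewrite IH // => [|d' d'r|d' d'' t d'r d''r]; last first.
- by apply: Hd; rewrite inE ?d'r ?d''r orbT.
- by apply: Hu; rewrite inE d'r orbT.
rewrite andbT -all_predC; apply/allP => t /flattenP[s /mapP[d' d'r ->] td'] /=; apply/negP => td.
have E := Hd d d' t (mem_head _ _) _ td td'; rewrite E ?inE ?d'r ?orbT // in dr.
Qed.

Lemma In_mem_map (T : Type) (U : eqType) (g : T -> U) r t : List.In t r -> g t \in map g r.
Proof. by elim: r => //= t' r IH [->|/IH H]; rewrite inE ?eqxx // H orbT. Qed.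

Lemma subn_injl x y z : (x < z)%N -> (y < z)%N -> (z - x = z - y)%N -> x = y.
Proof. by lia. Qed.

Lemma below_uniq (T : eqType) a j b (k : nat * (nat -> nat) -> T) :
  (forall p p', List.In p (below a j b) -> List.In p' (below a j b) -> k p = k p' ->
     forall r, (r <= j)%N -> p.2 r = p'.2 r) ->
  uniq (map k (below a j b)).
Proof.
elim: j b k => [|j IH] b k H /=.
  rewrite -map_comp map_inj_in_uniq ?iota_uniq // => d d'; rewrite !mem_iota => /= Hd Hd' E.
  have := H (d, decn b 0 d) (d', decn b 0 d') _ _ E 0%N (leqnn _); rewrite /decn /=.
  have P e : (e < b 0)%N -> List.In (e, decn b 0 e) (below a 0 b).
    by move=> eb; apply/List.in_map_iff; exists e; split => //; apply/In_mem; rewrite mem_iota.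
  by move=> /(_ (P _ Hd) (P _ Hd')); apply: subn_injl.
have P d p : d \in iota 0 (b j.+1 - a j) -> List.In p (below a j (decn b j.+1 d)) ->
    List.In ((d + p.1)%N, p.2) (below a j.+1 b).
  move=> dr pin /=; elim: (iota _ _) dr => //= d0 r IHr; rewrite inE => /orP[/eqP <-|/IHr dr].
    by apply/List.in_or_app; left; apply/List.in_map_iff; exists p.
  by apply/List.in_or_app; right.
rewrite map_flatten -map_comp; apply: uniq_flatten_map; first exact: iota_uniq.
  move=> d dr /=; rewrite -map_comp; apply: IH => p p' pin p'in E r rj.
  by apply: (H _ _ (P d p dr pin) (P d p' dr p'in) E); apply: leqW.
move=> d d' t dr d'r /=; rewrite -!map_comp => /mem_map_In[p pin ->] /mem_map_In[p' p'in /= E].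
have := H _ _ (P d p dr pin) (P d' p' d'r p'in) E j.+1 (leqnn _) => /=.
have [A1 _ _ _ _] := below_spec pin; have [B1 _ _ _ _] := below_spec p'in.
move: dr d'r; rewrite A1 // B1 // /decn !eqxx !mem_iota !add0n /= => dr d'r.
by apply: subn_injl; [apply: leq_trans dr (leq_subr _ _) | apply: leq_trans d'r (leq_subr _ _)].
Qed.

Section GelfandTsetlin.
Variables (m K : nat).
Notation V := {ffun 'I_m -> 'I_K.+1}.
Implicit Types (lam nu : V).

Definition ent lam j : nat := if insub j is Some i then lam i else 0%N.
Definition mkV (f : nat -> nat) : V := [ffun i : 'I_m => inord (f i)].
Definition vsize lam := (\sum_(0 <= j < m) ent lam j)%N.

Lemma entE lam (i : 'I_m) : ent lam i = lam i.
Proof. by rewrite /ent valK. Qed.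

Lemma ent_out lam j : (m <= j)%N -> ent lam j = 0%N.
Proof. by move=> mj; rewrite /ent insubF // ltnNge mj. Qed.

Lemma ent_max lam j : (ent lam j <= K)%N.
Proof. by rewrite /ent; case: insub => // i; rewrite -ltnS. Qed.

Lemma ent_inj lam nu : (forall j, (j < m)%N -> ent lam j = ent nu j) -> lam = nu.
Proof. by move=> H; apply/ffunP => i; apply: val_inj; have := H i (ltn_ord i); rewrite !entE. Qed.

Lemma ent_mkV f j : (j < m)%N -> (f j <= K)%N -> ent (mkV f) j = f j.
Proof. by move=> jm fK; rewrite -[j]/(val (Ordinal jm)) entE ffunE inordK. Qed.

Definition vdec lam := forall j, (ent lam j.+1 <= ent lam j)%N.
Definition vsupp l lam := forall j, (l <= j)%N -> ent lam j = 0%N.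
Definition inter lam nu := all (fun j => (ent lam j.+1 <= ent nu j <= ent lam j)%N) (iota 0 m).

Lemma interP lam nu : reflect (forall j, (ent lam j.+1 <= ent nu j)%N /\ (ent nu j <= ent lam j)%N) (inter lam nu).
Proof.
apply: (iffP allP) => [H j|H j _]; last by have [-> ->] := H j.
have [jm|mj] := ltnP j m; last by rewrite !ent_out // leqW.
by have := H j; rewrite mem_iota jm => /(_ isT)/andP[].
Qed.

Lemma inter_vdec lam nu : inter lam nu -> vdec lam /\ vdec nu.
Proof.
move=> /interP H; split => j; have [H1 H2] := H j; first exact: leq_trans H2.
by have [H3 H4] := H j.+1; apply: leq_trans H1.
Qed.

Lemma inter_vsize lam nu : inter lam nu -> (vsize nu <= vsize lam)%N.
Proof. by move=> /interP H; apply: leq_sum => j _; case: (H j). Qed.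

(** Beta-numbers of the partition, smallest part first: weakly decreasing parts become a strictly
    increasing staircase. *)
Definition bof q lam r := if (r <= q)%N then (ent lam (q - r) + r.+1)%N else 0%N.

Lemma below_sum (R : nmodType) q lam (f : nat -> (nat -> nat) -> R) : (q < m)%N -> vdec lam -> vsupp q.+1 lam ->
  \sum_(p <- below (bof q lam) q (bof q lam)) f p.1 p.2 =
  \sum_(nu | inter lam nu) f (vsize lam - vsize nu)%N (bof q nu).
Proof.
move=> qm ld ls.
pose enc (p : nat * (nat -> nat)) := mkV (fun j => if (j <= q)%N then p.2 (q - j) - (q - j).+1 else 0)%N.
pose bl := below (bof q lam) q (bof q lam).
have entenc p : List.In p bl -> forall j, ent (enc p) j = (if (j <= q)%N then p.2 (q - j) - (q - j).+1 else 0)%N.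
  move=> /below_spec[_ H2 _ _ _] j; have [jm|mj] := ltnP j m; last by rewrite ent_out //; case: ifP => //; lia.
  rewrite ent_mkV //; case: ifP => // jq; have := H2 (q - j)%N; rewrite /bof leq_subr subKn //.
  by have := ent_max lam j; lia.
have lowb p : List.In p bl -> forall r, (r <= q)%N -> (r < p.2 r)%N.
  move=> /below_spec[_ _ H3 H4 _] [|r] rq //; apply: leq_trans (H4 r rq); by rewrite /bof (ltnW rq) ltnS leq_addl.
have bofenc p : List.In p bl -> p.2 = bof q (enc p).
  move=> pin; apply/funext => r; rewrite /bof; case: ifP => rq.
    by rewrite entenc // leq_subr subKn // subnK // lowb.
  by have [H1 _ _ _ _] := below_spec pin; rewrite H1 /bof ?rq // ltnNge rq.
have interenc p : List.In p bl -> inter lam (enc p).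
  move=> pin; apply/interP => j; rewrite entenc //; have [_ H2 _ H4 _] := below_spec pin.
  have [jq|qj] := leqP j q; last by rewrite !ls // leqW.
  have := H2 (q - j)%N; rewrite /bof leq_subr subKn // => H2'.
  split; last by lia.
  have [jq'|] := ltnP j q; last by move=> ?; rewrite ls //; lia.
  have := H4 (q - j.+1)%N; rewrite /bof leq_subr subKn // subnSK // => H4'.
  have := H4' (leq_subr _ _); lia.
have sizeenc p : List.In p bl -> p.1 = (vsize lam - vsize (enc p))%N.
  move=> pin; have [_ H2 _ _ ->] := below_spec pin.
  have vs (nu : V) : vsupp q.+1 nu -> vsize nu = (\sum_(0 <= r < q.+1) ent nu (q - r))%N.
    move=> ns; rewrite /vsize (big_cat_nat (n := q.+1)) //= [X in (_ + X)%N]big_nat_cond.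
    rewrite [X in (_ + X)%N]big1 ?addn0 => [|j /andP[/andP[qj _] _]]; last by rewrite ns.
    by rewrite big_nat_rev; apply: eq_big_nat => r; rewrite add0n subSS.
  have es : vsupp q.+1 (enc p) by move=> j qj; rewrite entenc // leqNgt qj.
  rewrite !vs // -sumnB => [|r _]; last by have /interP/(_ (q - r)%N)[] := interenc p pin.
  apply: eq_big_nat => r /andP[_ rq]; rewrite (bofenc p pin) /bof -ltnS rq; lia.
transitivity (\sum_(nu <- map enc bl) f (vsize lam - vsize nu)%N (bof q nu)).
  rewrite big_map -/bl; clearbody bl; elim: bl {entenc lowb interenc} bofenc sizeenc => [|p l IH] H1 H2; first by rewrite !big_nil.
  rewrite !big_cons (IH (fun p' h => H1 p' (or_intror h)) (fun p' h => H2 p' (or_intror h))).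
  by rewrite -(H1 p (or_introl erefl)) -(H2 p (or_introl erefl)).
rewrite big_uniq /=; last first.
  apply: below_uniq => p p' pin p'in E r rq; by rewrite (bofenc p pin) (bofenc p' p'in) E.
apply: eq_bigl => nu; apply/idP/idP => [/mem_map_In[p pin ->]|I]; first exact: interenc.
have /interP H := I.
have [|r|||p pin pE] := @below_complete (bof q lam) q (bof q lam) (bof q nu).
- by move=> r qr; rewrite /bof leqNgt qr.
- by rewrite /bof; case: ifP => // _; rewrite leq_add2r; case: (H (q - r)%N).
- by rewrite /bof leq0n addn1.
- move=> r rq; rewrite /bof (ltnW rq) rq [X in (_ < X)%N]addnS ltnS leq_add2r.
  by have [] := H (q - r.+1)%N; rewrite subnSK.
have -> : nu = enc p.
  apply: ent_inj => j jm; rewrite entenc // pE /bof; case: ifP => jq.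
    by rewrite leq_subr subKn //; lia.
  by apply/eqP; rewrite -leqn0; have [_] := H j; rewrite ls // ltnNge jq.
exact: In_mem_map.
Qed.

Variable R : comNzRingType.
Implicit Types (u : nat -> nat -> R).

(** For u i d = x_i^d this is the branching rule for the Schur polynomial in l variables. Arbitrary
    weights u also cover x_i^d/d! and its derivatives. *)
Fixpoint gt u l lam : R :=
  if l is l'.+1 then \sum_(nu | inter lam nu) u l' (vsize lam - vsize nu)%N * gt u l' nu
  else (lam == mkV (fun=> 0%N))%:R.

Lemma wts_gt u q l lam : (q < m)%N -> vdec lam -> vsupp q.+1 lam ->
  \sum_(M <- wts q l (bof q lam)) \prod_(i < l) u i (nth 0%N M i) = gt u l lam.
Proof.
move=> qm; elim: l lam => [|l IH] lam ld ls.
  rewrite -[wts _ _ _]/(if all (fun r => bof q lam r == r.+1) (iota 0 q.+1) then [:: [::]] else [::]).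
  have -> : all (fun r => bof q lam r == r.+1) (iota 0 q.+1) = (lam == mkV (fun=> 0%N)).
    apply/allP/eqP => [H|-> r].
      apply: ent_inj => j jm; rewrite ent_mkV //; have [jq|qj] := leqP j q; last by rewrite ls.
      have := H (q - j)%N; rewrite mem_iota /bof leq_subr subKn // => /(_ _)/eqP; lia.
    by rewrite mem_iota /bof => /andP[_ rq]; rewrite -ltnS rq ent_mkV // (leq_ltn_trans (leq_subr _ _)).
  by rewrite /gt; case: (_ == _); rewrite ?big_nil // big_cons big_nil big_ord0 addr0.
rewrite /= big_flatten big_map.
transitivity (\sum_(p <- below (bof q lam) q (bof q lam))
   u l p.1 * \sum_(M <- wts q l p.2) \prod_(i < l) u i (nth 0%N M i)).
  apply: eq_bigr => p _; rewrite big_map big_distrr /= big_seq [RHS]big_seq.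
  apply: eq_bigr => M Min; have sM := size_wts Min.
  rewrite big_ord_recr /= nth_rcons sM ltnn eqxx mulrC; congr (_ * _).
  by apply: eq_bigr => i _; rewrite nth_rcons sM ltn_ord.
rewrite (below_sum (fun d b => u l d * \sum_(M <- wts q l b) \prod_(i < l) u i (nth 0%N M i)) qm ld ls).
apply: eq_bigr => nu I; rewrite IH //; first by case: (inter_vdec I).
move=> j qj; apply/eqP; rewrite -leqn0; have /interP/(_ j)[_] := I; by rewrite ls.
Qed.

Lemma gt_ext u u' l lam : (forall i, (i < l)%N -> u i = u' i) -> gt u l lam = gt u' l lam.
Proof.
elim: l lam => //= l IH lam H; apply: eq_bigr => nu _; rewrite H // IH // => i il.
by apply: H; apply: ltnW.
Qed.

Lemma gt_vsupp u l lam : ~ vsupp l lam -> gt u l lam = 0.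
Proof.
elim: l lam => [|l IH] lam H /=.
  case: eqP => // E; case: H => j _; rewrite E; have [jm|mj] := ltnP j m; [exact: ent_mkV|exact: ent_out].
rewrite big1 // => nu /interP I; rewrite IH ?mulr0 // => ns; apply: H => -[|j] // lj.
by apply/eqP; rewrite -leqn0; have [H _] := I j; rewrite -(ns j).
Qed.

Lemma gt_vdec u l lam : ~ vdec lam -> gt u l lam = 0.
Proof.
case: l => [|l] H /=; last by rewrite big1 // => nu /inter_vdec[].
case: eqP => // E; case: H => j; rewrite E; have [jm|mj] := ltnP j.+1 m; last by rewrite ent_out.
by rewrite ent_mkV.
Qed.

End GelfandTsetlin.

(** * Shift by a rectangle and the dual Pieri rule *)

Section Pieri.
Variables (m K : nat).
Notation V := {ffun 'I_m -> 'I_K.+1}.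
Implicit Types (lam nu : V).
Variable R : comNzRingType.
Implicit Types (u : nat -> nat -> R).

Definition vmap (f : nat -> nat -> nat) lam : V := mkV m K (fun j => minn (f j (ent lam j)) K).

Lemma ent_vmap f lam j : (j < m)%N -> ent (vmap f lam) j = minn (f j (ent lam j)) K.
Proof. by move=> jm; rewrite ent_mkV // geq_minr. Qed.

Definition vadd l c lam := vmap (fun j x => x + (if (j < l)%N then c else 0))%N lam.
Definition vsub l c lam := vmap (fun j x => x - (if (j < l)%N then c else 0))%N lam.
Definition vincr k lam := vmap (fun j x => x + (j == k))%N lam.
Definition vdecr k lam := vmap (fun j x => x - (j == k))%N lam.

Lemma ent_vsub l c lam j : ent (vsub l c lam) j = (ent lam j - (if (j < l)%N then c else 0))%N.
Proof.
have [jm|mj] := ltnP j m; last by rewrite !ent_out.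
by rewrite ent_vmap // (minn_idPl _) // (leq_trans (leq_subr _ _)) // ent_max.
Qed.

Lemma ent_vdecr k lam j : ent (vdecr k lam) j = (ent lam j - (j == k))%N.
Proof.
have [jm|mj] := ltnP j m; last by rewrite !ent_out.
by rewrite ent_vmap // (minn_idPl _) // (leq_trans (leq_subr _ _)) // ent_max.
Qed.

Lemma ent_vadd l c lam j : (l <= m)%N ->
  ent (vadd l c lam) j = minn (ent lam j + (if (j < l)%N then c else 0)) K.
Proof.
move=> lm; have [jm|mj] := ltnP j m; first by rewrite ent_vmap.
by rewrite !ent_out // ltnNge (leq_trans lm mj) /= min0n.
Qed.

Lemma ent_vincr k lam j : (k < m)%N -> ent (vincr k lam) j = minn (ent lam j + (j == k)) K.
Proof.
move=> km; have [jm|mj] := ltnP j m; first by rewrite ent_vmap.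
by rewrite !ent_out // gtn_eqF ?min0n // (leq_trans km).
Qed.

Lemma gt_supp u l lam (F : V -> R) :
  \sum_(nu | inter lam nu) F nu * gt u l nu = \sum_(nu | inter lam nu && (ent nu l == 0%N)) F nu * gt u l nu.
Proof.
rewrite (bigID (fun nu : V => ent nu l == 0%N)) /= [X in _ + X]big1 ?addr0 // => nu /andP[_ /eqP nl].
by rewrite gt_vsupp ?mulr0 // => H; apply/nl/H.
Qed.

(** Weighted form of the identity that multiplying a Schur polynomial by (x_1...x_l)^c adds c full
    columns. The bound by K keeps the truncating [vadd] exact. *)
Lemma gt_shift u c l lam : (l <= m)%N -> vsupp l lam -> (forall j, (ent lam j + c <= K)%N) ->
  gt (fun i d => u i (d + c)%N) l lam = gt u l (vadd l c lam).
Proof.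
elim: l lam => [|l IH] lam lm ls lK.
  rewrite /=; congr (_ == _)%:R; apply: ent_inj => j _.
  by rewrite ent_vadd // addn0 (minn_idPl _) // ent_max.
rewrite /= !gt_supp.
have inv nu : inter (vadd l.+1 c lam) nu && (ent nu l == 0)%N -> vadd l c (vsub l c nu) = nu.
  move=> /andP[/interP H _]; apply: ent_inj => j jm; rewrite ent_vadd ?ent_vsub; last exact: ltnW.
  have [H1 _] := H j; move: H1; rewrite !ent_vadd // ltnS; have := ent_max nu j.
  have := lK j.+1; case: ltnP => jl; last by move=> _ NK _; rewrite subn0 addn0; apply/minn_idPl.
  move=> LK NK; rewrite (minn_idPl LK) => H1; rewrite subnK ?(minn_idPl NK) //; lia.
rewrite (reindex_onto (vadd l c) (vsub l c) inv).
have vaddE nu j : inter lam nu -> ent nu l = 0%N ->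
    ent (vadd l c nu) j = (ent nu j + (if (j < l)%N then c else 0))%N.
  move=> /interP H nl; rewrite ent_vadd ?(ltnW lm) // (minn_idPl _) //.
  by have := lK j; have [_] := H j; case: ifP; lia.
have laddE j : ent (vadd l.+1 c lam) j = (ent lam j + (if (j < l.+1)%N then c else 0))%N.
  by rewrite ent_vadd // (minn_idPl _) //; have := lK j; case: ifP => _; lia.
have predE nu : (inter lam nu && (ent nu l == 0%N)) =
   (inter (vadd l.+1 c lam) (vadd l c nu) && (ent (vadd l c nu) l == 0%N)) && (vsub l c (vadd l c nu) == nu).
  apply/idP/idP => [/andP[I /eqP nl]|/andP[/andP[/interP I nl] /eqP E]].
    have /interP H := I; apply/andP; split; last first.
      by apply/eqP; apply: ent_inj => j jm; rewrite ent_vsub vaddE // addnK.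
    rewrite vaddE // ltnn nl eqxx andbT; apply/interP => j; rewrite laddE vaddE // laddE.
    have [H1 H2] := H j; rewrite !ltnS; have [jl|jl|jl] := ltngtP j l.
    - by rewrite !leq_add2r.
    - by rewrite !addn0.
    - by rewrite jl nl ls.
  have nl0 : ent nu l = 0%N by move: nl; rewrite ent_vadd ?(ltnW lm) // ltnn addn0 (minn_idPl _) ?ent_max // => /eqP.
  rewrite nl0 eqxx andbT; apply/interP => j; have [H1 H2] := I j.
  have [jl|jl|jl] := ltngtP j l; last first.
  - by rewrite jl nl0 ls.
  - have : ent (vadd l c nu) j = ent nu j.
      by rewrite ent_vadd ?(ltnW lm) // ltnNge (ltnW jl) /= addn0 (minn_idPl _) // ent_max.
    by move=> E'; move: H2; rewrite E' laddE ltnS [(j <= l)%N]leqNgt jl /= addn0 => H2; rewrite [ent lam j.+1]ls ?leqW.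
  have Ej : ent nu j = (minn (ent nu j + c) K - c)%N by rewrite -{1}E ent_vsub jl ent_vadd ?jl ?(ltnW lm).
  move: H1 H2; rewrite !laddE ent_vadd ?(ltnW lm) // jl !ltnS jl (ltnW jl); have := lK j.
  move: Ej; rewrite /minn; case: ifP => _; lia.
apply: eq_big => [nu|nu /andP[I /eqP nl]]; first exact: predE.
rewrite IH ?(ltnW lm) //; last 2 first.
- move=> j lj; move/interP: I => I; have [H1 H2] := I j.
  have := ls j; have [jl|jl|->] := ltngtP j l; rewrite ?nl //; last by move=> H; move: H2; rewrite H //; case: (ent nu j).
  by move: lj; rewrite leqNgt jl.
- by move=> j; move/interP: I => I; have [_ H2] := I j; apply: leq_trans (lK j); rewrite leq_add2r.
congr (u l _ * _).
have sz a (mu mu' : V) : (a <= m)%N -> (forall j, ent mu' j = ent mu j + (if (j < a)%N then c else 0))%N ->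
    vsize mu' = (vsize mu + a * c)%N.
  move=> am H; rewrite /vsize (eq_bigr (fun j => ent mu j + (if (j < a)%N then c else 0))%N) //.
  rewrite big_split /=; congr addn; rewrite (big_cat_nat (n := a)) //= [X in (_ + X)%N]big_nat_cond.
  rewrite [X in (_ + X)%N]big1 => [|j /andP[/andP[aj _] _]]; last by rewrite ltnNge aj.
  rewrite addn0 (@eq_big_nat _ _ _ _ _ _ (fun=> c)) => [|j /andP[_ ->] //].
  by rewrite sum_nat_const_nat subn0.
have nE : vsize (vadd l c nu) = (vsize nu + l * c)%N by apply: sz; [exact: ltnW | move=> j; apply: vaddE].
rewrite nE (sz l.+1 lam (vadd l.+1 c lam)) //; have := inter_vsize I; rewrite mulSn; lia.
Qed.

Lemma vsize_vdecr k lam : (k < m)%N -> (0 < ent lam k)%N -> (vsize (vdecr k lam)).+1 = vsize lam.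
Proof.
move=> km lk; rewrite /vsize !big_mkord (bigD1 (Ordinal km)) //= [RHS](bigD1 (Ordinal km)) //=.
rewrite ent_vdecr eqxx -addSn subn1 prednK //; congr addn; apply: eq_bigr => j jk.
by rewrite ent_vdecr (_ : (j == k :> nat) = false) ?subn0 //; apply/negbTE.
Qed.

(** On weights this is division by x_(i0); on the weights x^d/d! it is the derivative in x_(i0). *)
Definition du u i0 i d : R := if i == i0 then (if d is d'.+1 then u i d' else 0) else u i d.

Section Count.
Variables (l : nat) (lam nu : V).
Hypotheses (lm : (l < m)%N) (ld : vdec lam) (ls : vsupp l.+1 lam)
  (lp : forall j, (j <= l)%N -> (0 < ent lam j)%N) (nd : vdec nu).
Let Pr nu := inter lam nu && (ent nu l == 0%N).
Let J k nu := Pr (vincr k nu) && (vdecr k (vincr k nu) == nu).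
Let I0 k nu := inter (vdecr k lam) nu && (ent nu l == 0%N).

Lemma J_E k : (k < l)%N -> reflect ((forall j, (ent lam j.+1 <= ent nu j + (j == k) /\
   ent nu j + (j == k) <= ent lam j)%N) /\ ent nu l = 0%N) (J k nu).
Proof.
move=> kl; have km := ltn_trans kl lm; have lk : (l == k) = false by rewrite gtn_eqF.
apply: (iffP idP) => [/andP[/andP[/interP H /eqP nl] /eqP E]|[H nl]].
  have vE j : ent (vincr k nu) j = (ent nu j + (j == k))%N.
    have := ent_max nu j; have : ent nu j = (ent (vincr k nu) j - (j == k))%N by rewrite -{1}E ent_vdecr.
    by have := leq_trans (lp (leq0n l)) (ent_max lam 0); rewrite ent_vincr //; case: (j == k) => /=; case: (leqP (ent nu j + _) K) => /=; lia.
  by split=> [j|]; [rewrite -vE; apply: H | move: nl; rewrite vE lk addn0].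
have vE j : ent (vincr k nu) j = (ent nu j + (j == k))%N.
  by rewrite ent_vincr // (minn_idPl _) //; case: (H j) => _ /leq_trans; apply; apply: ent_max.
apply/andP; split; first (apply/andP; split).
- by apply/interP => j; rewrite vE.
- by rewrite vE lk nl.
- by apply/eqP/ent_inj => j _; rewrite ent_vdecr vE addnK.
Qed.

Lemma I0_E k : reflect ((forall j, (ent lam j.+1 - (j.+1 == k) <= ent nu j /\
   ent nu j <= ent lam j - (j == k))%N) /\ ent nu l = 0%N) (I0 k nu).
Proof.
apply: (iffP andP) => [[/interP H /eqP nl]|[H nl]]; split => //; last exact/eqP.
  by move=> j; have := H j; rewrite !ent_vdecr.
by apply/interP => j; rewrite !ent_vdecr.
Qed.

(** If nu interlaces lam, index k matches index k for k < l, both meaning nu_k < lam_k, and the last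
    term on the right matches [Pr]. Otherwise index k on the left matches k + 1 on the right: the
    only failure is nu_k = lam_(k+1) - 1, and the term k = 0 on the right is empty. *)
Lemma pieri_count : (Pr nu + \sum_(k < l) J k nu = \sum_(k < l.+1) I0 k nu)%N.
Proof.
case PrE : (Pr nu).
  have /andP[/interP H /eqP nl] := PrE.
  rewrite big_ord_recr /= addnC; congr addn; last first.
    apply/esym/eqP; rewrite eqb1; apply/I0_E; split=> // j; have [H1 H2] := H j.
    split; first exact: leq_trans (leq_subr _ _) H1.
    by have [->|] := eqVneq j l; rewrite ?nl ?subn0.
  apply: eq_bigr => k _; congr nat_of_bool; have kl := ltn_ord k.
  apply/(J_E kl)/I0_E => -[H' _]; split => // j; have [H1 H2] := H j; have [H3 H4] := H' j.
    split; first exact: leq_trans (leq_subr _ _) H1.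
    by move: H4; case: (j == k); lia.
  split; first exact: leq_trans H1 (leq_addr _ _).
  by move: H4; have := @lp j; case: eqP => [-> /(_ (ltnW kl))|]; lia.
have nPr : ent nu l = 0%N -> exists j, ~~ ((ent lam j.+1 <= ent nu j) && (ent nu j <= ent lam j))%N.
  move=> nl; apply: contrapT => nex; move/negP: PrE; apply; rewrite /Pr nl eqxx andbT; apply/interP => j.
  by apply/andP; apply/negPn/negP => nj; apply: nex; exists j.
rewrite add0n big_ord_recl (_ : nat_of_bool (I0 _ _) = 0%N); last first.
  apply/eqP; rewrite eqb0; apply/I0_E => -[H nl]; have [j] := nPr nl.
  by have := H j; rewrite /= subn0 => -[-> /leq_trans -> //]; apply: leq_subr.
apply: eq_bigr => k _; congr nat_of_bool; have kl := ltn_ord k.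
apply/(J_E kl)/I0_E; rewrite /= /bump /= add1n => -[H nl]; split => //.
  have [j nj] := nPr nl; have [H1 H2] := H j.
  have [E|jk] := eqVneq j k; last by move: nj H1 H2; rewrite (negbTE jk) addn0 => /negP nj ? ?; case: nj; apply/andP.
  rewrite E eqxx addn1 in H1 H2 nj. move=> i; have [H3 H4] := H i.
  have nk : ent nu k = (ent lam k.+1).-1 by move: nj; have := lp kl; lia.
  rewrite eqSS; split; first by move: H3; case: eqP => [->|_]; lia.
  have := nd k; move: H4; have [->|] := eqVneq i k.+1; last by lia.
  by rewrite nk; have := lp kl; lia.
have [j nj] := nPr nl; have [H1 H2] := H j.
have [E|jk] := eqVneq j k; last first.
  move: nj H1 H2; rewrite eqSS (negbTE jk) subn0 => /negP nj ? H2; case: nj; apply/andP; split => //.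
  exact: leq_trans H2 (leq_subr _ _).
rewrite E eqSS eqxx subn1 in H1 H2 nj. move=> i; have [H3 H4] := H i.
have kk : (k == k.+1 :> nat) = false by rewrite ltn_eqF.
rewrite kk subn0 in H2.
have nk : ent nu k = (ent lam k.+1).-1 by move: nj; have := lp kl; lia.
have := ld k; have := lp kl; move: H3 H4; rewrite eqSS.
have [->|ik] := eqVneq i k; first by rewrite nk; lia.
by rewrite subn0 addn0; lia.
Qed.

End Count.

(** Multiplying s_lam(x_1,...,x_l) by 1/x_1 + ... + 1/x_l removes one box in all admissible ways.
    Positivity of all l parts keeps exponents nonnegative. Branching on the last variable reduces
    the claim to [pieri_count]. *)
Lemma gt_pieri u l lam : (l <= m)%N -> vdec lam -> vsupp l lam -> (forall j, (j < l)%N -> (0 < ent lam j)%N) ->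
  \sum_(i < l) gt (du u i) l lam = \sum_(k < l) gt u l (vdecr k lam).
Proof.
elim: l lam => [|l IH] lam lm ld ls lp; first by rewrite !big_ord0.
pose Pr nu := inter lam nu && (ent nu l == 0%N).
pose g nu := u l ((vsize lam).-1 - vsize nu)%N * gt u l nu.
have Prlt nu : Pr nu -> (vsize nu < vsize lam)%N.
  move=> /andP[/interP H /eqP nl].
  have lm' := lm; rewrite /vsize !big_mkord (bigD1 (Ordinal lm)) //= [X in (_ < X)%N](bigD1 (Ordinal lm)) //= nl add0n.
  rewrite -add1n; apply: leq_add; first exact: lp.
  by apply: leq_sum => j _; case: (H j).
rewrite big_ord_recr /= addrC.
have -> : \sum_(nu | inter lam nu) du u l l (vsize lam - vsize nu)%N * gt (du u l) l nu = \sum_(nu | Pr nu) g nu.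
  rewrite gt_supp; apply: eq_bigr => nu Pn; have := Prlt nu Pn; rewrite -subn_gt0 /du eqxx /g.
  rewrite (@gt_ext _ _ _ _ u) => [|i il]; last by rewrite /du; apply/funext => d; rewrite ltn_eqF.
  rewrite -subn1 -subnAC subn1; by case: (vsize lam - vsize nu)%N.
have -> : \sum_(i < l) \sum_(nu | inter lam nu) du u i l (vsize lam - vsize nu)%N * gt (du u i) l nu =
    \sum_(k < l) \sum_(nu | Pr (vincr k nu) && (vdecr k (vincr k nu) == nu)) g nu.
  (* The induction hypothesis treats the first l variables inside each nu; reindexing by nu with its
     box removed brings all terms to the common summand g. *)
  transitivity (\sum_(nu | Pr nu) u l (vsize lam - vsize nu)%N * \sum_(k < l) gt u l (vdecr k nu)).
    transitivity (\sum_(nu | Pr nu) \sum_(i < l) u l (vsize lam - vsize nu)%N * gt (du u i) l nu).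
      rewrite [RHS]exchange_big /=; apply: eq_bigr => i _; rewrite gt_supp; apply: eq_bigr => nu _.
      by rewrite {1}/du gtn_eqF.
    apply: eq_bigr => nu /andP[I /eqP nl]; rewrite -big_distrr /=; congr (_ * _).
    have /interP H := I; apply: IH; first exact: ltnW.
    - by case: (inter_vdec I).
    - move=> j; rewrite leq_eqVlt => /orP[/eqP <- //|lj].
      by apply/eqP; rewrite -leqn0; have [_] := H j; rewrite ls.
    - by move=> j jl; have [H1 _] := H j; apply: leq_trans H1; apply: lp.
  rewrite (eq_bigr (fun nu => \sum_(k < l) u l (vsize lam - vsize nu)%N * gt u l (vdecr k nu))); last first.
    by move=> nu _; rewrite big_distrr.
  rewrite exchange_big /=; apply: eq_bigr => k _; have km : (k < m)%N by apply: leq_trans (ltn_ord k) (ltnW lm).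
  rewrite (reindex_onto (vincr k) (vdecr k)) /=.
    apply: eq_bigr => nu /andP[/andP[/interP H _] /eqP E]; rewrite E /g.
    have k0 : (0 < ent (vincr k nu) k)%N by have [H1 _] := H k; apply: leq_trans H1; apply: lp; rewrite ltnS.
    have := vsize_vdecr km k0; rewrite E => <-.
    by rewrite -subn1 -subnDA add1n.
  move=> nu /andP[/interP H _]; apply: ent_inj => j _; rewrite ent_vincr // ent_vdecr.
  have := ent_max nu j; have := H j; have := @lp j.+1; rewrite ltnS; case: eqP => [->|_]; last by rewrite subn0 addn0 => _ _ /minn_idPl.
  move=> /(_ (ltn_ord k)) P [H1 _] NK; rewrite subnK ?(minn_idPl NK) //; exact: leq_trans H1.
have -> : \sum_(k < l.+1) \sum_(nu | inter (vdecr k lam) nu) u l (vsize (vdecr k lam) - vsize nu)%N * gt u l nu =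
   \sum_(k < l.+1) \sum_(nu | inter (vdecr k lam) nu && (ent nu l == 0%N)) g nu.
  apply: eq_bigr => k _; rewrite gt_supp; apply: eq_bigr => nu _; rewrite /g.
  by rewrite -(vsize_vdecr (leq_trans (ltn_ord k) lm) (lp k (ltn_ord k))).
have mk (P : pred V) : \sum_(nu | P nu) g nu = \sum_nu (P nu)%:R * g nu.
  by rewrite big_mkcond; apply: eq_bigr => nu _; case: (P nu); rewrite ?mul1r ?mul0r.
rewrite mk (eq_bigr (fun k : 'I_l => \sum_nu (Pr (vincr k nu) && (vdecr k (vincr k nu) == nu))%:R * g nu)) => [|k _]; last exact: mk.
rewrite [RHS](eq_bigr (fun k : 'I_l.+1 => \sum_nu (inter (vdecr k lam) nu && (ent nu l == 0%N))%:R * g nu)) => [|k _]; last exact: mk.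
rewrite exchange_big [RHS]exchange_big -big_split /=; apply: eq_bigr => nu _.
rewrite -!mulr_suml -mulrDl -!natr_sum -natrD.
case: (pselect (vdec nu)) => [nd|nd]; last by rewrite /g gt_vdec // !mulr0.
by congr (_%:R * _); apply: pieri_count.
Qed.

End Pieri.

(** * Degrees and the weights x^d/d! *)

Lemma incr_leq q (b : nat -> nat) r r' : (forall r, (r < q)%N -> (b r < b r.+1)%N) ->
  (r <= r')%N -> (r' <= q)%N -> (b r + (r' - r) <= b r')%N.
Proof.
move=> bi; elim: r' => [|r' IH] rr rq; first by move: rr; rewrite leqn0 => /eqP ->; rewrite subnn addn0.
move: rr; rewrite leq_eqVlt => /orP[/eqP ->|]; first by rewrite subnn addn0.
rewrite ltnS => rr; have H := IH rr (ltnW rq); have := bi r' rq.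
by rewrite subSn // addnS; apply: leq_ltn_trans.
Qed.

(** The number of boxes of the partition behind the staircase a. *)
Definition dsize q (a : nat -> nat) := (\sum_(0 <= r < q.+1) (a r - r.+1))%N.

Lemma wts_homog q l a M : strict q a -> M \in wts q l a -> (\sum_(i < l) nth 0%N M i = dsize q a)%N.
Proof.
elim: l a M => [|l IH] a M sa.
  rewrite -[wts _ _ _]/(if all (fun r => a r == r.+1) (iota 0 q.+1) then [:: [::]] else [::]).
  case: ifP => // /allP H _; rewrite big_ord0 /dsize big_nat_cond big1 // => r /andP[/andP[_ rq] _].
  have /eqP -> : a r == r.+1 by apply: H; rewrite mem_iota.
  by rewrite subnn.
move=> /= /flattenP[s /mem_map_In[p pin ->] /mapP[M' M'in ->]].
have Ip := below_interl (strict_interl sa) pin.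
have [_ H2 _ _ pE] := below_spec pin.
rewrite big_ord_recr /= nth_rcons (size_wts M'in) ltnn eqxx.
rewrite (eq_bigr (fun i : 'I_l => nth 0%N M' i)) => [|i _]; last by rewrite nth_rcons (size_wts M'in) ltn_ord.
rewrite (IH _ _ (interl_strict Ip) M'in) pE /dsize -big_split /=.
apply: eq_big_nat => r /andP[_]; rewrite ltnS => rq.
by have := H2 r; have := strict_gt (interl_strict Ip) rq; lia.
Qed.

Section Shifted.
Variables (m K : nat) (R : comNzRingType).
Implicit Types (u : nat -> nat -> R) (lam : {ffun 'I_m -> 'I_K.+1}).

Lemma shifted_gt u c q lam : (q < m)%N -> vdec lam -> vsupp q.+1 lam ->
  \sum_(M <- shifted (fun _ : 'I_m => c) (wts q m (bof q lam))) \prod_(j < m) u j (M j) =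
  gt (fun i d => u i (d + c)%N) m lam.
Proof. by move=> qm ld ls; rewrite /shifted big_map -(wts_gt (fun i d => u i (d + c)%N) m qm ld ls). Qed.

End Shifted.

Section Weights.
Variables (R : archiRealFieldType) (m : nat).
Implicit Types (f : 'I_m -> R) (W : seq ('I_m -> nat)).

Definition ux f (i d : nat) : R := (if insub i is Some i' then f i' else 0) ^+ d / d`!%:R.

Lemma uxE f (i : 'I_m) d : ux f i d = f i ^+ d / d`!%:R.
Proof. by rewrite /ux valK. Qed.

Lemma ux_ge0 f i d : (forall i, 0 <= f i) -> 0 <= ux f i d.
Proof. by move=> f0; rewrite /ux; case: insub => [i'|]; rewrite divr_ge0 ?exprn_ge0. Qed.

Lemma Fw_ux W f : Fw W f = \sum_(M <- W) \prod_(j < m) ux f j (M j).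
Proof. by apply: eq_bigr => M _; apply: eq_bigr => j _; rewrite uxE. Qed.

Lemma Fw_dlist i W f : Fw (dlist i W) f = \sum_(M <- W) \prod_(j < m) du (ux f) i j (M j).
Proof.
rewrite /Fw /dlist big_map big_filter big_mkcond /=; apply: eq_bigr => M _.
case: ifP => [Mi|/negbT]; last first.
  by rewrite -eqn0Ngt => /eqP Mi; rewrite (bigD1 i) //= /du eqxx Mi mul0r.
apply: eq_bigr => j _; rewrite /du -[_ == _ :> nat]/(j == i); case: eqP => [->|_].
  by case: (M i) Mi => // k _; rewrite subn1 uxE.
by rewrite subn0 uxE.
Qed.

Lemma homog_dlists k s W : homogW k.+1 W -> homogW k (dlists s W).
Proof.
move=> hW M /(@In_flatten _ _ M)[l [/List.in_map_iff[i [<- _]] /List.in_map_iff[M' [<- M'in]]]].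
have [M'W Mi] : List.In M' W /\ (0 < M' i)%N.
  elim: W M'in {hW} => //= M0 W IH; case: ifP => [M0i|_] /=; last by move=> /IH[]; split=> //; right.
  by move=> [<-|/IH[]] //; split => //; [left|right].
have := hW M' M'W; rewrite (bigD1 i) //= [in X in _ -> X](bigD1 i) //= eqxx.
have -> : (\sum_(j < m | j != i) (M' j - (j == i)) = \sum_(j < m | j != i) M' j)%N.
  by apply: eq_bigr => j /negbTE ->; rewrite subn0.
by case: (M' i) Mi => // k' _; rewrite subn1 addSn => -[].
Qed.

(** The pattern formed by rectangles alone contributes this product, and the other contributions are
    nonnegative. *)
Lemma gt_rect K n l (u : nat -> nat -> R) : (l <= m)%N -> (n <= K)%N -> (forall i d, 0 <= u i d :> R) ->
  \prod_(i < l) u i n <= gt u l (mkV m K (fun j => if (j < l)%N then n else 0%N)).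
Proof.
move=> lm nK u0.
have g0 l' (lam : {ffun 'I_m -> 'I_K.+1}) : 0 <= gt u l' lam.
  elim: l' lam => [|l' IH] lam /=; first exact: ler0n.
  by apply: sumr_ge0 => nu _; rewrite mulr_ge0.
pose rc l' := mkV m K (fun j => if (j < l')%N then n else 0%N).
have rcE l' j : (l' <= m)%N -> ent (rc l') j = (if (j < l')%N then n else 0%N).
  move=> l'm; have [jm|mj] := ltnP j m; first by rewrite ent_mkV //; case: ifP.
  by rewrite ent_out // ltnNge (leq_trans l'm mj).
elim: l lm => [|l IH] lm.
  rewrite big_ord0 /= (_ : _ == _) //; apply/eqP; congr mkV.
rewrite big_ord_recr /= (bigD1 (rc l)) /=; last first.
  apply/interP => j; rewrite !rcE ?(ltnW lm) //.
  rewrite !ltnS; have [jl|lj] := ltnP j l; first by rewrite (ltnW jl).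
  by split.
have -> : (vsize (rc l.+1) - vsize (rc l))%N = n.
  rewrite /vsize -sumnB => [|j _]; last by rewrite !rcE ?(ltnW lm) //; case: ifP => // jl; rewrite (leqW jl).
  rewrite (eq_bigr (fun j => if j == l then n else 0%N)) => [|j _]; last first.
    by rewrite !rcE ?(ltnW lm) // ltnS leq_eqVlt; case: (ltngtP j l) => //= _; rewrite ?subnn ?subn0.
  by rewrite -big_mkcond big_mkord (big_pred1 (Ordinal lm)) // => j; rewrite -val_eqE.
rewrite mulrC -[X in X <= _]addr0; apply: lerD; last by apply: sumr_ge0 => nu _; rewrite mulr_ge0.
by rewrite ler_wpM2l // IH // ltnW.
Qed.

End Weights.

(** * Upper bounds for the dimensions *)

Section Upper.
Variables (R : archiRealFieldType) (q n : nat).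
Notation m := q.+1.
Notation nocut := (fun _ : 'I_m => 0%N).
Notation ngdim b k x := (gdim R n (fun r : 'I_q.+1 => b r) k x).
Notation K := (n + q).+1.
Implicit Types (b : nat -> nat) (f : 'I_m -> R) (x : 'X_{1..m}).

(** The partition of b with q extra columns, one for each degree of freedom of a point in L. The
    same formula is right when b_0 = 0; its last part is then q - 1, which lets [Wlist_gt] treat
    both cases of [Wlist] uniformly. *)
Definition Lam b : {ffun 'I_m -> 'I_K.+1} := mkV m K (fun j => b (q - j) + j - 1)%N.
Definition tail0 b := forall r, (q < r)%N -> b r = 0%N.
Definition increasing b := forall r, (r < q)%N -> (b r < b r.+1)%N.

Lemma ent_Lam b j : increasing b -> (b q <= n.+1)%N -> (j <= q)%N -> ent (Lam b) j = (b (q - j) + j - 1)%N.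
Proof.
move=> bi bn jq; rewrite ent_mkV //.
by have := incr_leq bi (leq_subr j q) (leqnn q); lia.
Qed.

Definition lamof b : {ffun 'I_m -> 'I_K.+1} := mkV m K (fun j => b (q - j) - (q - j).+1)%N.

Lemma ent_lamof b j : increasing b -> (b q <= n.+1)%N -> (j <= q)%N -> ent (lamof b) j = (b (q - j) - (q - j).+1)%N.
Proof.
move=> bi bn jq; rewrite ent_mkV //.
by have := incr_leq bi (leq_subr j q) (leqnn q); lia.
Qed.

Lemma vsupp_m (lam : {ffun 'I_m -> 'I_K.+1}) : vsupp m lam.
Proof. by move=> j mj; rewrite ent_out. Qed.

Lemma vdec_lamof b : strict q b -> (b q <= n.+1)%N -> vdec (lamof b).
Proof.
move=> [b0 bi] bn j; have [jq|qj] := ltnP j q; last by rewrite ent_out.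
rewrite !ent_lamof // ?(ltnW jq) //; have := bi (q - j.+1)%N; rewrite subnSK //.
have := incr_leq bi (leq0n (q - j.+1)) (leq_subr _ _).
have -> : (q - j = (q - j.+1).+1)%N by lia.
by move=> ? /(_ _); lia.
Qed.

Lemma bof_lamof b : strict q b -> tail0 b -> (b q <= n.+1)%N -> bof q (lamof b) = b.
Proof.
move=> sb bz bn; apply/funext => r; rewrite /bof; case: leqP => rq; last by rewrite bz.
case: (sb) => b0 bi; rewrite ent_lamof ?leq_subr // subKn //.
by have := strict_gt sb rq; lia.
Qed.

Lemma Wlist_gt (u : nat -> nat -> R) b : (0 < q)%N -> increasing b -> tail0 b -> (b q <= n.+1)%N ->
  \sum_(M <- @Wlist q b) \prod_(j < m) u j (M j) = gt u m (Lam b).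
Proof.
move=> q0 bi bz bn; rewrite /Wlist; case: eqP => [b0|/eqP]; last first.
  rewrite -lt0n => b0; have sb : strict q b by split.
  rewrite -{1}(bof_lamof sb bz bn).
  rewrite (@shifted_gt m K R u q q (lamof b) (ltnSn q) (vdec_lamof sb bn) (@vsupp_m (lamof b))).
  have bd j : (ent (lamof b) j + q <= K)%N.
    have [jq|qj] := leqP j q; last by rewrite ent_out //; lia.
    by rewrite ent_lamof //; have := incr_leq bi (leq_subr j q) (leqnn q); lia.
  rewrite (@gt_shift m K R u q m (lamof b) (leqnn m) (@vsupp_m (lamof b)) bd).
  congr gt; apply: ent_inj => j jm; have jq : (j <= q)%N by rewrite -ltnS.
  rewrite ent_vadd // jm ent_Lam // ent_lamof //.
  have := strict_gt sb (leq_subr j q); have := incr_leq bi (leq_subr j q) (leqnn q) => H1 H2.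
  by rewrite (minn_idPl _); lia.
have br r : (r <= q)%N -> (r <= b r)%N.
  by move=> rq; have := incr_leq bi (leq0n r) rq; rewrite b0 subn0.
have bl r : (r <= q)%N -> (b r <= n.+1)%N.
  by move=> rq; have := incr_leq bi rq (leqnn q); lia.
pose lam : {ffun 'I_m -> 'I_K.+1} := mkV m K (fun j => b (q - j) - (q - j))%N.
have lamE j : (j <= q)%N -> ent lam j = (b (q - j) - (q - j))%N.
  by move=> jq; rewrite ent_mkV //; have := bl (q - j)%N (leq_subr _ _); lia.
have ls : vsupp q lam.
  move=> j qj; have [jq|jq] := leqP j q; last by rewrite ent_out.
  have -> : j = q by apply/eqP; rewrite eqn_leq jq.
  by rewrite lamE // subnn b0.
have ld : vdec lam.
  move=> j; have [jq|qj] := ltnP j q; last by rewrite ls // leqW.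
  rewrite !lamE ?(ltnW jq) //; have := bi (q - j.+1)%N; rewrite subnSK //.
  have := br (q - j.+1)%N (leq_subr _ _).
  have -> : (q - j = (q - j.+1).+1)%N by lia.
  by move=> ? /(_ _); lia.
have qE : q = q.-1.+1 by rewrite prednK.
have q1m : (q.-1 < m)%N by lia.
have bE : (fun r => b r.+1) = bof q.-1 lam.
  apply/funext => r; rewrite /bof; case: leqP => rq; last by rewrite bz //; lia.
  rewrite lamE; last by lia.
  have -> : (q - (q.-1 - r) = r.+1)%N by lia.
  by have := br r.+1; lia.
have ls' : vsupp q.-1.+1 lam by rewrite -qE.
rewrite bE (@shifted_gt m K R u q.-1 q.-1 lam q1m ld ls').
have bd j : (ent lam j + q.-1 <= K)%N.
  have [jq|qj] := leqP j q; last by rewrite ent_out //; lia.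
  by rewrite lamE //; have := bl (q - j)%N (leq_subr _ _); lia.
rewrite (@gt_shift m K R u q.-1 m lam (leqnn m) (@vsupp_m lam) bd).
congr gt; apply: ent_inj => j jm; have jq : (j <= q)%N by rewrite -ltnS.
rewrite ent_vadd // jm ent_Lam // lamE //.
have := br (q - j)%N (leq_subr _ _); have := bl (q - j)%N (leq_subr _ _) => H1 H2.
by rewrite (minn_idPl _); lia.
Qed.

Lemma dec_tail0 b t : tail0 b -> tail0 (dec b t).
Proof. by move=> bz r qr; rewrite /dec bz. Qed.

Lemma dec_increasing b t : increasing b -> corner b t -> increasing (dec b t).
Proof.
move=> bi ct r rq; have H := bi r rq; rewrite /dec.
case: (eqVneq r t) => [E|_]; first by rewrite -E (_ : (r.+1 == r) = false) ?gtn_eqF //; lia.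
case: (eqVneq r.+1 t) => [E|_]; last by rewrite !subn0.
by move: ct; rewrite -E /=; lia.
Qed.

Lemma dec_le b t r : (dec b t r <= b r)%N.
Proof. exact: leq_subr. Qed.

Lemma Lam_dec b t : strict q b -> (b q <= n.+1)%N -> (t <= q)%N ->
  vdecr (q - t)%N (Lam b) = mkV m K (fun j => dec b t (q - j) + j - 1)%N.
Proof.
move=> sb bn tq; case: (sb) => b0 bi; apply: ent_inj => j jm; have jq : (j <= q)%N by rewrite -ltnS.
rewrite ent_vdecr ent_Lam // ent_mkV //; last first.
  by have := incr_leq bi (leq_subr j q) (leqnn q); rewrite /dec; lia.
rewrite /dec (_ : (j == q - t)%N = (q - j == t)%N); last by apply/eqP/eqP; lia.
have := strict_gt sb (leq_subr j q); case: eqP; lia.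
Qed.

(** The dual Pieri rule for [Lam b]. Decreasing a row that is not a corner produces a sequence that
    is no longer weakly decreasing, and [gt_vdec] makes its term zero. *)
Lemma Wlist_pieri b f : (0 < q)%N -> strict q b -> tail0 b -> (b q <= n.+1)%N ->
  Fw (dlists (enum 'I_m) (@Wlist q b)) f =
  \sum_(u <- iota 0 q.+1 | corner b u) Fw (@Wlist q (dec b u)) f.
Proof.
move=> q0 sb bz bn; case: (sb) => b0 bi; rewrite /dlists Fw_flatten.
transitivity (\sum_(i < m) gt (du (ux f) i) m (Lam b)).
  rewrite big_enum /=; apply: eq_bigr => i _; rewrite Fw_dlist.
  exact: (Wlist_gt (fun j => du (ux f) i j) q0 bi bz bn).
have ld : vdec (Lam b).
  move=> j; have [jq|qj] := ltnP j q; last by rewrite ent_out.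
  rewrite !ent_Lam // ?(ltnW jq) //; have := bi (q - j.+1)%N; rewrite subnSK //.
  have -> : (q - j = (q - j.+1).+1)%N by lia.
  by move=> /(_ _); lia.
rewrite gt_pieri //; last 2 first.
- exact: vsupp_m.
- move=> j; rewrite ltnS => jq; rewrite ent_Lam //; have := strict_gt sb (leq_subr j q); lia.
rewrite -(big_mkord xpredT (fun k => gt (ux f) m (vdecr k (Lam b)))) big_nat_rev /= add0n.
rewrite [RHS]big_mkcond /index_iota subn0 big_seq [RHS]big_seq; apply: eq_bigr => t.
rewrite mem_iota add0n ltnS subSS => /andP[_ tq]; rewrite Lam_dec //.
case: ifP => ct.
  rewrite Fw_ux (Wlist_gt (ux f) q0) //; [exact: dec_increasing|exact: dec_tail0|exact: leq_trans (dec_le _ _ _) bn].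
rewrite -[LHS]/(gt (ux f) m (mkV m K (fun j => dec b t (q - j) + j - 1)%N)).
apply: gt_vdec => H; case: t tq ct H => [//|t] tq /negbT ct /(_ (q - t.+1)%N).
have e1 : (q - (q - t.+1) = t.+1)%N by lia.
have e2 : (q - (q - t.+1).+1 = t)%N by lia.
have l1 : (b t.+1 <= n.+1)%N by have := incr_leq bi tq (leqnn q); lia.
rewrite !ent_mkV ?e1 ?e2; try (rewrite /dec; have := bi t tq; lia).
have bt0 := strict_gt sb (ltnW tq); have bt1 := bi t tq.
have d1 : dec b t.+1 t = b t by rewrite /dec ltn_eqF // subn0.
have d2 : dec b t.+1 t.+1 = b t.
  move: ct; rewrite /= /dec eqxx -leqNgt; case: (b t.+1) bt1 => // w.
  by rewrite ltnS subn1 /= => le1 le2; apply/eqP; rewrite eqn_leq le2.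
by rewrite d1 d2; move: bt0; lia.
Qed.

Definition hdeg b := (\sum_(0 <= r < q.+1) (b r + (q - r) - 1))%N.

Lemma homog_shifted c b : strict q b ->
  homogW (dsize q b + \sum_i c i) (shifted (c : 'I_m -> nat) (wts q m b)).
Proof.
move=> sb M /List.in_map_iff[M' [<- /In_mem M'in]].
by rewrite big_split /= (wts_homog sb M'in).
Qed.

Lemma homog_Wlist b : (0 < q)%N -> increasing b -> homogW (hdeg b) (@Wlist q b).
Proof.
move=> q0 bi; rewrite /Wlist; case: eqP => [b0|/eqP]; last first.
  rewrite -lt0n => b0; have sb : strict q b by split.
  suff -> : hdeg b = (dsize q b + \sum_(i < m) q)%N by apply: homog_shifted.
  rewrite /hdeg /dsize -(big_mkord xpredT (fun=> q)) -big_split /=; apply: eq_big_nat => r /andP[_].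
  by rewrite ltnS => rq; have := strict_gt sb rq; lia.
move=> M /List.in_map_iff[M' [<- /In_mem M'in]].
have sb : strict q.-1 (fun r => b r.+1).
  split=> [|r rq]; first by have := bi 0%N q0; rewrite b0.
  by apply: bi; lia.
rewrite big_split /= (wts_homog sb M'in) /dsize /hdeg prednK //.
rewrite -(big_mkord xpredT (fun=> q.-1)) big_nat_recl // [RHS]big_nat_recl // b0 addnCA -big_split /=.
congr addn; first by lia.
apply: eq_big_nat => r /andP[_ rq]; have := incr_leq bi (leq0n r.+1) rq; lia.
Qed.

Lemma hdeg_dec b t : (0 < q)%N -> strict q b -> (t <= q)%N -> hdeg b = (hdeg (dec b t)).+1.
Proof.
move=> q0 sb tq; rewrite /hdeg !big_mkord (bigD1 (inord t)) //= [in RHS](bigD1 (inord t)) //=.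
have tE : (inord t : 'I_q.+1) = t :> nat by rewrite inordK.
rewrite tE /dec eqxx -addSn; congr addn.
  by have := strict_gt sb tq; lia.
apply: eq_bigr => r rt; rewrite (_ : (r == t :> nat) = false) ?subn0 //.
by apply/negbTE; rewrite -tE; apply: contraNneq rt => H; apply/eqP/val_inj.
Qed.

Variable N : nat.
Hypothesis nN : n = (N + q)%N.

Definition rectb r := if (r <= q)%N then (N + r.+1)%N else 0%N.

Lemma strict_rect : strict q rectb.
Proof. by split=> [|r rq]; rewrite /rectb /= ?addn1 // rq (ltnW rq) ltn_add2l. Qed.

(** For the rectangle L is arbitrary, so the q + 1 points are arbitrary in P^n. Accordingly the
    monomial count [dbound], with leading form the product of x_i^n/n!, suffices. *)
Lemma rect_upper : asyLe (fun x => ngdim rectb nocut x) (dsize q rectb + \sum_(i < m) q)%N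
  (fun x => Fw (shifted (fun _ : 'I_m => q) (wts q m rectb)) (rmnm R x)).
Proof.
have bn : (rectb q <= n.+1)%N by rewrite /rectb leqnn nN addnS.
have bz : tail0 rectb by move=> r qr; rewrite /rectb leqNgt qr.
have [b0 bi] := strict_rect.
have dE : (dsize q rectb + \sum_(i < m) q = \sum_(i < m) n)%N.
  rewrite /dsize -(big_mkord xpredT (fun=> q)) -(big_mkord xpredT (fun=> n)) -big_split /=.
  by apply: eq_big_nat => r /andP[_]; rewrite ltnS /rectb => ->; rewrite nN; lia.
rewrite dE.
apply: (@asyLe_bound R m (@dbound m n) _ _ (fun x => \prod_i ((x i)%:R ^+ n / n`!%:R))).
- by move=> x; apply: gdim_bound.
- move=> x; rewrite Fw_ux -(bof_lamof strict_rect bz bn).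
  rewrite (@shifted_gt m K _ (ux (rmnm R x))) //; [|exact: vdec_lamof strict_rect bn|exact: vsupp_m].
  have lE j : (j <= q)%N -> ent (lamof rectb) j = N.
    by move=> jq; rewrite ent_lamof // /rectb leq_subr; lia.
  have bd j : (ent (lamof rectb) j + q <= K)%N.
    have [jq|qj] := leqP j q; last by rewrite ent_out //; lia.
    by rewrite lE // nN; lia.
  rewrite (@gt_shift m K R (ux (rmnm R x)) q m (lamof rectb) (leqnn m) (@vsupp_m (lamof rectb)) bd).
  have nK : (n <= K)%N by lia.
  have -> : vadd m q (lamof rectb) = mkV m K (fun j => if (j < m)%N then n else 0%N).
    apply: ent_inj => j jm; have jq : (j <= q)%N by rewrite -ltnS.
    by rewrite ent_vadd // jm ent_mkV ?jm // lE // -nN; apply/minn_idPl.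
  apply: le_trans (gt_rect (leqnn m) nK _); last by move=> i d; apply: ux_ge0 => ?; apply: ler0n.
  by rewrite le_eqVlt; apply/orP; left; apply/eqP; apply: eq_bigr => i _; rewrite uxE.
apply: asy_asyLe => x; apply: (@asy_ext _ _ _ (fun M => \prod_i 'C(n + x i * M, n)%:R)).
  by move=> M; rewrite /dbound natr_prod; apply: eq_bigr => i _; rewrite mulmnE.
by apply: asy_prod => i; apply: asy_bin.
Qed.

(** Descend from the rectangle. If b is c less one box, the Plucker inequality for c contains b and
    the other corners; the leading forms balance exactly by [Wlist_pieri], so lower bounds for the
    other corners leave the upper bound for b. *)
Lemma nocut_upper b : strict q b -> tail0 b -> b q = n.+1 ->
  asyLe (fun x => ngdim b nocut x) (dsize q b + \sum_(i < m) q)%N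
    (fun x => Fw (shifted (fun _ : 'I_m => q) (wts q m b)) (rmnm R x)).
Proof.
elim: {b}(\sum_(0 <= r < q.+1) (N + r.+1 - b r))%N {-2}b (erefl (\sum_(0 <= r < q.+1) (N + r.+1 - b r))%N)
  => [|e IH] b be sb bz bn.
  suff -> : b = rectb by apply: rect_upper.
  apply/funext => r; rewrite /rectb; case: leqP => rq; last exact: bz.
  case: sb => b0 bi; have := incr_leq bi rq (leqnn q).
  move/eqP: be; rewrite big_mkord sum_nat_eq0 => /forallP/(_ (Ordinal (rq : (r < q.+1)%N))) /= /eqP; lia.
case: (sb) => b0 bi.
have ble r : (r <= q)%N -> (b r <= N + r.+1)%N.
  by move=> rq; have := incr_leq bi rq (leqnn q); lia.
pose P t := (t <= q)%N && (b t < N + t.+1)%N.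
have exP : exists t, P t.
  apply: contrapT => nP; suff : (\sum_(0 <= r < q.+1) (N + r.+1 - b r) = 0)%N by rewrite be.
  rewrite big_nat_cond big1 // => r /andP[/andP[_ rq] _]; apply/eqP; rewrite subn_eq0 leqNgt; apply/negP => H.
  by apply: nP; exists r; rewrite /P -ltnS rq.
have Pq t : P t -> (t <= q)%N by case/andP.
(* Taking the last row that is not full guarantees that adding a box there keeps the staircase
   strict. *)
case: (ex_maxnP exP Pq) => t /andP[tq bt] tmax.
have tq' : (t < q)%N by rewrite ltn_neqAle tq andbT; apply/eqP => E; move: bt; rewrite E bn nN; lia.
have q0 : (0 < q)%N by apply: leq_ltn_trans tq'.
have bhi r : (t < r)%N -> (r <= q)%N -> b r = (N + r.+1)%N.
  move=> tr rq; apply/eqP; rewrite eqn_leq ble //= leqNgt; apply/negP => H.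
  by have := tmax r; rewrite /P rq H => /(_ isT); rewrite leqNgt tr.
pose c r := (b r + (r == t))%N.
have sc : strict q c.
  split=> [|r rq]; rewrite /c; first by rewrite addn_gt0 b0.
  have := bi r rq; case: (eqVneq r t) => [E|_]; last by case: eqP; lia.
  by have := bhi r.+1; rewrite E ltnSn => /(_ isT tq'); case: eqP; lia.
have cz : tail0 c by move=> r qr; rewrite /c bz // (_ : (r == t) = false) //; apply/negbTE; rewrite neq_ltn orbC (leq_trans _ qr).
have cn : c q = n.+1 by rewrite /c bn (_ : (q == t) = false) ?addn0 ?gtn_eqF.
have dc : dec c t = b by apply/funext => r; rewrite /dec /c; case: eqP => _; lia.
have ct' t' : t = t'.+1 -> (c t' < (c t'.+1).-1)%N.
  move=> E; have t'q : (t' < q)%N by lia.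
  have e0 : (t' == t) = false by rewrite E ltn_eqF.
  by have := bi t' t'q; rewrite /c -E eqxx e0 addn0 addn1.
have cc : corner c t.
  have gen s : s = t -> corner c s by case: s => [|s] // /esym; apply: ct'.
  exact: gen.
have Wc (a : nat -> nat) : strict q a -> @Wlist q a = shifted (fun _ : 'I_m => q) (wts q m a).
  by move=> [a0 _]; rewrite /Wlist; case: eqP => // E; rewrite E in a0.
have hE (a : nat -> nat) : strict q a -> hdeg a = (dsize q a + \sum_(i < m) q)%N.
  move=> sa; rewrite /hdeg /dsize -(big_mkord xpredT (fun=> q)) -big_split /=; apply: eq_big_nat => r /andP[_].
  by rewrite ltnS => rq; have := strict_gt sa rq; lia.
have IHc : asyLe (fun x => ngdim c nocut x) (hdeg c) (fun x => Fw (@Wlist q c) (rmnm R x)).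
  rewrite Wc // hE //; apply: IH => //; apply: succn_inj; rewrite -be !big_mkord.
  rewrite (bigD1 (Ordinal (tq : (t < q.+1)%N))) //= [RHS](bigD1 (Ordinal (tq : (t < q.+1)%N))) //=.
  rewrite -addSn; congr addn; first by rewrite /c eqxx; lia.
  apply: eq_bigr => r rt; rewrite /c (_ : (r == t :> nat) = false) ?addn0 //.
  by apply/negbTE; apply: contraNneq rt => H; apply/eqP/val_inj.
rewrite -Wc // -hE //.
have hc : hdeg c = (hdeg b).+1 by rewrite -dc; apply: hdeg_dec.
pose WE := flatten [seq @Wlist q (dec c u) | u <- iota 0 q.+1 & corner c u && (u != t)].
have cn' : (c q <= n.+1)%N by rewrite cn.
have bn' : (b q <= n.+1)%N by rewrite bn.
have ic : increasing c by case: sc.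
apply: (@asyLe_derivative R m (fun x => ngdim c nocut x) _ _ (@Wlist q c) _ WE (enum 'I_m) (mone m)).
- by move=> i; rewrite mnmE count_uniq_mem ?enum_uniq // mem_enum.
- by rewrite -hc; apply: homog_Wlist.
- by apply: homog_dlists; rewrite -hc; apply: homog_Wlist.
- move=> M /(@In_flatten _ _ M)[l [/List.in_map_iff[u [<- /In_mem]]]].
  rewrite mem_filter mem_iota add0n ltnS => /andP[/andP[cu _] /andP[_ uq]].
  have -> : hdeg b = hdeg (dec c u) by apply: succn_inj; rewrite -hc; apply: hdeg_dec.
  by apply: homog_Wlist => //; apply: dec_increasing.
- by move=> x; have := @gdim_plucker R q n c t x q0 sc cn' tq cc; rewrite dc.
- by move=> x y; apply: gdim_mono.
- by rewrite -hc.
- by move=> x; apply: gdim_Wlist.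
move=> f f0; rewrite Wlist_pieri // -big_filter.
rewrite (bigD1_seq t) ?filter_uniq ?iota_uniq ?mem_filter ?mem_iota ?add0n ?ltnS ?cc ?tq //.
by rewrite dc lerD2l big_filter_cond Fw_flatten big_filter.
Qed.

(** Cuts are introduced one at a time: each cut of point i is a unit step of [gdim_cut], and it
    differentiates the leading form in variable i. *)
Lemma gdim_upper b k : strict q b -> tail0 b -> b q = n.+1 -> (forall i, (k i <= q)%N) ->
  asyLe (fun x => ngdim b k x) (dsize q b + \sum_i (q - k i))%N
    (fun x => Fw (shifted (fun i => q - k i)%N (wts q m b)) (rmnm R x)).
Proof.
move=> sb bz bn; have bn' : (b q <= n.+1)%N by rewrite bn.
have qn := strict_n sb bn'.
have ha (r : 'I_q.+1) : (r < b r)%N by apply: (strict_gt sb); rewrite leq_ord.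
elim: {k}(\sum_i k i)%N {-2}k (erefl (\sum_i k i)%N) => [|e IH] k ke kq.
  have -> : k = nocut.
    apply/funext => i; apply/eqP; move/eqP: ke.
    by rewrite sum_nat_eq0 => /forallP/(_ i).
  by have := nocut_upper sb bz bn; rewrite subn0.
have [i ki] : exists i, (0 < k i)%N.
  apply: contrapT => nk; suff : (\sum_i k i = 0)%N by rewrite ke.
  by rewrite big1 // => i _; apply/eqP; rewrite eqn0Ngt; apply/negP => ki; apply: nk; exists i.
pose k' j := (k j - (j == i))%N.
have kE : k = incr k' i by apply/funext => j; rewrite /incr /k'; case: eqP => [->|_]; lia.
have k'i : (k' i < q)%N by rewrite /k' eqxx; have := kq i; lia.
have k'q j : (k' j <= q)%N by apply: leq_trans (leq_subr _ _) (kq j).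
have IHk : asyLe (fun x => ngdim b k' x) (dsize q b + \sum_j (q - k' j))%N
    (fun x => Fw (shifted (fun j => q - k' j)%N (wts q m b)) (rmnm R x)).
  apply: IH => //; apply: succn_inj; rewrite -ke (bigD1 i) //= [RHS](bigD1 i) //= -addSn /k' eqxx; congr addn.
    by rewrite subn1 prednK.
  by apply: eq_bigr => j /negbTE ->; rewrite subn0.
have dS : (dsize q b + \sum_j (q - k' j) = (dsize q b + \sum_j (q - k j)).+1)%N.
  rewrite -addnS; congr addn; rewrite (bigD1 i) //= [in RHS](bigD1 i) //= -addSn /k' eqxx; congr addn.
    by have := kq i; lia.
  by apply: eq_bigr => j /negbTE ->; rewrite subn0.
have dW : dlists [:: i] (shifted (fun j => q - k' j)%N (wts q m b)) = shifted (fun j => q - k j)%N (wts q m b).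
  rewrite /dlists /= cats0 /dlist (_ : filter _ _ = shifted (fun j => q - k' j)%N (wts q m b)); last first.
    apply/all_filterP; rewrite /shifted all_map; apply/allP => M _ /=.
    by rewrite addn_gt0 subn_gt0 k'i orbT.
  rewrite /shifted -map_comp; apply: eq_map => M; apply/funext => j /=; rewrite /k'.
  by case: eqP => [->|_]; rewrite ?subn0 //; have := kq i; lia.
apply: (@asyLe_derivative R m (fun x => ngdim b k' x) _ _ (shifted (fun j => q - k' j)%N (wts q m b)) _ [::] [:: i] U_(i)%MM).
- by move=> j; rewrite mnm1E /= addn0.
- by rewrite -dS; apply: homog_shifted.
- by apply: homog_dlists; rewrite -dS; apply: homog_shifted.
- by [].
- move=> x; rewrite /binsum big_nil addn0 {1}kE; exact: gdim_cut.
- by move=> x y; apply: gdim_mono.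
- by rewrite -dS.
- by move=> x; apply: gdim_lower.
by move=> f f0; rewrite dW /(Fw [::] _) big_nil addr0.
Qed.

End Upper.

(** * Discrete Prekopa-Leindler and Brunn-Minkowski inequalities *)

Section PrekopaLeindler.
Variable R : rcfType.
Implicit Types (a b c : nat -> R).

(* Walk from (i, j) towards the maxima (i0, j0), each time paying for the smaller of a_i and b_j. *)
Lemma staircase_left a b c i0 j0 :
  (forall i, (i <= i0)%N -> a i <= 1) -> (forall j, (j <= j0)%N -> b j <= 1) -> a i0 = 1 -> b j0 = 1 ->
  (forall i j, (i <= i0)%N -> (j <= j0)%N -> a i <= b j -> a i <= c (i + j)%N) ->
  (forall i j, (i <= i0)%N -> (j <= j0)%N -> b j <= a i -> b j <= c (i + j)%N) ->
  forall e i j, (i <= i0)%N -> (j <= j0)%N -> ((i0 - i) + (j0 - j) = e)%N ->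
  \sum_(i <= k < i0) a k + \sum_(j <= k < j0) b k <= \sum_(i + j <= k < i0 + j0) c k.
Proof.
move=> a1 b1 ai bj Ha Hb; elim=> [|e IH] i j ii jj E.
  have -> : i = i0 by lia.
  have -> : j = j0 by lia.
  by rewrite !big_geq // addr0.
have [[il ab]|[jl ba]] : ((i < i0)%N /\ a i <= b j) \/ ((j < j0)%N /\ b j <= a i).
  have [il|] := ltnP i i0; last first.
    move=> i0i; have iE : i = i0 by lia.
    by right; split; [lia | rewrite iE ai; apply: b1].
  have [ab|ba] := leP (a i) (b j); first by left.
  have [jl|j0j] := ltnP j j0; first by right; split=> //; apply: ltW.
  have jE : j = j0 by lia.
  by move: (lt_le_trans ba (a1 i ii)); rewrite jE bj ltxx.
- have ijl : (i + j < i0 + j0)%N by lia.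
  rewrite (big_ltn il) (big_ltn ijl) -addrA; apply: lerD; first exact: Ha.
  by rewrite -addSn; apply: IH => //; lia.
- have ijl : (i + j < i0 + j0)%N by lia.
  rewrite (big_ltn jl) (big_ltn ijl) addrCA; apply: lerD; first exact: Hb.
  by rewrite -addnS; apply: IH => //; lia.
Qed.

Lemma staircase_right a b c i0 j0 n :
  (forall i, (i <= n)%N -> a i <= 1) -> (forall j, (j <= n)%N -> b j <= 1) -> a i0 = 1 -> b j0 = 1 ->
  (forall i j, (i <= n)%N -> (j <= n)%N -> a i <= b j -> a i <= c (i + j).+1) ->
  (forall i j, (i <= n)%N -> (j <= n)%N -> b j <= a i -> b j <= c (i + j).+1) ->
  forall e i j, (i0 <= i <= n)%N -> (j0 <= j <= n)%N -> ((i - i0) + (j - j0) = e)%N ->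
  \sum_(i0.+1 <= k < i.+1) a k + \sum_(j0.+1 <= k < j.+1) b k <= \sum_((i0 + j0).+2 <= k < (i + j).+2) c k.
Proof.
move=> a1 b1 ai bj Ha Hb; elim=> [|e IH] i j /andP[ii iN] /andP[jj jN] E.
  have -> : i = i0 by lia.
  have -> : j = j0 by lia.
  by rewrite !big_geq // addr0.
have [[il ab]|[jl ba]] : ((i0 < i)%N /\ a i <= b j) \/ ((j0 < j)%N /\ b j <= a i).
  have [il|] := ltnP i0 i; last first.
    move=> i0i; have iE : i = i0 by lia.
    by right; split; [lia | rewrite iE ai; apply: b1].
  have [ab|ba] := leP (a i) (b j); first by left.
  have [jl|j0j] := ltnP j0 j; first by right; split=> //; apply: ltW.
  have jE : j = j0 by lia.
  by move: (lt_le_trans ba (a1 i iN)); rewrite jE bj ltxx.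
- case: i ii iN E il ab => // i ii iN E il ab.
  rewrite big_nat_recr //= addSn [X in _ <= X]big_nat_recr /=; last by lia.
  rewrite addrAC; apply: lerD; last by rewrite -addSn; apply: Ha.
  by apply: IH; lia.
- case: j jj jN E jl ba => // j jj jN E jl ba.
  rewrite [X in _ + X]big_nat_recr //= addnS [X in _ <= X]big_nat_recr /=; last by lia.
  rewrite addrA; apply: lerD; last by rewrite -addnS; apply: Hb.
  by apply: IH; lia.
Qed.

(** A discrete one-dimensional sumset bound. Walks on both sides of the common maximum pay for all
    other terms; the maxima themselves use two consecutive values of c, and the right walk uses the
    shifted index i + j + 1. *)
Lemma sumset_sum a b c n (i0 j0 : nat) : (i0 <= n)%N -> (j0 <= n)%N ->
  (forall i, (i <= n)%N -> a i <= 1) -> (forall j, (j <= n)%N -> b j <= 1) -> a i0 = 1 -> b j0 = 1 ->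
  (forall i j, (i <= n)%N -> (j <= n)%N -> a i <= b j -> a i <= c (i + j)%N /\ a i <= c (i + j).+1) ->
  (forall i j, (i <= n)%N -> (j <= n)%N -> b j <= a i -> b j <= c (i + j)%N /\ b j <= c (i + j).+1) ->
  \sum_(0 <= k < n.+1) a k + \sum_(0 <= k < n.+1) b k <= \sum_(0 <= k < (n + n).+2) c k.
Proof.
move=> i0n j0n a1 b1 ai bj Ha Hb.
have L : \sum_(0 <= k < i0) a k + \sum_(0 <= k < j0) b k <= \sum_(0 + 0 <= k < i0 + j0) c k.
  apply: (@staircase_left a b c i0 j0 _ _ ai bj _ _ (i0 - 0 + (j0 - 0))%N) => //.
  - by move=> i ii; apply: a1; apply: leq_trans i0n.
  - by move=> j jj; apply: b1; apply: leq_trans j0n.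
  - by move=> i j ii jj ab; case: (Ha i j (leq_trans ii i0n) (leq_trans jj j0n) ab).
  - by move=> i j ii jj ab; case: (Hb i j (leq_trans ii i0n) (leq_trans jj j0n) ab).
have Rr : \sum_(i0.+1 <= k < n.+1) a k + \sum_(j0.+1 <= k < n.+1) b k <= \sum_((i0 + j0).+2 <= k < (n + n).+2) c k.
  apply: (@staircase_right a b c i0 j0 n _ _ ai bj _ _ (n - i0 + (n - j0))%N) => //; rewrite ?i0n ?j0n ?leqnn //.
  - by move=> i j ii jj ab; case: (Ha i j ii jj ab).
  - by move=> i j ii jj ab; case: (Hb i j ii jj ab).
have ab0 : a i0 <= b j0 by rewrite ai bj.
have [c1 c2] := Ha i0 j0 i0n j0n ab0.
rewrite ai in c1 c2.
have sp (g : nat -> R) k : (k <= n)%N -> \sum_(0 <= i < n.+1) g i = \sum_(0 <= i < k) g i + g k + \sum_(k.+1 <= i < n.+1) g i.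
  move=> kn; rewrite (big_cat_nat (n := k)) //=; last exact: leqW.
  by rewrite [X in _ + X]big_ltn ?ltnS // addrA.
have -> : \sum_(0 <= k < (n + n).+2) c k = \sum_(0 + 0 <= k < i0 + j0) c k + c (i0 + j0)%N + c (i0 + j0).+1 +
    \sum_((i0 + j0).+2 <= k < (n + n).+2) c k.
  rewrite (big_cat_nat (n := (i0 + j0)%N)) //=; last by lia.
  rewrite [X in _ + X]big_ltn ?[X in _ + (_ + X)]big_ltn ?addrA //; lia.
rewrite (sp a i0) // (sp b j0) // ai bj.
have := lerD (lerD L Rr) (lerD c1 c2).
set A0 := \sum_(0 <= i < i0) a i; set A1 := \sum_(i0.+1 <= i < n.+1) a i.
set B0 := \sum_(0 <= i < j0) b i; set B1 := \sum_(j0.+1 <= i < n.+1) b i.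
set C0 := \sum_(0 + 0 <= k < i0 + j0) c k; set C1 := \sum_((i0 + j0).+2 <= k < (n + n).+2) c k.
rewrite (_ : A0 + 1 + A1 + (B0 + 1 + B1) = A0 + B0 + (A1 + B1) + (1 + 1)); last by ring.
by move=> H; apply: le_trans H _; rewrite le_eqVlt; apply/orP; left; apply/eqP; ring.
Qed.

(** Normalize a and b to maximum 1, bound the sum of their masses by [sumset_sum], and finish with 4
    A B <= (A + B)^2. *)
Lemma discrete_pl a b c n k : (forall i, 0 <= a i) -> (forall i, 0 <= b i) -> (forall i, 0 <= c i) -> 0 <= k ->
  (forall i j, (i <= n)%N -> (j <= n)%N -> k * a i * b j <= c (i + j)%N ^+ 2 /\ k * a i * b j <= c (i + j).+1 ^+ 2) ->
  4%:R * k * (\sum_(0 <= i < n.+1) a i) * (\sum_(0 <= j < n.+1) b j) <= (\sum_(0 <= l < (n + n).+2) c l) ^+ 2.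
Proof.
move=> a0 b0 c0 k0 H.
have mx (g : nat -> R) : exists2 i0, (i0 <= n)%N & forall i, (i <= n)%N -> g i <= g i0.
  elim: (n) => [|n' [i0 i0n' H0]].
    by exists 0%N => // i; rewrite leqn0 => /eqP ->.
  have [gl|gl] := leP (g n'.+1) (g i0).
    by exists i0 => [|i]; [exact: leqW | rewrite leq_eqVlt => /orP[/eqP ->|/H0]].
  by exists n'.+1 => // i; rewrite leq_eqVlt => /orP[/eqP -> //|/H0 /le_trans]; apply; apply: ltW.
have [i0 i0n ma] := mx a; have [j0 j0n mb] := mx b.
have z (g : nat -> R) l : (l <= n)%N -> (forall i, 0 <= g i) -> (forall i, (i <= n)%N -> g i <= g l) -> g l = 0 ->
    \sum_(0 <= i < n.+1) g i = 0.
  move=> ln g0 mg gl; rewrite big_nat_cond big1 // => i /andP[/andP[_ il] _]; apply/eqP.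
  by rewrite eq_le g0 andbT -gl mg.
have [ka|ka] := eqVneq (a i0) 0; first by rewrite (z a i0) // mulr0 mul0r sqr_ge0.
have [kb|kb] := eqVneq (b j0) 0; first by rewrite (z b j0) // mulr0 sqr_ge0.
have [kk|kk] := eqVneq k 0; first by rewrite kk mulr0 !mul0r sqr_ge0.
have a1 : 0 < a i0 by rewrite lt_def ka a0.
have b1 : 0 < b j0 by rewrite lt_def kb b0.
have k1 : 0 < k by rewrite lt_def kk k0.
(* Dividing c by this geometric mean turns the hypothesis into c/g >= the smaller of the two
   normalized values. *)
pose g := Num.sqrt (k * a i0 * b j0).
have g2 : g ^+ 2 = k * a i0 * b j0 by rewrite sqr_sqrtr // !mulr_ge0.
have g1 : 0 < g by rewrite sqrtr_gt0 !mulr_gt0.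
have key x y u v : 0 <= x -> 0 <= y -> 0 <= v -> k * x * y <= v ^+ 2 -> u = x / a i0 \/ u = y / b j0 ->
    u <= x / a i0 -> u <= y / b j0 -> u <= v / g.
  move=> x0 y0 v0 xyv uE ux uy.
  have u0 : 0 <= u by case: uE => ->; rewrite divr_ge0.
  rewrite -(@ler_pXn2r _ 2) ?nnegrE ?divr_ge0 ?(ltW g1) // expr2.
  apply: le_trans (ler_pM u0 u0 ux uy) _.
  rewrite expr_div_n g2 ler_pdivlMr ?mulr_gt0 //.
  rewrite (_ : x / a i0 * (y / b j0) * (k * a i0 * b j0) = k * x * y) //.
  by field; rewrite ka kb.
have S : \sum_(0 <= i < n.+1) (a i / a i0) + \sum_(0 <= j < n.+1) (b j / b j0) <=
    \sum_(0 <= l < (n + n).+2) (c l / g).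
  apply: (@sumset_sum (fun i => a i / a i0) (fun j => b j / b j0) (fun l => c l / g) n i0 j0) => //.
  - by move=> i il; rewrite ler_pdivrMr // mul1r ma.
  - by move=> j jl; rewrite ler_pdivrMr // mul1r mb.
  - by rewrite divff.
  - by rewrite divff.
  - move=> i j il jl ab; have [H1 H2] := H i j il jl.
    by split; [apply: (key (a i) (b j)) | apply: (key (a i) (b j))] => //; left.
  - move=> i j il jl ab; have [H1 H2] := H i j il jl.
    by split; [apply: (key (a i) (b j)) | apply: (key (a i) (b j))] => //; right.
move: S; rewrite -!mulr_suml; set SA := \sum_(0 <= i < n.+1) a i; set SB := \sum_(0 <= i < n.+1) b i.
set SC := \sum_(_ <= _ < _) c _ => S.
have SA0 : 0 <= SA by apply: sumr_ge0. have SB0 : 0 <= SB by apply: sumr_ge0.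
have SC0 : 0 <= SC by apply: sumr_ge0.
have P0 : 0 <= SA / a i0 by rewrite divr_ge0 // ltW.
have Q0 : 0 <= SB / b j0 by rewrite divr_ge0 // ltW.
have E1 : 4%:R * (SA / a i0) * (SB / b j0) <= (SC / g) ^+ 2.
  apply: le_trans (_ : (SA / a i0 + SB / b j0) ^+ 2 <= _).
    by have := sqr_ge0 (SA / a i0 - SB / b j0); nra.
  by rewrite ler_pXn2r ?nnegrE ?addr_ge0 ?divr_ge0 // ltW.
move: E1; rewrite expr_div_n g2 ler_pdivlMr ?mulr_gt0 // => E1; apply: le_trans E1.
by rewrite le_eqVlt; apply/orP; left; apply/eqP; field; rewrite ka kb.
Qed.

Fixpoint add3 (s t e : seq nat) : seq nat :=
  match s, t, e with x :: s', y :: t', z :: e' => (x + y + z)%N :: add3 s' t' e' | _, _, _ => [::] end.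

Lemma sum_eq_ltn h N : (\sum_(0 <= i < N) (h == i) = (h < N))%N.
Proof.
elim: N => [|N IH]; first by rewrite big_geq.
rewrite big_nat_recr //= IH [(h < N.+1)%N]ltnS [(h <= N)%N]leq_eqVlt; have [->|_] := eqVneq h N; first by rewrite ltnn.
by rewrite addn0.
Qed.

Definition slice (l : seq (seq nat)) i := [seq behead s | s <- l & head 0%N s == i].

Lemma size_slice l i : size (slice l i) = count (fun s => head 0%N s == i) l.
Proof. by rewrite size_map size_filter. Qed.

Lemma sum_slice l N : (\sum_(0 <= i < N) size (slice l i) = count (fun s => head 0 s < N) l)%N.
Proof.
rewrite (eq_bigr _ (fun i _ => size_slice l i)); elim: l => [|s l IH] /=; first by rewrite big1.
by rewrite big_split /= IH sum_eq_ltn.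
Qed.

Lemma mem_slice d l i s : all (fun s => size s == d.+1) l -> (s \in slice l i) = (i :: s \in l).
Proof.
move=> /allP sl; apply/mapP/idP => [[s']|H]; last by exists (i :: s); rewrite // mem_filter eqxx.
rewrite mem_filter => /andP[/eqP hi s'l] ->; have := sl s' s'l.
by case: s' hi s'l => [|x s'] //= ->.
Qed.

Lemma uniq_slice d l i : all (fun s => size s == d.+1) l -> uniq l -> uniq (slice l i).
Proof.
move=> /allP sl ul; rewrite map_inj_in_uniq ?filter_uniq // => s t.
rewrite !mem_filter => /andP[/eqP hs sin] /andP[/eqP ht tin].
have := sl s sin; have := sl t tin.
by case: s hs {sin} => [|x s] //= ->; case: t ht {tin} => [|y t] //= -> _ _ ->.
Qed.

Lemma size_slice_all d l i : all (fun s => size s == d.+1) l -> all (fun s => size s == d) (slice l i).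
Proof.
move=> sl; apply/allP => s; rewrite (mem_slice _ _ sl) => sin.
by have := allP sl _ sin.
Qed.

(** Slice by the first coordinate: slices i and j add up into slices i + j and i + j + 1, so the
    induction hypothesis supplies the assumption of [discrete_pl] with k = 4^d. The added cube makes
    cardinalities behave like volumes. *)
Lemma discrete_bm d (A B C : seq (seq nat)) : uniq A -> uniq B -> uniq C ->
  all (fun s => size s == d) A -> all (fun s => size s == d) B -> all (fun s => size s == d) C ->
  (forall s t e, s \in A -> t \in B -> size e = d -> all (fun z => z <= 1)%N e -> add3 s t e \in C) ->
  4%:R ^+ d * (size A)%:R * (size B)%:R <= (size C)%:R ^+ 2 :> R.
Proof.
elim: d A B C => [|d IH] A B C uA uB uC sA sB sC H.
  have le1 (l : seq (seq nat)) : uniq l -> all (fun s => size s == 0%N) l -> (size l <= 1)%N.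
    move=> ul /allP sl; apply: (@uniq_leq_size _ l [:: [::]]) => // s /sl.
    by rewrite size_eq0 => /eqP ->; rewrite inE.
  rewrite expr0 mul1r -natrM -natrX ler_nat.
  have := le1 A uA sA; have := le1 B uB sB.
  case: A uA sA H => [|s A] uA sA H; first by rewrite mul0n.
  case: B uB sB H => [|t B] uB sB H; first by rewrite muln0.
  move=> l1 l2; have : [::] \in C.
    have := H s t [::]; rewrite !mem_head => /(_ isT isT erefl isT).
    by case: s {H uA sA l2} => // ? ?; case: t {uB sB l1}.
  move=> CC; have C1 : (0 < size C)%N by case: (C) CC.
  by apply: leq_trans (leq_mul l2 l1) _; rewrite muln1 expn_gt0 C1.
pose n := \max_(s <- A ++ B) head 0%N s.
have hA s : s \in A ++ B -> (head 0%N s < n.+1)%N by move=> sin; rewrite ltnS; apply: leq_bigmax_seq.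
have szE l : {subset l <= A ++ B} -> size l = (\sum_(0 <= i < n.+1) size (slice l i))%N.
  move=> lAB; rewrite sum_slice; apply/esym/eqP; rewrite -all_count; apply/allP => s sl.
  by apply: hA; apply: lAB.
have szC : (\sum_(0 <= i < (n + n).+2) size (slice C i) <= size C)%N.
  by rewrite sum_slice count_size.
apply: le_trans (_ : (\sum_(0 <= l < (n + n).+2) (size (slice C l))%:R) ^+ 2 <= _); last first.
  by rewrite -natr_sum -!natrX ler_nat leq_exp2r.
rewrite (szE A) ?(szE B) => [|s sB'|s sA']; [|by rewrite mem_cat sB' orbT|by rewrite mem_cat sA'].
rewrite !natr_sum exprS; apply: discrete_pl => //.
- by rewrite exprn_ge0.
move=> i j _ _.
have st e0 : (e0 <= 1)%N -> 4%:R ^+ d * (size (slice A i))%:R * (size (slice B j))%:R <=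
    (size (slice C (i + j + e0)%N))%:R ^+ 2 :> R.
  move=> e01; apply: IH.
  - exact: (@uniq_slice d A i sA uA).
  - exact: (@uniq_slice d B j sB uB).
  - exact: (@uniq_slice d C _ sC uC).
  - exact: (@size_slice_all d A i sA).
  - exact: (@size_slice_all d B j sB).
  - exact: (@size_slice_all d C _ sC).
  move=> s t e; rewrite !(mem_slice (d := d)) // => sin tin se ae.
  have := H _ _ (e0 :: e) sin tin; rewrite /= se e01 ae; exact.
by split; [have := st 0%N isT; rewrite addn0 | have := st 1%N isT; rewrite addn1].
Qed.

End PrekopaLeindler.

(** * Leading monomials and linear independence *)

Lemma base_inj K d (f g : nat -> nat) : (forall i, (i < d)%N -> (f i < K)%N) -> (forall i, (i < d)%N -> (g i < K)%N) ->
  (\sum_(i < d) f i * K ^ i = \sum_(i < d) g i * K ^ i)%N -> forall i, (i < d)%N -> f i = g i.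
Proof.
elim: d f g => [//|d IH] f g fK gK.
rewrite !big_ord_recl !expn0 !muln1.
have sh (h : nat -> nat) : (\sum_(i < d) h (bump 0 i) * K ^ bump 0 i = K * \sum_(i < d) h i.+1 * K ^ i)%N.
  by rewrite big_distrr /=; apply: eq_bigr => i _; rewrite /bump /= add1n expnS mulnCA.
rewrite (sh f) (sh g) => E.
have K0 : (0 < K)%N by apply: leq_ltn_trans (fK 0%N isT).
have E0 : f 0%N = g 0%N.
  have := congr1 (modn^~ K) E; rewrite ![(_ + K * _)%N]addnC ![(K * _)%N]mulnC !modnMDl.
  by rewrite !modn_small ?fK ?gK.
move=> [|i] // id; apply: (IH (fun i => f i.+1) (fun i => g i.+1)) => //.
- by move=> j jd; apply: fK.
- by move=> j jd; apply: gK.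
- by move/eqP: E; rewrite E0 eqn_add2l eqn_pmul2l // => /eqP.
Qed.

Section Leads.
Variables (R : realFieldType) (d : nat).
Implicit Types (p : {mpoly R[d]}) (z : 'I_d -> R).

(* Kronecker substitution z_i = t^(K^i). *)
Lemma mpoly_nonroot p : p != 0 -> exists z, p.@[z] != 0.
Proof.
move=> p0; pose K := (msize p).+1.
pose e (mu : 'X_{1..d}) := (\sum_(i < d) mu i * K ^ i)%N.
have muK mu i : mu \in msupp p -> (mu i < K)%N.
  move=> /msize_mdeg_lt H; rewrite ltnS; apply: leq_trans (ltnW H).
  by rewrite mdegE (bigD1 i) //= leq_addr.
have einj : {in msupp p &, injective e}.
  move=> mu nu mup nup E; apply/mnmP => i.
  pose fn (w : 'X_{1..d}) (j : nat) := if insub j is Some j' then w j' else 0%N.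
  have fE w (j : 'I_d) : fn w j = w j by rewrite /fn valK.
  have := @base_inj K d (fn mu) (fn nu) _ _ _ i (ltn_ord i); rewrite !fE; apply.
  - by move=> j jd; rewrite -[j]/(val (Ordinal jd)) fE; apply: muK.
  - by move=> j jd; rewrite -[j]/(val (Ordinal jd)) fE; apply: muK.
  - by move: E; rewrite /e => E; under eq_bigr do rewrite fE; under [RHS]eq_bigr do rewrite fE.
pose P : {poly R} := \sum_(mu <- msupp p) p@_mu *: 'X^(e mu).
have P0 : P != 0.
  have lp := mlead_supp p0; apply/eqP => /(congr1 (fun r : {poly R} => r`_(e (mlead p)))).
  rewrite coef0 /P coef_sum (bigD1_seq (mlead p)) ?msupp_uniq //= coefZ coefXn eqxx mulr1.
  rewrite big_seq_cond big1 ?addr0 => [|mu /andP[mup ml]].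
    by move/eqP; rewrite mleadc_eq0 (negbTE p0).
  rewrite coefZ coefXn (_ : (_ == _) = false) ?mulr0 //; apply/negbTE/eqP => E.
  by move/eqP: ml; apply; apply: einj.
have [t Pt] := poly_nonroot P0; exists (fun i => t ^+ (K ^ i)); apply: contraNneq Pt => pz.
apply/eqP; rewrite -pz /P horner_sum mevalE; apply: eq_bigr => mu _.
rewrite hornerZ hornerXn; congr (_ * _); rewrite /e -prodrXr; apply: eq_bigr => i _.
by rewrite -exprM mulnC.
Qed.

(** Gaussian elimination: subtracting multiples of the first polynomial clears its leading monomial
    M from the others, so no leading monomial found later can equal M. *)
Lemma leads_of_free N (p : 'I_N -> {mpoly R[d]}) :
  (forall c : 'I_N -> R, \sum_i c i *: p i = 0 -> forall i, c i = 0) ->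
  exists2 l : seq 'X_{1..d}, uniq l /\ size l = N &
    forall mu, mu \in l -> exists c : 'I_N -> R, \sum_i c i *: p i != 0 /\ mlead (\sum_i c i *: p i) = mu.
Proof.
elim: N p => [|N IH] p fp; first by exists [::].
have p0 : p ord0 != 0.
  apply/eqP => p0; have := fp (fun i => (i == ord0)%:R) _ ord0; rewrite eqxx => H.
  have/eqP : (1 : R) = 0 by apply: H; rewrite big1 // => i _; case: eqP => [->|_]; rewrite ?p0 ?scaler0 ?scale0r.
  by rewrite oner_eq0.
set M := mlead (p ord0); have pM : (p ord0)@_M != 0 by rewrite mleadc_eq0.
pose a i := (p (lift ord0 i))@_M / (p ord0)@_M.
pose p' i := p (lift ord0 i) - a i *: p ord0.
pose ext (c : 'I_N -> R) (i : 'I_N.+1) : R := oapp c (- \sum_j c j * a j) (unlift ord0 i).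
have extE c : \sum_i ext c i *: p i = \sum_i c i *: p' i.
  rewrite big_ord_recl /ext unlift_none /= (eq_bigr (fun i => c i *: p (lift ord0 i))) => [|i _]; last by rewrite liftK.
  rewrite /p' [RHS](eq_bigr (fun i => c i *: p (lift ord0 i) - (c i * a i) *: p ord0)) => [|i _]; last first.
    by rewrite scalerBr scalerA.
  by rewrite sumrB -scaler_suml addrC scaleNr.
have [c E i|l [ul sl] Hl] := IH p'.
  by have := fp (ext c) _ (lift ord0 i); rewrite /ext liftK /=; apply; rewrite extE.
exists (M :: l); first split; rewrite /= ?sl //.
  rewrite ul andbT; apply/negP => /Hl[c [q0 qM]].
  have : (\sum_i c i *: p' i)@_M = 0.
    rewrite raddf_sum /= big1 // => i _; rewrite mcoeffZ /p' mcoeffB mcoeffZ /a divfK // subrr mulr0.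
    by [].
  by move/eqP; rewrite -{1}qM mleadc_eq0 (negbTE q0).
move=> mu; rewrite inE => /orP[/eqP ->|/Hl[c [q0 qM]]]; last by exists (ext c); rewrite extE.
exists (fun i => (i == ord0)%:R).
have -> : \sum_i (i == ord0)%:R *: p i = p ord0; last by [].
rewrite (bigD1 ord0) //= big1 ?addr0 ?eqxx ?scale1r // => i /negbTE ->; by rewrite scale0r.
Qed.

Lemma seq_max (l : seq 'X_{1..d}) : l != [::] -> exists2 M, M \in l & forall y, y \in l -> (y <= M)%O.
Proof.
elim: l => // x l IH _; have [->|l0] := eqVneq l [::].
  by exists x; rewrite ?mem_head // => y; rewrite inE => /eqP ->.
have [M Ml HM] := IH l0; have [xM|/ltW Mx] := leP x M.
  by exists M; [rewrite inE Ml orbT | move=> y; rewrite inE => /orP[/eqP ->|/HM]].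
by exists x; [exact: mem_head | move=> y; rewrite inE => /orP[/eqP ->|/HM /le_trans]; [|apply]].
Qed.

(** In a relation, the largest leading monomial among terms with nonzero coefficient cannot
    cancel. *)
Lemma free_of_leads N (p : 'I_N -> {mpoly R[d]}) : (forall i, p i != 0) -> injective (fun i => mlead (p i)) ->
  forall c : 'I_N -> R, \sum_i c i *: p i = 0 -> forall i, c i = 0.
Proof.
move=> p0 pi c E; apply: contrapT => /existsNP[i0 /eqP ci0].
pose l := [seq mlead (p i) | i <- enum 'I_N & c i != 0].
have [|M /mapP[i iin ME] HM] := @seq_max l.
  have : mlead (p i0) \in l by apply: map_f; rewrite mem_filter ci0 mem_enum.
  by case: l.
have ci : c i != 0 by move: iin; rewrite mem_filter => /andP[].
have := congr1 (fun r : {mpoly R[d]} => r@_M) E; rewrite mcoeff0 raddf_sum /= (bigD1 i) //= big1 ?addr0.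
  by move/eqP; rewrite mcoeffZ mulf_eq0 (negbTE ci) ME mleadc_eq0 (negbTE (p0 i)).
move=> j ji; rewrite mcoeffZ; have [->|cj] := eqVneq (c j) 0; first by rewrite mul0r.
rewrite mcoeff_gt_mlead ?mulr0 // lt_neqAle HM ?andbT.
  by apply: contraNneq ji; rewrite ME => /pi ->.
by apply: map_f; rewrite mem_filter cj mem_enum.
Qed.

Definition polyfun (f : ('I_d -> R) -> R) := exists p, forall z, f z = p.@[z].

Lemma polyfun_cst c : polyfun (fun=> c).
Proof. by exists c%:MP => z; rewrite mevalC. Qed.

Lemma polyfun_X i : polyfun (fun z => z i).
Proof. by exists 'X_i => z; rewrite mevalXU. Qed.

Lemma polyfunD f g : polyfun f -> polyfun g -> polyfun (fun z => f z + g z).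
Proof. by move=> [p Hp] [r Hr]; exists (p + r) => z; rewrite mevalD Hp Hr. Qed.

Lemma polyfunM f g : polyfun f -> polyfun g -> polyfun (fun z => f z * g z).
Proof. by move=> [p Hp] [r Hr]; exists (p * r) => z; rewrite mevalM Hp Hr. Qed.

Lemma polyfun_sum (T : Type) (r : seq T) (F : T -> ('I_d -> R) -> R) :
  (forall t, polyfun (F t)) -> polyfun (fun z => \sum_(t <- r) F t z).
Proof.
move=> H; elim: r => [|t r IH].
  by rewrite (_ : (fun z => _) = (fun=> 0)); [exact: polyfun_cst | apply/funext => z; rewrite big_nil].
rewrite (_ : (fun z => _) = (fun z => F t z + \sum_(t <- r) F t z)); first exact: polyfunD.
by apply/funext => z; rewrite big_cons.
Qed.

Lemma polyfun_prod (T : Type) (r : seq T) (F : T -> ('I_d -> R) -> R) :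
  (forall t, polyfun (F t)) -> polyfun (fun z => \prod_(t <- r) F t z).
Proof.
move=> H; elim: r => [|t r IH].
  by rewrite (_ : (fun z => _) = (fun=> 1)); [exact: polyfun_cst | apply/funext => z; rewrite big_nil].
rewrite (_ : (fun z => _) = (fun z => F t z * \prod_(t <- r) F t z)); first exact: polyfunM.
by apply/funext => z; rewrite big_cons.
Qed.

Lemma polyfun_det k (F : ('I_d -> R) -> 'M[R]_k) : (forall i j, polyfun (fun z => F z i j)) -> polyfun (fun z => \det (F z)).
Proof.
move=> H; rewrite /determinant; apply: polyfun_sum => s; apply: polyfunM; first exact: polyfun_cst.
exact: polyfun_prod.
Qed.

End Leads.

Lemma det_replace_row (R : comNzRingType) k (r : 'I_k) (v : 'I_k -> R) :
  \det (\matrix_(i, j) if i == r then v j else (i == j)%:R) = v r.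
Proof.
rewrite /determinant (bigD1 1%g) //= odd_perm1 expr0 mul1r [X in _ + X]big1 ?addr0 => [|s s1].
  rewrite (bigD1 r) //= mxE eqxx perm1 big1 ?mulr1 // => i ir.
  by rewrite mxE (negbTE ir) perm1 eqxx.
have [i ir si] : exists2 i, i != r & s i != i.
  apply: contrapT => H; case/eqP: s1; apply/permP => i; rewrite perm1.
  have fx j : j != r -> s j = j.
    by move=> jr; apply/eqP; apply: contrapT => /negP sj; apply: H; exists j.
  have [->|/fx //] := eqVneq i r.
  have [//|srr] := eqVneq (s r) r; have := fx _ srr => /perm_inj E; by rewrite E eqxx in srr.
by rewrite (bigD1 i) //= mxE (negbTE ir) eq_sym (negbTE si) mul0r mulr0.
Qed.

(** * Echelon coordinates on a fully cut cell *)

Section Slice.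
Variables (R : realFieldType) (q n : nat).
Notation m := q.+1.
Notation Om := (Omega R q m n).
Notation cuts := (cuts R q m n).
Notation phi := (@phi R q m n).
Notation fullk := (fun _ : 'I_m => q).
Implicit Types (B : cuts) (x y : 'X_{1..m}) (Y : 'M[R]_(q.+1, n.+1)).
Variable b : nat -> nat.
Hypothesis sb : strict q b.
Hypothesis bn : (b q <= n.+1)%N.
Notation br := (fun r : 'I_q.+1 => b r).
Notation Z B := (@cell R q m n br fullk B).

Definition slw B Y : Om := (Y, [ffun i => Y *m B i]).

Lemma cell_full B w : Z B w <-> exists Y, stairs br Y /\ w = slw B Y.
Proof.
have E Y W : cpt fullk B Y W = slw B Y.
  by congr pair; apply/ffunP => i; rewrite !ffunE; apply/matrixP => r j; rewrite mxE ltn_ord.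
by split=> [[Y [W [sY ->]]]|[Y [sY ->]]]; [exists Y | exists Y, 0]; rewrite E.
Qed.

Lemma b_gt (r : 'I_q.+1) : (r < b r)%N.
Proof. by apply: strict_gt sb _; rewrite leq_ord. Qed.

Lemma b_lt (r r' : 'I_q.+1) : (r < r')%N -> (b r < b r')%N.
Proof.
case: sb => _ bi; have := leq_ord r'; move: (r' : nat) => k; elim: k => // k IH kq.
rewrite ltnS leq_eqVlt => /orP[/eqP ->|rk]; first exact: bi.
exact: ltn_trans (IH (ltnW kq) rk) (bi k kq).
Qed.

Lemma b_max (r : 'I_q.+1) : (b r <= n.+1)%N.
Proof.
have [->|rq] := eqVneq r ord_max; first exact: bn.
apply: leq_trans bn; apply: ltnW; apply: (@b_lt r ord_max).
by rewrite ltn_neqAle leq_ord andbT; apply: contraNneq rq => H; apply/eqP/val_inj.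
Qed.

Lemma b_inj (r r' : 'I_q.+1) : b r = b r' -> r = r'.
Proof.
move=> E; apply: val_inj; have [H|H|//] := ltngtP r r'.
- by have := b_lt H; rewrite E ltnn.
- by have := b_lt H; rewrite E ltnn.
Qed.

Definition pcol (r : 'I_q.+1) : 'I_n.+1 := inord (b r).-1.

Lemma pcolE r : (pcol r).+1 = b r.
Proof. by have b0 := leq_ltn_trans (leq0n r) (b_gt r); rewrite inordK prednK // b_max. Qed.

Lemma colcat_mul (T : 'M[R]_q.+1) (y : 'I_q.+1 -> R) (W : 'M[R]_(q.+1, q)) :
  colcat (fun r => \sum_k T r k * y k) (T *m W) = T *m colcat y W.
Proof.
apply/matrixP => r c; rewrite !mxE; case Ec : (unlift ord0 c) => [j|] /=.
  by rewrite mxE; apply: eq_bigr => k _; rewrite mxE Ec.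
by apply: eq_bigr => k _; rewrite mxE Ec.
Qed.

(** Change of basis of L multiplies every coordinate [phi i s] by det T, so its effect on degree x
    is a fixed power of det T. *)
Lemma grade_scale (T : 'M[R]_q.+1) x f Y (W : {ffun 'I_m -> 'M[R]_(q.+1, q)}) : grade phi x f ->
  f (T *m Y, [ffun i => T *m W i]) = \det T ^+ mdeg x * f (Y, W).
Proof.
elim=> {x f} [x||i s x f _ IH|x f h _ IHf _ IHh|x c f _ IH].
- by rewrite mulr0.
- by rewrite mdeg0 expr0 mul1r.
- rewrite IH mdegD mdeg1 exprD expr1.
  have -> : phi i s (T *m Y, [ffun i => T *m W i]) = \det T * phi i s (Y, W).
    rewrite /phi /= ffunE -det_mulmx -colcat_mul; congr (\det (colcat _ _)).
    by apply/funext => r; rewrite mxE.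
  by rewrite mulrACA.
- by rewrite IHf IHh mulrDr.
- by rewrite IH mulrCA.
Qed.

Definition isfree (p : 'I_q.+1 * 'I_n.+1) := (p.2 < b p.1)%N && [forall r' : 'I_q.+1, p.2.+1 != b r'].
Definition fv : finType := {p : 'I_q.+1 * 'I_n.+1 | isfree p}.
Notation d := #|fv|.
Implicit Types (z : 'I_d -> R).

(** Reduced echelon matrices of the Schubert cell: the identity in the pivot columns b_r - 1,
    parameters at the other positions inside the staircase. *)
Definition Ysl z : 'M[R]_(q.+1, n.+1) := \matrix_(r, s)
  if s.+1 == b r then 1 else if (insub (r, s) : option fv) is Some v then z (enum_rank v) else 0.

Lemma stairs_Ysl z : stairs br (Ysl z).
Proof.
move=> r s brs; rewrite mxE (_ : (_ == _) = false); last by apply/negbTE; rewrite neq_ltn orbC ltnS brs.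
by rewrite insubF // /isfree /= ltnNge brs.
Qed.

Lemma Ysl_pivot z r r' : Ysl z r (pcol r') = (r == r')%:R.
Proof.
rewrite mxE pcolE; case: eqVneq => [/b_inj ->|bb]; first by rewrite eqxx.
rewrite insubF; last by rewrite /isfree /=; apply/negbTE; rewrite negb_and; apply/orP; right; apply/forallPn; exists r'; rewrite pcolE eqxx.
have [E|_] := eqVneq r r'; last by [].
by rewrite E eqxx in bb.
Qed.

Lemma Ysl_free z (v : fv) : Ysl z (val v).1 (val v).2 = z (enum_rank v).
Proof.
have /andP[_ /forallP/(_ (val v).1)] := valP v; rewrite mxE => /negbTE ->.
by rewrite -surjective_pairing valK.
Qed.

Definition pivmx (w : Om) : 'M[R]_q.+1 := \matrix_(r, j) w.1 r (pcol j).

Lemma linepoly_pivmx : linepoly (fun w : Om => \det (pivmx w)).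
Proof.
apply: linepoly_det => i j; apply: linepoly_affine => t u v; by rewrite !mxE.
Qed.

(** Row reduction by the pivot block T. The staircase makes T lower triangular, and its diagonal is
    nonzero, so the reduced matrix stays inside the staircase. *)
Lemma normal_form Y : stairs br Y -> \det (\matrix_(r, j) Y r (pcol j)) != 0 ->
  exists z, Y = (\matrix_(r, j) Y r (pcol j)) *m Ysl z.
Proof.
move=> sY; set T := \matrix_(r, j) Y r (pcol j) => dT.
have Tu : T \in unitmx by rewrite unitmxE unitfE.
have Ttrig : is_trig_mx T.
  apply/is_trig_mxP => i j ij; rewrite mxE; apply: sY.
  by have := b_lt ij; have := pcolE j; lia.
have Tii i : T i i != 0 by move: dT; rewrite det_trig // prodf_seq_neq0 => /allP/(_ i); apply; rewrite mem_index_enum.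
pose Y' := invmx T *m Y.
have TY' : T *m Y' = Y by rewrite mulmxA mulmxV // mul1mx.
have piv r r' : Y' r (pcol r') = (r == r')%:R.
  have := congr1 (fun M : 'M[R]_q.+1 => M r r') (mulVmx Tu); rewrite !mxE => <-.
  by apply: eq_bigr => k _; rewrite [T k r']mxE.
have sY' : stairs br Y'.
  move=> r; have [k] := ubnP (val r); elim: k r => // k IH r rk s brs.
  have := congr1 (fun M : 'M[R]_(q.+1, n.+1) => M r s) TY'; rewrite mxE (sY r s brs) (bigD1 r) //= big1 ?addr0.
    by move/eqP; rewrite mulf_eq0 (negbTE (Tii r)) => /eqP.
  move=> j jr; have [jlt|jgt|/val_inj E] := ltngtP j r; last by rewrite E eqxx in jr.
    by rewrite IH ?mulr0 //; [apply: leq_trans jlt _ | apply: leq_trans brs; apply/ltnW/b_lt].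
  by have /is_trig_mxP/(_ r j jgt) -> := Ttrig; rewrite mul0r.
exists (fun k => Y' (val (enum_val k)).1 (val (enum_val k)).2).
rewrite -[LHS]TY'; congr (_ *m _); apply/matrixP => r s; rewrite [RHS]mxE.
case: eqP => [E|nE].
  have -> : s = pcol r by apply: val_inj; have := pcolE r; rewrite -E => -[].
  by rewrite piv eqxx.
case: insubP => [v vf vE|nf]; first by rewrite enum_rankK vE.
move: nf; rewrite /isfree /= negb_and -leqNgt => /orP[|/forallPn[r']]; first exact: sY'.
rewrite negbK => /eqP E; have sE : s = pcol r' by apply: val_inj; have := pcolE r'; rewrite -E => -[].
rewrite sE piv; case: eqP => // rr'; by case: nE; rewrite E rr'.
Qed.

(** The function and the pivot determinant are simultaneously nonzero somewhere on the cell; there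
    [normal_form] applies and [grade_scale] removes T. *)
Lemma slice_nonzero B x f w : grade phi x f -> Z B w -> f w != 0 -> exists z, f (slw B (Ysl z)) != 0.
Proof.
move=> gf Zw fw.
have Z0 : Z B (slw B (Ysl (fun=> 0))) by apply/cell_full; exists (Ysl (fun=> 0)); split => //; apply: stairs_Ysl.
have p0 : \det (pivmx (slw B (Ysl (fun=> 0)))) != 0.
  rewrite (_ : pivmx _ = 1%:M) ?det1 ?oner_neq0 //.
  by apply/matrixP => r j; rewrite !mxE -[RHS](Ysl_pivot (fun=> 0)) [RHS]mxE.
have [w' [/cell_full[Y [sY ->]] H]] :=
  linepoly_mul_neq0 (grade_linepoly (@phi_lp R q m n) gf) linepoly_pivmx (@cell_lineclosed R q m n br fullk B) Zw fw Z0 p0.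
have [fY dY] : f (slw B Y) != 0 /\ \det (pivmx (slw B Y)) != 0.
  by apply/andP; rewrite -negb_or -mulf_eq0.
have [z Yz] := normal_form sY dY; exists z.
move: fY; rewrite /slw {1}Yz.
have -> : [ffun i => Y *m B i] = [ffun i => (\matrix_(r, j) Y r (pcol j)) *m [ffun i => Ysl z *m B i] i] :> {ffun 'I_m -> _}.
  by apply/ffunP => i; rewrite !ffunE mulmxA -Yz.
by rewrite (grade_scale _ _ _ gf) mulf_eq0 negb_or => /andP[].
Qed.

Lemma polyfun_Ysl r s : polyfun (fun z => Ysl z r s).
Proof.
case E : (s.+1 == b r).
  by rewrite (_ : (fun z => _) = (fun=> 1)); [exact: polyfun_cst | apply/funext => z; rewrite mxE E].
case I : (insub (r, s) : option fv) => [v|].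
  by rewrite (_ : (fun z => _) = (fun z => z (enum_rank v))); [exact: polyfun_X | apply/funext => z; rewrite mxE E I].
by rewrite (_ : (fun z => _) = (fun=> 0)); [exact: polyfun_cst | apply/funext => z; rewrite mxE E I].
Qed.

Lemma polyfun_grade B x f : grade phi x f -> polyfun (fun z => f (slw B (Ysl z))).
Proof.
elim=> {x f} [x||i s x f _ IH|x f h _ IHf _ IHh|x c f _ IH].
- exact: polyfun_cst.
- exact: polyfun_cst.
- apply: polyfunM IH; rewrite /phi /=; apply: polyfun_det => r c.
  case E : (unlift ord0 c) => [j|].
    rewrite (_ : (fun z => _) = (fun z => \sum_k Ysl z r k * B i k j)).
      by apply: polyfun_sum => k; apply: polyfunM; [exact: polyfun_Ysl | exact: polyfun_cst].
    by apply/funext => z; rewrite mxE E /= ffunE mxE.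
  rewrite (_ : (fun z => _) = (fun z => Ysl z r s)); first exact: polyfun_Ysl.
  by apply/funext => z; rewrite mxE E.
- exact: polyfunD.
- by apply: polyfunM IH; apply: polyfun_cst.
Qed.

(** The semigroup of an Okounkov body: its elements of degree x are the leading exponents on the
    slice, as many as the dimension in that degree ([leads_ge], [leads_le]). *)
Definition Lead B x (mu : 'X_{1..d}) := exists f p, [/\ grade phi x f,
  forall z, f (slw B (Ysl z)) = p.@[z], p != 0 & mlead p = mu].

Lemma Lead_mul B x y mu nu : Lead B x mu -> Lead B y nu -> Lead B (x + y)%MM (mu + nu)%MM.
Proof.
move=> [f [p [gf fp p0 <-]]] [g [r [gg gr r0 <-]]]; exists (fun u => f u * g u), (p * r); split.
- exact: grade_mul.
- by move=> z; rewrite fp gr mevalM.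
- by rewrite mulf_neq0.
- by rewrite mleadM.
Qed.

Lemma Lead0 B : Lead B 0%MM 0%MM.
Proof.
exists (fun=> 1), 1; split; rewrite ?oner_neq0 ?mlead1 //; first exact: grade1.
by move=> z; rewrite meval1.
Qed.

Lemma Lead_sum B (I : Type) (r : seq I) (x : I -> 'X_{1..m}) (mu : I -> 'X_{1..d}) :
  (forall i, Lead B (x i) (mu i)) ->
  Lead B (\big[mnm_add/0%MM]_(i <- r) x i) (\big[mnm_add/0%MM]_(i <- r) mu i).
Proof.
move=> H; elim: r => [|i r IH]; first by rewrite !big_nil; apply: Lead0.
by rewrite !big_cons; apply: Lead_mul.
Qed.

Lemma leads_ge B x : exists2 l : seq 'X_{1..d}, uniq l /\ size l = ddim phi (Z B) x &
  forall mu, mu \in l -> Lead B x mu.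
Proof.
have [f [gf ff _]] : dge phi (Z B) x (ddim phi (Z B) x) by apply/dgeP.
have /choice[p Hp] : forall i, exists p : {mpoly R[d]}, forall z, f i (slw B (Ysl z)) = p.@[z].
  by move=> i; apply: polyfun_grade (gf i).
have gc (c : 'I__ -> R) : grade phi x (fun u => \sum_i c i * f i u).
  by apply: grade_sum => i _; apply: gradeZ.
have ec (c : 'I__ -> R) z : \sum_i c i * f i (slw B (Ysl z)) = (\sum_i c i *: p i).@[z].
  by rewrite raddf_sum /=; apply: eq_bigr => i _; rewrite mevalZ Hp.
have [|l [ul sl] Hl] := @leads_of_free R d _ p.
  move=> c E; apply: ff => u Zu; apply/eqP; apply: contrapT => /negP cu.
  by have [z] := slice_nonzero (gc c) Zu cu; rewrite ec E meval0 eqxx.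
exists l => // mu /Hl[c [c0 cE]].
by exists (fun u => \sum_i c i * f i u), (\sum_i c i *: p i); split.
Qed.

Lemma leads_le B x (l : seq 'X_{1..d}) : uniq l -> (forall mu, mu \in l -> Lead B x mu) ->
  (size l <= ddim phi (Z B) x)%N.
Proof.
move=> ul H; apply/dgeP.
have /choice[f Hf] : forall i : 'I_(size l), exists f, exists p, [/\ grade phi x f,
    forall z, f (slw B (Ysl z)) = p.@[z], p != 0 & mlead p = nth 0%MM l i].
  by move=> i; apply: H; rewrite mem_nth.
have /choice[p Hp] := Hf.
exists f; split => [i|c Hc|//]; first by case: (Hp i).
apply: (@free_of_leads R d _ p).
- by move=> i; case: (Hp i).
- move=> i j /=; case: (Hp i) => _ _ _ ->; case: (Hp j) => _ _ _ -> /eqP.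
  by rewrite nth_uniq // => /eqP/val_inj.
apply/eqP; apply: contrapT => /negP/mpoly_nonroot[z]; apply/negP; rewrite negbK.
rewrite raddf_sum /= -[X in _ == X](Hc (slw B (Ysl z))).
  by apply/eqP; apply: eq_bigr => i _; rewrite mevalZ; case: (Hp i) => _ ->.
by apply/cell_full; exists (Ysl z); split => //; apply: stairs_Ysl.
Qed.

Definition cutminor B := exists Y, stairs br Y /\ minor pcol (slw B Y) != 0.

Lemma cutminor_generic : generic cutminor.
Proof.
apply: (@generic_linepoly R q m n _ (stairs br) (fun Y B => minor pcol (slw B Y))).
  move=> Y B v.
  have [w Hw] := cpt_line fullk B (B + v) Y 0.
  have [p Hp] := grade_linepoly (@phi_lp R q m n) (grade_minor R pcol) (cpt fullk B Y 0) w.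
  exists p => t; rewrite -Hp -Hw; congr minor.
  have -> : B + v - B = v by rewrite addrC addKr.
  by congr pair; apply/ffunP => i; rewrite !ffunE; apply/matrixP => r j; rewrite [RHS]mxE ltn_ord.
pose Y0 := Ysl (fun=> 0).
(* Since Y0 times its transpose is the identity, Y0 times [B0 i] is [stdW], whose cofactor vectors
   are signed unit vectors. *)
pose B0 : cuts := [ffun i => Y0^T *m stdW R q i].
have Y1 : Y0 *m Y0^T = 1%:M.
  apply/matrixP => r r'; rewrite !mxE (bigD1 (pcol r')) //= !mxE pcolE eqxx mulr1 big1 ?addr0.
    by rewrite -[RHS](Ysl_pivot (fun=> 0) r r') [RHS]mxE pcolE.
  move=> s sr; rewrite [X in _ * X]mxE [X in _ * X]mxE (_ : (s.+1 == b r') = false).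
    by case: insub => [v|]; rewrite mulr0.
  by apply: contraNF sr => /eqP E; apply/eqP/val_inj; have := pcolE r'; rewrite -E => -[].
exists B0, Y0; split; first exact: stairs_Ysl.
rewrite minorE mulf_neq0 //=.
  rewrite (_ : matrix_of_fun _ _ = diag_mx (\row_i (-1) ^+ i)).
    by rewrite det_diag prodf_seq_neq0; apply/allP => i _ /=; rewrite mxE signr_eq0.
  have B0E i : B0 i = Y0^T *m stdW R q i by rewrite ffunE.
  by apply/matrixP => i r; rewrite !mxE ffunE B0E mulmxA Y1 mul1mx cofvec_std mulr_natr eq_sym.
rewrite (_ : matrix_of_fun _ _ = 1%:M) ?det1 ?oner_neq0 //.
by apply/matrixP => r j; rewrite mxE Ysl_pivot mxE.
Qed.

(** The cofactor factor in [minorE] is the same for all column choices. On the slice the pivot minor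
    of Y is 1, and exchanging one pivot column for that of the k-th free entry gives z_k; so p and p
    z_k both occur. *)
Lemma cube_leads B : cutminor B -> exists delta : 'X_{1..d}, Lead B (mone m) delta /\
  forall k, Lead B (mone m) (delta + U_(k))%MM.
Proof.
move=> [Y [sY mY]].
have Zw : Z B (slw B Y) by apply/cell_full; exists Y.
have [z0 Hz0] := slice_nonzero (grade_minor R pcol) Zw mY.
have [p Hp] := polyfun_grade B (grade_minor R pcol).
have p0 : p != 0 by apply: contraNneq Hz0 => p0; rewrite Hp p0 meval0.
exists (mlead p); split; first by exists (minor pcol), p; split => //; apply: grade_minor.
move=> k; pose v : fv := enum_val k.
have X0 : 'X_k != 0 :> {mpoly R[d]}.
  by apply/eqP => /(congr1 (mcoeff U_(k)%MM)); rewrite mcoeffX eqxx mcoeff0 => /eqP; rewrite oner_eq0.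
pose c (j : 'I_q.+1) := if j == (val v).1 then (val v).2 else pcol j.
exists (minor c), (p * 'X_k); split.
- exact: grade_minor.
- move=> z.
  have dp : \det (\matrix_(r, j) Ysl z r (pcol j)) = 1.
    rewrite (_ : matrix_of_fun _ _ = 1%:M) ?det1 //.
    by apply/matrixP => r j; rewrite mxE Ysl_pivot mxE.
  have dc : \det (\matrix_(r, j) Ysl z r (c j)) = z k.
    rewrite -det_tr (_ : _^T = \matrix_(i, j) if i == (val v).1 then Ysl z j (val v).2 else (i == j)%:R).
      by rewrite det_replace_row Ysl_free enum_valK.
    apply/matrixP => i j; rewrite [LHS]mxE [LHS]mxE [RHS]mxE /c.
    by case: ifP => // _; rewrite Ysl_pivot eq_sym.
  by rewrite mevalM mevalXU -Hp !minorE /= dp dc mulr1.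
- by rewrite mulf_neq0.
- by rewrite mleadM // mleadXm.
Qed.


(** Row r has b_r positions inside the staircase, of which at most r + 1 are pivot columns. *)
Lemma card_fv : (\sum_(0 <= r < q.+1) (b r - r.+1) <= d)%N.
Proof.
have -> : d = (\sum_(r < q.+1) \sum_(s < n.+1) isfree (r, s))%N.
  rewrite card_sig -sum1_card big_mkcond /= pair_big /=; apply: eq_bigr => -[r s] _.
  by rewrite inE; case: (isfree _).
rewrite big_mkord; apply: leq_sum => r _; rewrite leq_subLR.
have e1 : (\sum_(s < n.+1) (s < b r)%N = b r)%N.
  have -> : (\sum_(s < n.+1) (s < b r)%N = \sum_(0 <= s < n.+1) (s < b r)%N)%N by rewrite big_mkord.
  rewrite (big_cat_nat (n := b r)) ?b_max //= [X in (_ + X)%N]big_nat_cond [X in (_ + X)%N]big1 ?addn0.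
    rewrite (@eq_big_nat _ _ _ _ _ _ (fun=> 1%N)) => [|s /andP[_ ->] //].
    by rewrite sum_nat_const_nat subn0 muln1.
  by move=> s /andP[/andP[bs _] _]; rewrite ltnNge bs.
have e2 : (\sum_(s < n.+1) \sum_(r' < q.+1 | (r' <= r)%N) (s.+1 == b r')%N <= r.+1)%N.
  rewrite exchange_big /=; apply: leq_trans (_ : \sum_(r' < q.+1 | (r' <= r)%N) 1 <= _)%N.
    apply: leq_sum => r' _; rewrite (bigD1 (pcol r')) //= pcolE eqxx big1 // => s sr.
    apply/eqP; rewrite eqb0; apply: contraNneq sr => E; apply/eqP/val_inj.
    by have := pcolE r'; rewrite -E => -[].
  rewrite sum1_card -[r.+1]card_ord.
  pose h (i : 'I_r.+1) : 'I_q.+1 := widen_ord (ltn_ord r) i.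
  apply: leq_trans (_ : #|[set h i | i in 'I_r.+1]| <= _)%N; last exact: leq_imset_card.
  apply: subset_leq_card; apply/subsetP => r' H; have r'r : (r' <= r)%N by exact: H.
  by apply/imsetP; exists (Ordinal (r'r : (r' < r.+1)%N)) => //; apply: val_inj.
rewrite -{1}e1 addnC; apply: leq_trans (leq_add (leqnn _) e2).
rewrite -big_split /=; apply: leq_sum => s _.
case: ltnP => //= sbr; rewrite /isfree /= sbr /=; case: forallP => //= H.
have [r' E] : exists r' : 'I_q.+1, s.+1 = b r'.
  by apply: contrapT => nE; apply: H => r'; apply/eqP => E; apply: nE; exists r'.
rewrite (bigD1 r') /=; first by rewrite E eqxx.
rewrite leqNgt; apply/negP => rr'; have := b_lt rr'; rewrite -E ltnS leqNgt sbr //.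
Qed.

End Slice.

(** * Brunn-Minkowski for the dimension function *)

Section BrunnMinkowski.
Variables (R : rcfType) (q n : nat).
Notation m := q.+1.
Notation fullk := (fun _ : 'I_m => q).
Implicit Types (x y : 'X_{1..m}).
Variable b : nat -> nat.
Hypothesis sb : strict q b.
Hypothesis bn : (b q <= n.+1)%N.
Notation br := (fun r : 'I_q.+1 => b r).
Notation d := #|fv q n b|.
Notation G x := (gdim R n br fullk x).

Definition tos k (mu : 'X_{1..k}) : seq nat := [seq mu i | i <- enum 'I_k].

Lemma tos_inj k : injective (@tos k).
Proof.
move=> mu nu E; apply/mnmP => i; have /eq_in_map H := E.
by apply: H; rewrite mem_enum.
Qed.

Lemma size_tos k (mu : 'X_{1..k}) : size (tos mu) = k.
Proof. by rewrite size_map size_enum_ord. Qed.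

Lemma add3_map (T : Type) (f g h : T -> nat) (r : seq T) :
  add3 (map f r) (map g r) (map h r) = [seq (f t + g t + h t)%N | t <- r].
Proof. by elim: r => //= t r ->. Qed.

(** Exponents of degrees x and y and of a cube in degree d (1,...,1) add up to exponents of the
    total degree. The cube is obtained by multiplying, over all k, a function of exponent delta or
    delta + e_k; then [discrete_bm] applies. *)
Lemma gdim_brunn_minkowski x y :
  4%:R ^+ d * (G x)%:R * (G y)%:R <= (G (mone m *+ d + (x + y))%MM)%:R ^+ 2 :> R.
Proof.
pose w := (mone m *+ d + (x + y))%MM.
have [[B [HB [<- <-]]] _] := generic_and (@cutminor_generic R q n b sb bn)
   (generic_and (@gdim_generic R q m n br fullk x) (@gdim_generic R q m n br fullk y)).
apply: le_trans (_ : (ddim (@phi R q m n) (cell br fullk B) w)%:R ^+ 2 <= _); last first.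
  by rewrite -!natrX ler_nat leq_exp2r // gdim_ge.
have [delta [L0 L1]] := cube_leads sb bn HB.
have [lx [ulx <-] Hx] := leads_ge sb bn B x; have [ly [uly <-] Hy] := leads_ge sb bn B y.
pose D := (delta *+ d)%MM.
pose em (e : {ffun 'I_d -> bool}) : 'X_{1..d} := [multinom nat_of_bool (e i) | i < d].
pose lz := undup [seq (mu.1 + mu.2 + D + em e)%MM | mu <- [seq (mu, nu) | mu <- lx, nu <- ly], e <- enum {ffun 'I_d -> bool}].
have Lcube (e : {ffun 'I_d -> bool}) : Lead B (mone m *+ d)%MM (D + em e)%MM.
  have H k : Lead B (mone m) (if e k then delta + U_(k) else delta)%MM by case: (e k).
  have := Lead_sum (index_enum 'I_d) H.
  have -> : \big[mnm_add/0%MM]_(k : 'I_d) mone m = (mone m *+ d)%MM.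
    by apply/mnmP => i; rewrite mnm_sumE mulmnE sum_nat_const card_ord mulnC.
  have -> : \big[mnm_add/0%MM]_(k : 'I_d) (if e k then delta + U_(k) else delta)%MM = (D + em e)%MM.
    apply/mnmP => i; rewrite mnm_sumE mnmDE mulmnE mnmE.
    rewrite (eq_bigr (fun k => delta i + (if e k then (k == i : nat) else 0))%N) => [|k _]; last first.
      by case: (e k); rewrite ?addn0 // mnmDE mnm1E.
    rewrite big_split /= sum_nat_const card_ord mulnC; congr addn.
    rewrite (bigD1 i) //= eqxx big1 ?addn0; first by case: (e i).
    by move=> k /negbTE ->; case: (e k).
  exact.
have Lz mu : mu \in lz -> Lead B w mu.
  rewrite mem_undup => /allpairsP[[[mu1 mu2] e] /= [/allpairsP[[m1 m2] /= [m1x m2y [-> ->]]] _ ->]].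
  have := Lead_mul (Lcube e) (Lead_mul (Hx _ m1x) (Hy _ m2y)).
  by rewrite -/w (_ : (D + em e + (m1 + m2) = m1 + m2 + D + em e)%MM) //; apply/mnmP => i; rewrite !mnmDE; lia.
apply: le_trans (_ : (size lz)%:R ^+ 2 <= _); last first.
  by rewrite -!natrX ler_nat leq_exp2r // leads_le // undup_uniq.
have sz (l : seq 'X_{1..d}) : size (map (@tos d) l) = size l by rewrite size_map.
rewrite -(size_map (fun mu => tos (mu + D)%MM) lx) -(sz ly) -(sz lz).
have al (T : Type) (g : T -> 'X_{1..d}) (l : seq T) : all (fun s => size s == d) (map (fun t => tos (g t)) l).
  by elim: l => //= t l ->; rewrite size_tos eqxx.
apply: discrete_bm.
- rewrite map_inj_uniq // => mu nu /tos_inj E; apply/mnmP => i.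
  by move/mnmP/(_ i): E; rewrite !mnmDE => /addIn.
- by rewrite map_inj_uniq //; apply: tos_inj.
- by rewrite map_inj_uniq ?undup_uniq //; apply: tos_inj.
- exact: al.
- exact: (al _ id).
- exact: (al _ id).
move=> s t e /mapP[mu mux ->] /mapP[nu nuy ->] se ae.
pose e' : {ffun 'I_d -> bool} := [ffun i : 'I_d => nth 0%N e i == 1%N].
have eE : e = tos (em e').
  rewrite -[LHS](mkseq_nth 0%N) se /mkseq -val_enum_ord -map_comp; apply: eq_map => i /=.
  rewrite mnmE ffunE; have : (nth 0%N e i <= 1)%N by apply: (allP ae); rewrite mem_nth // se.
  by case: (nth _ _ _) => [|[|]].
rewrite eE add3_map.
have -> : [seq ((mu + D)%MM i + nu i + em e' i)%N | i <- enum 'I_d] = tos (mu + nu + D + em e')%MM.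
  by apply: eq_map => i; rewrite !mnmDE; lia.
apply: map_f; rewrite mem_undup; apply/allpairsP; exists ((mu, nu), e') => /=; split => //; last by rewrite mem_enum.
by apply/allpairsP; exists (mu, nu).
Qed.

End BrunnMinkowski.

(** * Semistandard tableaux as chains of interlacing partitions *)

Section Chains.
Variables (m K : nat) (R : comNzRingType).
Notation V := {ffun 'I_m -> 'I_K.+1}.
Implicit Types (lam nu : V) (u : nat -> nat -> R).
Let v0 : V := mkV m K (fun=> 0%N).

Fixpoint chains l lam : seq (seq V) :=
  if l is l'.+1 then flatten [seq [seq rcons c lam | c <- chains l' nu] | nu <- enum V & inter lam nu]
  else if lam == v0 then [:: [:: lam]] else [::].

Lemma chainsP l lam c : reflect [/\ size c = l.+1, nth v0 c 0 = v0, nth v0 c l = lam &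
  forall i, (i < l)%N -> inter (nth v0 c i.+1) (nth v0 c i)] (c \in chains l lam).
Proof.
elim: l lam c => [|l IH] lam c /=.
  apply: (iffP idP) => [|[sc c0 cl _]].
    by case: eqP => // -> ; rewrite inE => /eqP ->.
  by case: c sc c0 cl => [|x [|]] //= _ -> <-; rewrite eqxx inE.
apply: (iffP flattenP) => [[s /mapP[nu]]|[sc c0 cl ci]].
  rewrite mem_filter => /andP[I _] -> /mapP[c' /IH[sc c0 cl ci] ->].
  split; rewrite ?size_rcons ?sc ?nth_rcons ?sc ?ltnn ?eqxx //.
  move=> i; rewrite ltnS leq_eqVlt => /orP[/eqP ->|il].
    by rewrite !nth_rcons sc ltnn eqxx ltnSn cl.
  by rewrite !nth_rcons sc !ltnS il (ltnW il); apply: ci.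
case/lastP: c sc c0 cl ci => // c x; rewrite size_rcons => -[sc] c0 cl ci.
have xE : x = lam by move: cl; rewrite nth_rcons sc ltnn eqxx.
exists [seq rcons c' lam | c' <- chains l (nth v0 c l)].
  apply/mapP; exists (nth v0 c l) => //; rewrite mem_filter mem_enum andbT.
  by have := ci l (ltnSn l); rewrite !nth_rcons sc ltnn eqxx ltnSn xE.
apply/mapP; exists c; last by rewrite xE.
apply/IH; split => //; first by move: c0; rewrite nth_rcons sc.
by move=> i il; have := ci i (leqW il); rewrite !nth_rcons sc !ltnS il (ltnW il).
Qed.

Lemma uniq_chains l lam : uniq (chains l lam).
Proof.
elim: l lam => [|l IH] lam /=; first by case: ifP.
apply: uniq_flatten_map.
- by rewrite filter_uniq ?enum_uniq.
- by move=> nu _; rewrite map_inj_uniq // => c c' /rcons_inj[].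
move=> nu nu' c _ _ /mapP[c1 /chainsP[_ _ e1 _] ->] /mapP[c2 /chainsP[_ _ e2 _] /rcons_inj[E]].
by rewrite -e1 -e2 E.
Qed.

Lemma gt_chains u l lam :
  gt u l lam = \sum_(c <- chains l lam) \prod_(i < l) u i (vsize (nth v0 c i.+1) - vsize (nth v0 c i))%N.
Proof.
elim: l lam => [|l IH] lam /=.
  by case: eqP => _; rewrite ?big_nil // big_seq1 big_ord0.
rewrite big_flatten big_map big_filter big_enum_cond /=; apply: eq_bigr => nu I.
rewrite IH big_map big_distrr /= big_seq [RHS]big_seq; apply: eq_bigr => c /chainsP[sc _ cl _].
rewrite big_ord_recr /= mulrC !nth_rcons sc ltnn eqxx ltnSn cl; congr (_ * _).
by apply: eq_bigr => i _; rewrite !nth_rcons sc !ltnS ltn_ord (ltnW (ltn_ord i)).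
Qed.

End Chains.

Section Tableaux.
Variables (lam : seq nat) (m : nat).
Hypothesis plam : is_partition lam.
Hypothesis lamm : nth 0%N lam m = 0%N.
Notation K := (sumn lam).
Notation V := {ffun 'I_m -> 'I_K.+1}.
Notation fil := (filling lam m).
Implicit Types (T : fil) (x y : box lam).
Let v0 : V := mkV m K (fun=> 0%N).
Notation lamn i := (nth 0%N lam i).

Lemma lamn_dec i j : (i <= j)%N -> (lamn j <= lamn i)%N.
Proof.
move=> ij; have [js|sj] := ltnP j (size lam); last by rewrite nth_default.
have tr : transitive geq by move=> a b' c H1 H2; apply: leq_trans H2 H1.
have := sorted_leq_nth tr (fun a => leqnn a) 0%N plam; apply => //; rewrite inE //.
exact: leq_ltn_trans js.
Qed.

Lemma lamn_le i : (lamn i <= K)%N.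
Proof.
have [isz|si] := ltnP i (size lam); last by rewrite nth_default.
rewrite sumnE (big_nth 0%N) big_mkord (bigD1 (Ordinal isz)) //=; exact: leq_addr.
Qed.

Lemma box_lt x : (bcol x < lamn (brow x))%N.
Proof. by case: x => i j; apply: (ltn_ord j). Qed.

Lemma box_row x : (brow x < m)%N.
Proof.
rewrite ltnNge; apply/negP => mx; have := box_lt x.
by have := lamn_dec mx; rewrite lamm leqn0 => /eqP ->.
Qed.

Lemma mkbox i j : (j < lamn i)%N -> {x : box lam | brow x = i /\ bcol x = j}.
Proof.
move=> jl; have il : (i < size lam)%N.
  by rewrite ltnNge; apply/negP => H; rewrite nth_default in jl.
by exists (@Tagged _ (Ordinal il) (fun i : 'I_(size lam) => 'I_(lamn i)) (Ordinal (jl : (j < lamn (Ordinal il))%N))).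
Qed.

Lemma box_inj x y : brow x = brow y -> bcol x = bcol y -> x = y.
Proof.
case: x => i j; case: y => i' j'; rewrite /brow /bcol /= => /val_inj E; move: j'; rewrite -E => j' /val_inj ->.
by [].
Qed.

Definition cnt T l i := #|[pred x : box lam | (brow x == i) && (T x < l)%N]|.

Lemma cnt_bound T l i : (cnt T l i <= lamn i)%N.
Proof.
rewrite -[X in (_ <= X)%N](size_iota 0) /cnt cardE -(size_map (@bcol lam)).
apply: uniq_leq_size.
  rewrite map_inj_in_uniq ?enum_uniq // => x y; rewrite !mem_enum !inE => /andP[/eqP ex _] /andP[/eqP ey _].
  by apply: box_inj; rewrite ex ey.
move=> j /mapP[x]; rewrite mem_enum inE => /andP[/eqP <- _] ->; by rewrite mem_iota add0n box_lt.
Qed.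

Lemma ss_row T x y : semistandard T -> brow x = brow y -> (bcol x <= bcol y)%N -> (T x <= T y)%N.
Proof. by move=> /forallP/(_ x)/forallP/(_ y)/andP[/implyP H _] E L; apply: H; rewrite E eqxx. Qed.

Lemma ss_col T x y : semistandard T -> bcol x = bcol y -> (brow x < brow y)%N -> (T x < T y)%N.
Proof. by move=> /forallP/(_ x)/forallP/(_ y)/andP[_ /implyP H] E L; apply: H; rewrite E eqxx. Qed.

(** In each row the entries below l form an initial segment of length [cnt]. This lets a tableau be
    recovered from its chain of shapes. *)
Lemma cntP T l x : semistandard T -> (T x < l)%N = (bcol x < cnt T l (brow x))%N.
Proof.
move=> ss; pose s := [seq bcol y | y <- enum [pred y : box lam | (brow y == brow x) && (T y < l)%N]].
have us : uniq s.
  rewrite map_inj_in_uniq ?enum_uniq // => y y'; rewrite !mem_enum !inE => /andP[/eqP ex _] /andP[/eqP ey _].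
  by apply: box_inj; rewrite ex ey.
have ss' : size s = cnt T l (brow x) by rewrite size_map -cardE.
rewrite -ss'; apply/idP/idP => [Tx|].
  rewrite -[X in (X <= _)%N](size_iota 0); apply: uniq_leq_size; first exact: iota_uniq.
  move=> j; rewrite mem_iota add0n ltnS => /andP[_ jx].
  have [y [yr yc]] := mkbox (leq_ltn_trans jx (box_lt x)).
  apply/mapP; exists y => //; rewrite mem_enum inE yr eqxx /=.
  by apply: leq_ltn_trans Tx; apply: ss_row => //; rewrite yc.
rewrite ltnNge => /negP H; rewrite ltnNge; apply/negP => lT; apply: H.
rewrite -[X in (_ <= X)%N](size_iota 0); apply: uniq_leq_size us _ => j /mapP[y].
rewrite mem_enum inE => /andP[/eqP yr Ty] ->; rewrite mem_iota add0n /= ltnNge; apply/negP => xy.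
have := @ss_row T x y ss (esym yr) xy; rewrite leqNgt (leq_trans Ty lT) //.
Qed.

Definition shp T l : V := mkV m K (cnt T l).
Definition chain T : seq V := mkseq (shp T) m.+1.
Definition lamV : V := mkV m K (fun i => lamn i).

Lemma ent_shp T l i : ent (shp T l) i = cnt T l i.
Proof.
have [im|mi] := ltnP i m; first by rewrite ent_mkV // (leq_trans (cnt_bound _ _ _)) ?lamn_le.
rewrite ent_out //; apply/esym/eqP; rewrite -leqn0; apply: leq_trans (cnt_bound _ _ _) _.
by have := lamn_dec mi; rewrite lamm.
Qed.

Lemma ent_lamV i : ent lamV i = lamn i.
Proof.
have [im|mi] := ltnP i m; first by rewrite ent_mkV // lamn_le.
by rewrite ent_out //; apply/esym/eqP; rewrite -leqn0 -[X in (_ <= X)%N]lamm lamn_dec.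
Qed.

Lemma cnt_full T l i : (m <= l)%N -> cnt T l i = lamn i.
Proof.
move=> ml; apply/eqP; rewrite eqn_leq cnt_bound -[X in (X <= _)%N](size_iota 0) /cnt cardE -(size_map (@bcol lam)).
apply: uniq_leq_size (iota_uniq _ _) _ => j; rewrite mem_iota add0n => /andP[_ jl].
have [x [xr xc]] := mkbox jl; apply/mapP; exists x => //.
by rewrite mem_enum inE xr eqxx /= (leq_trans (ltn_ord _) ml).
Qed.

Lemma chain_in T : semistandard T -> chain T \in chains m lamV.
Proof.
move=> ss; apply/chainsP; split.
- by rewrite size_mkseq.
- rewrite nth_mkseq //; apply: ent_inj => i im; rewrite ent_shp ent_mkV // /cnt.
  by apply: eq_card0 => x; rewrite !inE ltn0 andbF.
- by rewrite nth_mkseq //; apply: ent_inj => i im; rewrite ent_shp ent_lamV cnt_full.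
move=> l lm; rewrite !nth_mkseq ?ltnS ?(ltnW lm) //; apply/interP => i; rewrite !ent_shp; split; last first.
  by apply: subset_leq_card; apply/subsetP => x; rewrite !inE => /andP[-> H]; apply: ltnW.
rewrite leqNgt; apply/negP => H.
have jl : (cnt T l i < lamn i.+1)%N by apply: leq_trans H (cnt_bound _ _ _).
have [y [yr yc]] := mkbox jl; have [x [xr xc]] := mkbox (leq_trans jl (lamn_dec (leqnSn i))).
have Ty : (T y < l.+1)%N by rewrite cntP // yr yc.
have Tx : (T x < T y)%N by apply: ss_col => //; rewrite ?xc ?yc ?xr ?yr.
by have : (T x < l)%N by [apply: leq_trans Tx _]; rewrite cntP // xr xc ltnn.
Qed.

Lemma nth_chain T l : (l <= m)%N -> nth v0 (chain T) l = shp T l.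
Proof. by move=> lm; rewrite nth_mkseq. Qed.

Lemma chain_inj T T' : semistandard T -> semistandard T' -> chain T = chain T' -> T = T'.
Proof.
move=> ss ss' E; apply/ffunP => x; apply: val_inj.
have H l : (l <= m)%N -> (T x < l)%N = (T' x < l)%N.
  move=> lm; rewrite !cntP // -!ent_shp; by rewrite -!nth_chain // E.
apply/eqP; rewrite eqn_leq -[(T x <= T' x)%N]ltnS -[(T' x <= T x)%N]ltnS; apply/andP; split; first by rewrite H // ltn_ord.
by rewrite -H // ltn_ord.
Qed.

(** The entry of a box is the step of the chain at which the box appears. Interlacing prevents two
    boxes of one column from appearing at the same step. *)
Lemma chain_surj c : c \in chains m lamV -> exists2 T, semistandard T & chain T = c.
Proof.
move=> /chainsP[sc c0 cm ci]; pose g l i := ent (nth v0 c l) i.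
have gm l l' i : (l <= l')%N -> (l' <= m)%N -> (g l i <= g l' i)%N.
  elim: l' => [|l' IH]; first by rewrite leqn0 => /eqP ->.
  rewrite leq_eqVlt => /orP[/eqP -> //|ll] lm; apply: leq_trans (IH ll (ltnW lm)) _.
  by have /interP/(_ i)[] := ci l' lm.
have gd l i j : (l <= m)%N -> (i <= j)%N -> (g l j <= g l i)%N.
  move=> lm; have st k : (g l k.+1 <= g l k)%N.
    case: l lm => [|l] lm; first by rewrite /g c0 /ent; case: insub => [k'|] //; rewrite ffunE inordK.
    by have /interP/(_ k)[H1 H2] := ci l lm; apply: leq_trans H2.
  elim: j => [|j IH]; first by rewrite leqn0 => /eqP ->.
  by rewrite leq_eqVlt => /orP[/eqP -> //|/IH]; apply: leq_trans.
have glam i : g m i = lamn i by rewrite /g cm ent_lamV.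
have g0 i : g 0%N i = 0%N by rewrite /g c0; have [im|mi] := ltnP i m; [rewrite ent_mkV | rewrite ent_out].
have exT x : exists t : 'I_m, (g t (brow x) <= bcol x < g t.+1 (brow x))%N.
  have exl : exists l, (bcol x < g l (brow x))%N && (l <= m)%N by exists m; rewrite glam box_lt leqnn.
  case: (ex_minnP exl) => -[|l] /andP[H lm] Hmin; first by rewrite g0 in H.
  exists (Ordinal lm); rewrite /= H andbT leqNgt; apply/negP => H'.
  by have := Hmin l; rewrite H' (ltnW lm) => /(_ isT); rewrite ltnn.
have /choice[t Ht] := exT; pose T : fil := [ffun x => t x].
have key x l : (l <= m)%N -> (T x < l)%N = (bcol x < g l (brow x))%N.
  move=> lm; rewrite ffunE; have /andP[H1 H2] := Ht x; apply/idP/idP => H.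
    by apply: leq_trans H2 (gm _ _ _ H lm).
  rewrite ltnNge; apply/negP => lt; have := gm l (t x) (brow x) lt (ltnW (ltn_ord _)).
  by move=> H3; move: H; rewrite ltnNge (leq_trans H3 H1).
have ssT : semistandard T.
  apply/forallP => x; apply/forallP => y; apply/andP; split; apply/implyP => /andP[/eqP E L].
    rewrite -ltnS key ?ltn_ord // E; apply: leq_ltn_trans L _.
    by rewrite -key ?ltn_ord.
  rewrite key ?(ltnW (ltn_ord _)) // E.
  have H : (bcol y < g (T y).+1 (brow y))%N by rewrite -key ?ltn_ord.
  apply: leq_trans H _; apply: leq_trans (gd _ (brow x).+1 _ _ L) _; first exact: ltn_ord.
  by have /interP/(_ (brow x))[] := ci (T y) (ltn_ord _).
exists T => //; apply: (@eq_from_nth _ v0); first by rewrite size_mkseq sc.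
move=> l; rewrite size_mkseq ltnS => lm; rewrite nth_chain //; apply: ent_inj => i _; rewrite ent_shp.
rewrite -[RHS]/(g l i).
have gl : (g l i <= lamn i)%N by rewrite -glam; apply: gm.
rewrite /cnt cardE -(size_map (@bcol lam)) -[RHS](size_iota 0); apply/eqP.
rewrite -uniq_size_uniq ?iota_uniq //.
- rewrite map_inj_in_uniq ?enum_uniq // => x y; rewrite !mem_enum !inE => /andP[/eqP ex _] /andP[/eqP ey _].
  by apply: box_inj; rewrite ex ey.
- move=> j; rewrite mem_iota add0n /=; apply/idP/mapP => [jg|[x]]; last first.
    by rewrite mem_enum inE => /andP[/eqP <- Tx] ->; rewrite -key.
  have [x [xr xc]] := mkbox (leq_trans jg gl); exists x => //.
  by rewrite mem_enum inE xr eqxx key // xr xc.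
Qed.

Lemma vsize_shp T l : vsize (shp T l) = #|[pred x : box lam | (T x < l)%N]|.
Proof.
rewrite /vsize big_mkord (eq_bigr (fun i : 'I_m => cnt T l i)) => [|i _]; last by rewrite ent_shp.
rewrite -sum1_card (partition_big (fun x => Ordinal (box_row x)) xpredT) //=.
apply: eq_bigr => i _; rewrite /cnt -sum1_card; apply: eq_bigl => x.
by rewrite !inE andbC -val_eqE.
Qed.

Lemma weight_shp T (i : 'I_m) : weight T i = (vsize (shp T i.+1) - vsize (shp T i))%N.
Proof.
rewrite mnmE !vsize_shp; apply/eqP; rewrite -(eqn_add2r #|[pred x : box lam | (T x < i)%N]|) subnK; last first.
  by apply: subset_leq_card; apply/subsetP => x; rewrite !inE => /ltnW.
rewrite -[X in _ == X](cardID [pred x : box lam | (T x < i)%N]) addnC; apply/eqP; congr addn.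
  by apply: eq_card => x; rewrite !inE; case: (ltnP (T x) i) => // H; rewrite ?andbF ?andbT ?ltnS ?(ltnW H).
by apply: eq_card => x; rewrite !inE ltnS -leqNgt -val_eqE eqn_leq andbC.
Qed.

Lemma sum_tableaux (R : comNzRingType) (u : nat -> nat -> R) :
  \sum_(T : fil | semistandard T) \prod_(i < m) u i (weight T i) = gt u m lamV.
Proof.
rewrite gt_chains.
have -> : \sum_(T : fil | semistandard T) \prod_(i < m) u i (weight T i) =
    \sum_(T <- enum [pred T : fil | semistandard T]) \prod_(i < m) u i (weight T i).
  by rewrite big_enum; apply: eq_bigl => T; rewrite inE.
have -> : \sum_(T <- enum [pred T : fil | semistandard T]) \prod_(i < m) u i (weight T i) =
   \sum_(c <- [seq chain T | T <- enum [pred T : fil | semistandard T]])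
      \prod_(i < m) u i (vsize (nth v0 c i.+1) - vsize (nth v0 c i))%N.
  rewrite big_map; apply: eq_bigr => T _; apply: eq_bigr => i _.
  by rewrite weight_shp !nth_chain // ltnW.
apply: perm_big; apply: uniq_perm; last first.
- move=> c; apply/mapP/idP => [[T]|/chain_surj[T ssT <-]]; first by rewrite mem_enum inE => ssT ->; apply: chain_in.
  by exists T; rewrite // mem_enum.
- exact: uniq_chains.
rewrite map_inj_in_uniq ?enum_uniq // => T T'; rewrite !mem_enum !inE; exact: chain_inj.
Qed.

End Tableaux.

(** The first column has more than m boxes and increases strictly. *)
Lemma no_tableaux lam m (T : filling lam m) : is_partition lam -> (0 < nth 0%N lam m)%N -> ~~ semistandard T.
Proof.
move=> pl lm; apply/negP => ss.
have ex i : (i <= m)%N -> exists x : box lam, [/\ brow x = i, bcol x = 0%N & (i <= T x)%N].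
  elim: i => [|i IH] im.
    by have [x [xr xc]] := mkbox (leq_trans lm (lamn_dec pl im)); exists x.
  have [y [yr yc yT]] := IH (ltnW im).
  have [x [xr xc]] := mkbox (leq_trans lm (lamn_dec pl im)); exists x; split => //.
  by apply: leq_ltn_trans yT _; apply: ss_col => //; rewrite ?xr ?yr ?xc ?yc.
by have [x [_ _]] := ex m (leqnn m); rewrite leqNgt ltn_ord.
Qed.

(** * Passing to the limit: midpoint log-concavity *)

Lemma asy_limit (R : archiRealFieldType) k (u v w : nat -> R) (a b c K : R) :
  0 <= a -> 0 <= b -> 0 <= c -> 0 <= K ->
  (forall e, 0 < e -> exists N0, forall N, (N0 <= N)%N -> (a - e) * N%:R ^+ k <= u N) ->
  (forall e, 0 < e -> exists N0, forall N, (N0 <= N)%N -> (b - e) * N%:R ^+ k <= v N) ->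
  (forall e, 0 < e -> exists N0, forall N, (N0 <= N)%N -> w N <= (c + e) * N%:R ^+ k) ->
  (forall N, 0 <= w N) ->
  (exists N0, forall N, (N0 <= N)%N -> K * u N * v N <= w N ^+ 2) -> K * a * b <= c ^+ 2.
Proof.
move=> a0 b0 c0 K0 Hu Hv Hw w0 [N0 HN]; rewrite leNgt; apply/negP => lt.
have Kab : 0 < K * a * b by apply: le_lt_trans lt; apply: sqr_ge0.
have a1 : 0 < a by rewrite lt_def a0 andbT; apply: contraTneq Kab => ->; rewrite mulr0 mul0r ltxx.
have b1 : 0 < b by rewrite lt_def b0 andbT; apply: contraTneq Kab => ->; rewrite mulr0 ltxx.
pose dl := K * a * b - c ^+ 2; have dl0 : 0 < dl by rewrite subr_gt0.
pose T := 2%:R * c + 1 + K * (a + b); have T1 : 1 <= T.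
  by have := mulr_ge0 K0 (addr_ge0 a0 b0); rewrite /T; lra.
pose X := T + dl / a + dl / b + dl.
have da : 0 < dl / a by rewrite divr_gt0. have db : 0 < dl / b by rewrite divr_gt0.
have X0 : 0 < X by rewrite /X; lra.
(* X dominates T, dl/a, dl/b and dl, so this one e gives e T <= dl/2 together with e <= a, e <= b
   and e <= 1; then the errors cannot absorb the gap dl. *)
pose e := dl / (2%:R * X); have e0 : 0 < e by rewrite divr_gt0 // mulr_gt0.
have eX : e * X = dl / 2%:R by rewrite /e; field; rewrite gt_eqF.
have eT : e * T <= dl / 2%:R by rewrite -eX ler_wpM2l ?(ltW e0) // /X; lra.
have e1 : e <= 1.
  have : e * dl <= e * X by rewrite ler_wpM2l ?(ltW e0) // /X; lra.
  rewrite eX => H; rewrite -(ler_pM2r dl0); lra.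
have ea : e <= a.
  have : e * (dl / a) <= e * X by rewrite ler_wpM2l ?(ltW e0) // /X; lra.
  rewrite eX => H; have : e * (dl / a) <= dl by lra.
  by rewrite mulrCA ger_pMr // ler_pdivrMr // mul1r.
have eb : e <= b.
  have : e * (dl / b) <= e * X by rewrite ler_wpM2l ?(ltW e0) // /X; lra.
  rewrite eX => H; have : e * (dl / b) <= dl by lra.
  by rewrite mulrCA ger_pMr // ler_pdivrMr // mul1r.
have [N1 H1] := Hu e e0; have [N2 H2] := Hv e e0; have [N3 H3] := Hw e e0.
pose N := (maxn N0 (maxn N1 (maxn N2 N3))).+1.
have : (maxn N0 (maxn N1 (maxn N2 N3)) <= N)%N by apply: leqnSn.
rewrite !geq_max => /and4P[/HN {}HN /H1 {}H1 /H2 {}H2 /H3 {}H3].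
have P0 : 0 < N%:R ^+ k :> R by rewrite exprn_gt0 // ltr0n.
set P := N%:R ^+ k in H1 H2 H3 P0.
have aP : 0 <= (a - e) * P by rewrite mulr_ge0 ?subr_ge0 // ltW.
have bP : 0 <= (b - e) * P by rewrite mulr_ge0 ?subr_ge0 // ltW.
have L1 : K * ((a - e) * P) * ((b - e) * P) <= K * u N * v N.
  by apply: ler_pM => //; [exact: mulr_ge0 | exact: ler_wpM2l].
have L2 : w N ^+ 2 <= ((c + e) * P) ^+ 2.
  by apply: lerXn2r; rewrite ?nnegrE //; apply: le_trans (w0 N) H3.
have L3 : (K * (a - e) * (b - e)) * P ^+ 2 <= (c + e) ^+ 2 * P ^+ 2.
  rewrite (_ : _ * P ^+ 2 = K * ((a - e) * P) * ((b - e) * P)); last by ring.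
  by rewrite -exprMn; apply: le_trans L1 (le_trans HN L2).
rewrite ler_pM2r ?exprn_gt0 // in L3.
have ee : e * e <= e by rewrite ger_pMr.
have Kee : 0 <= K * (e * e) by exact: mulr_ge0 K0 (mulr_ge0 (ltW e0) (ltW e0)).
have E1 : K * (a - e) * (b - e) = K * a * b - e * (K * (a + b)) + K * (e * e) by ring.
have E2 : (c + e) ^+ 2 = c ^+ 2 + e * (2%:R * c) + e * e by ring.
have E3 : e * T = e * (2%:R * c) + e + e * (K * (a + b)) by rewrite /T; ring.
move: L3 eT; rewrite E1 E2 E3 /dl; move: dl0; rewrite /dl; lra.
Qed.

Lemma floor_ex (R : archiRealFieldType) (x : R) : 0 <= x -> exists n : nat, n%:R <= x < n%:R + 1.
Proof.
move=> x0; have ex : exists n : nat, x < n%:R + 1.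
  by exists (Num.bound x); apply: lt_le_trans (archi_boundP x0) _; rewrite lerDl.
case: (ex_minnP ex) => -[|n] xn nmin; first by exists 0%N; rewrite x0.
exists n.+1; rewrite xn andbT leNgt; apply/negP => xn'.
have := nmin n; rewrite -natr1 in xn'; rewrite xn' => /(_ isT); by rewrite ltnn.
Qed.

Section LogConcavity.
Variables (R : realType) (q n : nat).
Notation m := q.+1.
Variable b : nat -> nat.
Hypothesis sb : strict q b.
Hypothesis bz : tail0 q b.
Hypothesis bn : b q = n.+1.
Notation fullk := (fun _ : 'I_m => q).
Notation br := (fun r : 'I_q.+1 => b r).
Notation G x := (gdim R n br fullk x).
Let W : seq ('I_m -> nat) := shifted (fun=> (q - q)%N) (wts q m b).
Let D := (dsize q b + \sum_(i < m) (q - q))%N.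
Notation F := (Fw W).
Implicit Types (x y : 'X_{1..m}) (f g : 'I_m -> R).

Let bn' : (b q <= n.+1)%N. Proof. by rewrite bn. Qed.

Lemma homog_W : homogW D W.
Proof. exact: homog_shifted. Qed.

Lemma Fw_int x y : 4%:R ^+ D * F (rmnm R x) * F (rmnm R y) <= F (rmnm R (x + y + mone m)%MM) ^+ 2.
Proof.
have r0 (z : 'X_{1..m}) i : 0 <= rmnm R z i by apply: ler0n.
have qn : (q <= n)%N by apply: strict_n sb bn'.
have Glow : asyGe (fun x => G x) D (fun x => F (rmnm R x)).
  apply: asyGe_bound (asy_asyGe (fun z => asy_binsum R z homog_W)) => z.
  by apply: gdim_lower.
have Gup : asyLe (fun x => G x) D (fun x => F (rmnm R x)).
  by apply: (@gdim_upper R q n (n - q) _ b fullk) => //; rewrite subnK.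
have bm := gdim_brunn_minkowski R sb bn'.
set d := #|_| in bm.
have Dd : (D <= d)%N by rewrite /D subnn big1 // addn0; apply: card_fv.
apply: (@asy_limit R D (fun N => (G (x *+ N)%MM)%:R) (fun N => (G (y *+ N)%MM)%:R)
   (fun N => (G ((x + y + mone m) *+ N)%MM)%:R)); rewrite ?Fw_ge0 ?exprn_ge0 //.
- exact: Glow.
- exact: Glow.
- exact: Gup.
(* The exponent d may be lowered to D, and for N >= d the N copies of (1,...,1) contain the d copies
   required by Brunn-Minkowski. *)
exists d => N dN; apply: le_trans (_ : 4%:R ^+ d * (G (x *+ N)%MM)%:R * (G (y *+ N)%MM)%:R <= _).
  by rewrite !ler_wpM2r // ler_weXn2l // ler1n.
apply: le_trans (bm _ _) _; rewrite -!natrX ler_nat leq_exp2r //.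
have -> : ((x + y + mone m) *+ N = mone m *+ (N - d) + (mone m *+ d + (x *+ N + y *+ N)))%MM.
  apply/mnmP => i; rewrite !(mnmDE, mulmnE) !mnmE; nia.
exact: gdim_mono.
Qed.

(** Apply [Fw_int] to the integer parts of N f and N g; rounding and the extra (1,...,1) shift
    arguments by a bounded amount, invisible at order N^D. *)
Lemma Fw_real f g : (forall i, 0 < f i) -> (forall i, 0 < g i) ->
  4%:R ^+ D * F f * F g <= F (fun i => f i + g i) ^+ 2.
Proof.
move=> f0 g0.
have fl (h : 'I_m -> R) : (forall i, 0 < h i) -> forall N : nat, exists z : 'X_{1..m},
    forall i, (z i)%:R <= h i * N%:R < (z i)%:R + 1.
  move=> h0 N; have /choice[z Hz] : forall i, exists z : nat, z%:R <= h i * N%:R < z%:R + 1.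
    by move=> i; apply: floor_ex; rewrite mulr_ge0 // ltW.
  by exists [multinom z i | i < m] => i; rewrite mnmE.
have /choice[X HX] := fl f f0; have /choice[Y HY] := fl g g0.
have low (h : 'I_m -> R) (Z : nat -> 'X_{1..m}) : (forall i, 0 < h i) ->
    (forall N i, (Z N i)%:R <= h i * N%:R < (Z N i)%:R + 1) ->
    forall e, 0 < e -> exists N0, forall N, (N0 <= N)%N -> (F h - e) * N%:R ^+ D <= F (rmnm R (Z N)).
  move=> h0 HZ e e0; have [N0 H0] := asy_near (asy_Fw h (fun=> -1) homog_W) e0.
  exists (maxn N0 (\max_i Num.bound (h i)^-1)) => N; rewrite geq_max => /andP[/H0 {}H0 /bigmax_leqP HN].
  move: H0; rewrite ler_norml mulrBl lerBrDl => /andP[H0 _]; apply: le_trans H0 _.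
  apply: Fw_mono => i; have /andP[z1 z2] := HZ N i.
  have hN : 1 <= h i * N%:R.
    rewrite mulrC -ler_pdivrMr // mul1r; apply: ltW; apply: lt_le_trans (archi_boundP _) _.
      by rewrite invr_ge0 ltW.
    by rewrite ler_nat; apply: HN.
  by rewrite /rmnm; apply/andP; split; lra.
apply: (@asy_limit R D (fun N => F (rmnm R (X N))) (fun N => F (rmnm R (Y N)))
   (fun N => F (rmnm R (X N + Y N + mone m)%MM))).
- by apply: Fw_ge0 => i; apply: ltW.
- by apply: Fw_ge0 => i; apply: ltW.
- by apply: Fw_ge0 => i; rewrite addr_ge0 // ltW.
- by rewrite exprn_ge0.
- exact: low.
- exact: low.
- move=> e e0; have [N0 H0] := asy_near (asy_Fw (fun i => f i + g i) (fun=> 1) homog_W) e0.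
  exists N0 => N /H0; rewrite ler_norml mulrDl lerBlDl => /andP[_ H1]; apply: le_trans H1.
  apply: Fw_mono => i; rewrite ler0n /rmnm !mnmDE mnmE !natrD.
  by have /andP[x1 _] := HX N i; have /andP[y1 _] := HY N i; rewrite mulrDl; lra.
- by move=> N; apply: Fw_ge0 => i; apply: ler0n.
by exists 0%N => N _; apply: Fw_int.
Qed.

Lemma Fw_scale c f : F (fun i => c * f i) = c ^+ D * F f.
Proof.
rewrite /Fw big_distrr /=.
suff H (l : seq ('I_m -> nat)) : homogW D l ->
    \sum_(M <- l) mono_val M (fun i => c * f i) = \sum_(M <- l) c ^+ D * mono_val M f by apply: H homog_W.
elim: l => [|M l IH] hl; first by rewrite !big_nil.
rewrite !big_cons IH => [|M' M'l]; last by apply: hl; right.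
congr (_ + _); rewrite /mono_val -(hl M (or_introl erefl)) -prodrXr -big_split /=.
by apply: eq_bigr => i _; rewrite exprMn mulrA.
Qed.

(** Homogeneity of degree D turns f + g into twice the midpoint, and the square of 2^D cancels
    4^D. *)
Lemma Fw_midpoint f g : (forall i, 0 < f i) -> (forall i, 0 < g i) ->
  F f * F g <= F (fun i => (f i + g i) / 2%:R) ^+ 2.
Proof.
move=> f0 g0; have := Fw_real f0 g0.
have -> : (fun i => f i + g i) = (fun i => 2%:R * ((f i + g i) / 2%:R)).
  by apply/funext => i; rewrite mulrC divfK // pnatr_eq0.
have E : (2%:R ^+ D) ^+ 2 = 4%:R ^+ D :> R by rewrite exprAC -natrX.
by rewrite Fw_scale exprMn E -mulrA ler_pM2l // exprn_gt0 // ltr0n.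
Qed.

End LogConcavity.

(* From midpoint concavity to concavity *)
From mathcomp Require Import classical_sets reals topology normedtype sequences derive realfun exp convex.
Import numFieldNormedType.Exports.

Section Segment.
Variables (R : realType) (m : nat) (W : seq ('I_m -> nat)).
Notation F := (@Fw R m W).
Implicit Types (f g : 'I_m -> R).
Hypothesis mid : forall f g, (forall i, 0 < f i) -> (forall i, 0 < g i) ->
  F f * F g <= F (fun i => (f i + g i) / 2%:R) ^+ 2.
Hypothesis Fpos : forall f, (forall i, 0 < f i) -> 0 < F f.

Lemma Fw_line f g : exists P : {poly R}, forall t, F (fun i => f i + t * (g i - f i)) = P.[t].
Proof.
exists (\sum_(M <- W) \prod_i ((((f i)%:P + (g i - f i)%:P * 'X) ^+ M i) * ((M i)`!%:R^-1)%:P)) => t.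
rewrite horner_sum; apply: eq_bigr => M _; rewrite horner_prod; apply: eq_bigr => i _.
by rewrite hornerM hornerC horner_exp hornerD hornerM !hornerC hornerX [t * _]mulrC.
Qed.

Lemma segment_pos f g t : (forall i, 0 < f i) -> (forall i, 0 < g i) -> 0 <= t <= 1 ->
  forall i, 0 < f i + t * (g i - f i).
Proof.
move=> f0 g0 /andP[t0 t1] i.
have -> : f i + t * (g i - f i) = (1 - t) * f i + t * g i by ring.
have [->|tn] := eqVneq t 0; first by rewrite subr0 mul1r mul0r addr0.
by rewrite ltr_wpDl // ?mulr_ge0 ?subr_ge0 ?(ltW (f0 i)) // mulr_gt0 // lt_def tn.
Qed.

(** Subtract the chord and add e s (1 - s), which is strictly concave and zero at both ends. An
    interior minimum of this continuous function contradicts midpoint concavity; letting e shrink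
    gives the claim. *)
Lemma ln_segment f g t : (forall i, 0 < f i) -> (forall i, 0 < g i) -> 0 <= t <= 1 ->
  (1 - t) * ln (F f) + t * ln (F g) <= ln (F (fun i => f i + t * (g i - f i))).
Proof.
move=> f0 g0 t01; have [P HP] := Fw_line f g.
pose l t := (1 - t) * ln (F f) + t * ln (F g).
have P0 s : 0 <= s <= 1 -> 0 < P.[s] by move=> s01; rewrite -HP; apply/Fpos/segment_pos.
have e0P : P.[0] = F f by rewrite -HP; congr Fw; apply/funext => i; rewrite mul0r addr0.
have e1P : P.[1] = F g by rewrite -HP; congr Fw; apply/funext => i; rewrite mul1r addrC subrK.
rewrite HP -subr_ge0 -/(l t).
suff H e : 0 < e -> 0 <= ln P.[t] - l t + e * (t * (1 - t)).
  rewrite leNgt; apply/negP => neg.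
  have s0 : 0 <= t * (1 - t) by move: t01 => /andP[? ?]; rewrite mulr_ge0 // subr_ge0.
  have s1 : t * (1 - t) <= 1 by move: t01 => /andP[? ?]; nra.
  have := H (- (ln P.[t] - l t) / 2%:R); rewrite divr_gt0 ?oppr_gt0 // => /(_ isT).
  set A := ln P.[t] - l t in neg *; set B := t * (1 - t) in s0 s1 *; nra.
move=> e0; pose psi s := ln P.[s] - l s + e * (s * (1 - s)).
have cP : continuous (fun s : R => P.[s]) by first [exact: continuous_horner | move=> s; exact: continuous_horner].
have cpsi : {within `[0, 1], continuous psi}%classic.
  apply: continuous_in_subspaceT => s; rewrite inE /= in_itv /= => s01.
  apply: (@continuousD _ _ _ (fun s => ln P.[s] - l s) (fun s => e * (s * (1 - s)))).
    apply: (@continuousB _ _ _ (fun s => ln P.[s]) l).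
      by apply: continuous_comp; [exact: cP | apply: continuous_ln; exact: P0].
    apply: continuousD; apply: continuousM; try exact: cst_continuous; try exact: cvg_id.
    by apply: continuousB; [exact: cst_continuous | exact: cvg_id].
  apply: continuousM; first exact: cst_continuous.
  apply: continuousM; first exact: cvg_id.
  by apply: continuousB; [exact: cst_continuous | exact: cvg_id].
have [c c01 cmin] := EVT_min (@ler01 R) cpsi.
move: c01; rewrite in_itv /= => c01.
apply: le_trans (_ : psi c <= _); last by apply: cmin; rewrite in_itv.
have psi0 : psi 0 = 0 by rewrite /psi /l e0P; ring.
have psi1 : psi 1 = 0 by rewrite /psi /l e1P; ring.
have [->|cn0] := eqVneq c 0; first by rewrite psi0.
have [->|cn1] := eqVneq c 1; first by rewrite psi1.
have /andP[c0 c1] := c01.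
have cp : 0 < c by rewrite lt_def cn0.
have cl : c < 1 by rewrite lt_def eq_sym cn1.
(* The largest radius keeping c - dd and c + dd inside the segment; the added term lowers the sum of
   the two values by 2 e dd^2. *)
pose dd := Num.min c (1 - c).
have dd0 : 0 < dd by rewrite lt_min cp subr_gt0.
have ddc : dd <= c by rewrite ge_min lexx.
have dd1 : dd <= 1 - c by rewrite ge_min lexx orbT.
have m1 : 0 <= c - dd <= 1 by apply/andP; split; lra.
have m2 : 0 <= c + dd <= 1 by apply/andP; split; lra.
have := mid (segment_pos f0 g0 m1) (segment_pos f0 g0 m2).
have -> : (fun i => (f i + (c - dd) * (g i - f i) + (f i + (c + dd) * (g i - f i))) / 2%:R) =
   (fun i => f i + c * (g i - f i)) by apply/funext => i; field.
rewrite !HP => mm.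
have lnm : ln P.[c - dd] + ln P.[c + dd] <= 2%:R * ln P.[c].
  rewrite -lnM ?posrE ?P0 //; have -> : 2%:R * ln P.[c] = ln (P.[c] ^+ 2).
    by rewrite lnXn ?P0 // mulr_natl.
  by rewrite ler_ln ?posrE ?mulr_gt0 ?exprn_gt0 ?P0.
have q1 : psi c <= psi (c - dd) by apply: cmin; rewrite in_itv.
have q2 : psi c <= psi (c + dd) by apply: cmin; rewrite in_itv.
have edd : 0 < e * (dd * dd) by rewrite !mulr_gt0.
exfalso; move: q1 q2 lnm edd; rewrite /psi /l.
set A := ln P.[c]; set A1 := ln P.[c - dd]; set A2 := ln P.[c + dd]; set U := ln (F f); set V := ln (F g).
move=> q1 q2 q3 q4.
have : (A1 - ((1 - (c - dd)) * U + (c - dd) * V) + e * ((c - dd) * (1 - (c - dd)))) +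
   (A2 - ((1 - (c + dd)) * U + (c + dd) * V) + e * ((c + dd) * (1 - (c + dd)))) =
   (A1 + A2) - 2%:R * ((1 - c) * U + c * V) + 2%:R * (e * (c * (1 - c))) - 2%:R * (e * (dd * dd)) by ring.
by move: q1 q2; lra.
Qed.

End Segment.

(* Assembling the theorem *)
From mathcomp Require Import classical_sets exp convex interval_inference.

Lemma card_box lam : #|box lam| = sumn lam.
Proof.
rewrite /box card_tagged; congr sumn.
rewrite (eq_map (fun i : 'I_(size lam) => card_ord (nth 0%N lam i))).
by rewrite (map_comp (nth 0%N lam) val) val_enum_ord -/(mkseq _ _) mkseq_nth.
Qed.

Lemma mdeg_weight lam m (T : filling lam m) : mdeg (weight T) = sumn lam.
Proof.
rewrite mdegE -card_box -sum1_card (partition_big T xpredT) //=.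
apply: eq_bigr => i _; rewrite mnmE -sum1_card; apply: eq_bigl => x; by rewrite !inE.
Qed.

Lemma mcoeff_schur (R : realType) m lam (mu : 'X_{1..m}) : (schur R m lam)@_mu = (kostka lam mu)%:R.
Proof.
rewrite /schur raddf_sum /= (eq_bigr (fun T : filling lam m => (weight T == mu)%:R)) => [|T _]; last exact: mcoeffX.
rewrite -natr_sum /kostka -sum1_card; congr _%:R.
rewrite [RHS](eq_bigl (fun T : filling lam m => semistandard T && (weight T == mu))) // big_mkcondr /=.
by apply: eq_bigr => T _; case: eqP.
Qed.

Lemma normalize_schurE (R : realType) m lam :
  normalize (schur R m lam) =
    \sum_(mu : 'X_{1..m < (sumn lam).+1}) ((kostka lam mu)%:R / (mnm_fact mu)%:R) *: 'X_[mu].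
Proof.
apply/mpolyP => mu; rewrite mcoeff_normalize mcoeff_schur raddf_sum /=.
have [lt|ge] := ltnP (mdeg mu) (sumn lam).+1.
  rewrite (bigD1 (BMultinom lt)) //= mcoeffZ mcoeffX eqxx mulr1 big1 ?addr0 // => nu ne.
  rewrite mcoeffZ mcoeffX (_ : (_ == _) = false) ?mulr0 //.
  by apply: contraNF ne => /eqP E; apply/eqP/val_inj.
have -> : kostka lam mu = 0%N.
  apply: eq_card0 => T; rewrite !inE; apply/negbTE; rewrite negb_and orbC; apply/orP; left.
  by apply: contraTneq ge => <-; rewrite mdeg_weight ltnn.
rewrite mul0r big1 // => nu _; rewrite mcoeffZ mcoeffX (_ : (_ == _) = false) ?mulr0 //.
by apply: contraTF ge => /eqP <-; rewrite -ltnNge bmdeg.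
Qed.

Lemma poly_fun_schur (R : realType) m lam (x : 'rV[R]_m) :
  poly_fun (normalize (schur R m lam)) x =
  \sum_(T : filling lam m | semistandard T) \prod_(i < m) ux (fun i => x 0 i) i (weight T i).
Proof.
have E : normalize (schur R m lam) =
    \sum_(T : filling lam m | semistandard T) normalize 'X_[weight T] by rewrite /schur linear_sum.
rewrite /poly_fun E raddf_sum /=; apply: eq_bigr => T _.
rewrite normalizeX mevalZ mevalX /mnm_fact natr_prod -prodfV -big_split /=.
by apply: eq_bigr => i _; rewrite uxE mulrC.
Qed.

Theorem theorem1 (R : realType) (lam : seq nat) (m : nat)
    (hlam : is_partition lam) (hm : (1 <= m)%N) :
  normalize (schur R m lam) =
    \sum_(mu : 'X_{1..m < (sumn lam).+1})
      ((kostka lam mu)%:R / (mnm_fact mu)%:R) *: 'X_[mu]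
  /\
  (normalize (schur R m lam) = 0 \/
   log_concave_on (@positive_orthant R m)
     (poly_fun (normalize (schur R m lam)))).
Proof.
split; first exact: normalize_schurE.
have [lm|lm] := posnP (nth 0%N lam m); last first.
  left; rewrite /schur big1 ?linear0 // => T ss; have := no_tableaux T hlam lm; by rewrite ss.
case: m hm lm => // q _ lm.
pose lv := lamV lam q.+1; pose b := bof q lv.
have lvE i : ent lv i = nth 0%N lam i by apply: ent_lamV.
have lvd : vdec lv by move=> j; rewrite !lvE; apply: lamn_dec.
have lvs : vsupp q.+1 lv by move=> j qj; rewrite ent_out.
have bE r : (r <= q)%N -> b r = (nth 0%N lam (q - r) + r.+1)%N by move=> rq; rewrite /b /bof rq lvE.
have sb : strict q b.
  split=> [|r rq]; first by rewrite bE // addn1.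
  rewrite bE ?(ltnW rq) // bE //; have : (nth 0%N lam (q - r) <= nth 0%N lam (q - r.+1))%N.
    by apply: lamn_dec => //; lia.
  lia.
have bz : tail0 q b by move=> r qr; rewrite /b /bof leqNgt qr.
have bn : b q = (nth 0%N lam 0 + q).+1 by rewrite bE // subnn addnS.
(* All q cuts are present, so the shift q - q is zero and the exponents are the tableau weights
   themselves. *)
pose W : seq ('I_q.+1 -> nat) := shifted (fun=> (q - q)%N) (wts q q.+1 b).
have FE x : poly_fun (normalize (schur R q.+1 lam)) x = Fw W (fun i => x 0 i).
  rewrite poly_fun_schur (@sum_tableaux lam q.+1 hlam lm R) Fw_ux /W /b.
  rewrite (@shifted_gt q.+1 _ R (ux (fun i => x 0 i)) _ q lv) //.
  by congr gt; apply/funext => i; apply/funext => d; rewrite subnn addn0.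
case EW : W => [|M l].
  (* With no exponent at all the polynomial function is zero everywhere, hence so is the
     polynomial. *)
  left; apply/eqP; apply: contrapT => /negP/mpoly_nonroot[z]; apply/negP; rewrite negbK.
  have := FE (\row_i z i); rewrite /poly_fun EW /Fw big_nil => <-; apply/eqP; congr meval.
  by apply/funext => i; rewrite mxE.
have Fpos (f : 'I_q.+1 -> R) : (forall i, 0 < f i) -> 0 < Fw W f.
  move=> f0; rewrite EW /Fw big_cons ltr_wpDr //.
    by apply: sumr_ge0 => M' _; apply: mono_val_ge0 => i; apply: ltW.
  by apply: prodr_gt0 => i _; rewrite divr_gt0 ?exprn_gt0 // ltr0n fact_gt0.
right; split; first by move=> x xp; rewrite FE; apply: Fpos.
move=> t x y; rewrite !inE => xp yp.
have t01 : 0 <= t%:num <= 1 by apply/andP; split; [exact: ge0 | exact: le1].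
have := @ln_segment R q.+1 W (@Fw_midpoint R q _ b sb bz bn) Fpos (fun i => y 0 i) (fun i => x 0 i) t%:num yp xp t01.
rewrite -[conv t x y]/(t%:num *: (x : 'rV[R]_q.+1) + (1 - t%:num) *: (y : 'rV[R]_q.+1)).
rewrite -[X in _ -> _ <= X]/(t%:num * (- ln (poly_fun (normalize (schur R q.+1 lam)) x)) +
  (1 - t%:num) * (- ln (poly_fun (normalize (schur R q.+1 lam)) y))).
rewrite !FE.
have -> : (fun i => (t%:num *: (x : 'rV[R]_q.+1) + (1 - t%:num) *: (y : 'rV[R]_q.+1)) 0 i) =
   (fun i => y 0 i + t%:num * (x 0 i - y 0 i)).
  by apply/funext => i; rewrite !mxE; ring.
rewrite !mulrN -opprD lerN2 addrC; exact.
Qed.
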